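(* Let $X$ be a complex Banach space and $I=[0,1]$. Suppose that for every $t\in I$ the operator $A(t):D(A(t))\subset X\to X$ is the generator of a strongly continuous semigroup on $X$, that the family $A=(A(t))_{t\in I}$ is $(M,\omega)$-stable for some $M\in[1,\infty)$ and $\omega\in\mathbb{R}$, and that for some complex numbers $\mu(s,t)\in\mathbb{C}$ $$A(s)\,e^{A(t)\tau}\supset e^{A(t)\tau}\big(A(s)+\mu(s,t)\,\tau\big)\qquad\text{for all } s,t\in I \text{ and } \tau\in[0,\infty).$$ Suppose further that the maximal continuity subspace $$Y^{\circ}:=\Big\{y\in\bigcap_{\tau\in I}D(A(\tau)):\ t\mapsto A(t)y \text{ is continuous on } I\Big\}$$ is dense in $X$ and that $(s,t)\mapsto\mu(s,t)$ is continuous on $I^2$. Then there exists a unique evolution system $U$ for $A$ on $Y^{\circ}$, and it is given by $$U(t,s)=e^{\overline{\left(\int_s^tA(\tau)\,d\tau\right)^{\circ}}}\;e^{\frac12\int_s^t\int_s^{\tau}\mu(\tau,\sigma)\,d\sigma\,d\tau}\qquad(0\le s\le t\le1),$$ where $\big(\int_s^tA(\tau)\,d\tau\big)^{\circ}$ is the operator with domain $Y^{\circ}$ defined by $y\mapsto\int_s^tA(\tau)y\,d\tau$; this operator is closable, and its closure generates a strongly continuous semigroup on $X$, whose value at time $1$ is the first factor in the formula.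
   Context: Write $\Delta=\{(s,t)\in I^2:s\le t\}$. An inclusion $S\supset T$ of (possibly unbounded) operators means that $S$ extends $T$; sums and products of operators have their natural domains. $e^{B\,\cdot}$ denotes the strongly continuous semigroup generated by $B$. $(M,\omega)$-stability: a family $A$ of semigroup generators $A(t)$, $t\in I$, on $X$ is $(M,\omega)$-stable if $\|e^{A(t_n)s_n}\cdots e^{A(t_1)s_1}\|\le Me^{\omega(s_1+\dots+s_n)}$ for all $n\in\mathbb{N}$, all $t_1,\dots,t_n\in I$ with $t_n\ge\dots\ge t_1$, and all $s_1,\dots,s_n\in[0,\infty)$. Evolution system: let $Y$ be a dense subspace of $X$ contained in $\bigcap_{\tau\in I}D(A(\tau))$. An evolution system for $A$ on $Y$ is a family of bounded operators $U(t,s)$ on $X$, $(s,t)\in\Delta$, such that (i) for every $y\in Y$ and $s\in[0,1)$ the map $[s,1]\ni t\mapsto U(t,s)y$ is a continuously differentiable solution, with values in $Y$, of the initial value problem $x'(t)=A(t)x(t)$ $(t\in[s,1])$, $x(s)=y$; (ii) $U(t,s)U(s,r)=U(t,r)$ for all $r\le s\le t$ in $I$, and $\Delta\ni(s,t)\mapsto U(t,s)$ is strongly continuous. *)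

(* Defs.v *)
From Stdlib Require Import Reals.
From Coquelicot Require Import Coquelicot.
Open Scope R_scope.

(** [RInt] and derivatives of functions of a real variable require a normed
    module over [R].  [real_of X] is the complex Banach space [X], with the same
    addition, norm and uniform structure, seen as a real one.  It is not
    declared canonical, since it has the same carrier as [X]. *)

Section RestrictionOfScalars.

Context (X : CompleteNormedModule C_AbsRing).

Definition rscal (r : R) (x : X) : X := scal (RtoC r : C_AbsRing) x.

Lemma rscal_assoc (r s : R) (x : X) : rscal r (rscal s x) = rscal (mult r s) x.
Proof.
  refine (eq_trans (scal_assoc (RtoC r : C_AbsRing) (RtoC s : C_AbsRing) x) _).
  exact (f_equal (fun z : C_AbsRing => scal z x) (eq_sym (RtoC_mult r s))).
Qed.

Lemma rscal_one (x : X) : rscal one x = x.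
Proof. exact (scal_one x). Qed.

Lemma rscal_distr_l (r : R) (x y : X) :
  rscal r (plus x y) = plus (rscal r x) (rscal r y).
Proof. exact (scal_distr_l _ x y). Qed.

Lemma rscal_distr_r (r s : R) (x : X) :
  rscal (plus r s) x = plus (rscal r x) (rscal s x).
Proof.
  refine (eq_trans (f_equal (fun z : C_AbsRing => scal z x) (RtoC_plus r s)) _).
  exact (scal_distr_r (RtoC r : C_AbsRing) (RtoC s : C_AbsRing) x).
Qed.

Definition real_ModuleSpace_mixin :=
  ModuleSpace.Mixin R_Ring X rscal
    rscal_assoc rscal_one rscal_distr_l rscal_distr_r.

Definition real_NormedModuleAux : NormedModuleAux R_AbsRing :=
  NormedModuleAux.Pack R_AbsRing X
    (NormedModuleAux.Class R_AbsRing X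
       (ModuleSpace.Class R_Ring X _ real_ModuleSpace_mixin)
       (UniformSpace.class X)) X.

Lemma norm_rscal (r : R) (x : X) : norm (rscal r x) <= Rabs r * norm x.
Proof. rewrite <- Cmod_R; exact (norm_scal (RtoC r : C_AbsRing) x). Qed.

Definition real_NormedModule_mixin :=
  NormedModule.Mixin R_AbsRing real_NormedModuleAux
    (@norm C_AbsRing X) (@norm_factor C_AbsRing X)
    norm_triangle norm_rscal norm_compat1 norm_compat2 norm_eq_zero.

Definition real_of : CompleteNormedModule R_AbsRing :=
  CompleteNormedModule.Pack R_AbsRing X
    (CompleteNormedModule.Class R_AbsRing X
       (NormedModule.Class R_AbsRing X _ real_NormedModule_mixin)
       (CompleteNormedModule.mixin C_AbsRing X
          (CompleteNormedModule.class C_AbsRing X))) X.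

End RestrictionOfScalars.

Definition Cexp (z : C) : C :=
  Cmult (RtoC (exp (Re z))) (cos (Im z), sin (Im z)).

Definition Icc (a b : R) (t : R) : Prop := a <= t <= b.

Definition I01 : R -> Prop := Icc 0 1.

Definition Delta01 (p : R * R) : Prop := I01 (fst p) /\ I01 (snd p) /\ fst p <= snd p.

Definition adherent {T : UniformSpace} (P : T -> Prop) (x : T) : Prop :=
  forall Q : T -> Prop, locally x Q -> exists z, P z /\ Q z.

Definition is_dense {T : UniformSpace} (P : T -> Prop) : Prop :=
  forall x, adherent P x.

(** One-sided where [t] is an end point of the interval [D]. *)
Definition is_derive_within {V : NormedModule R_AbsRing}
    (D : R -> Prop) (f : R -> V) (t : R) (l : V) : Prop :=
  filterdiff f (within D (locally t)) (fun h => scal h l).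

Section Operators.

Context {X : CompleteNormedModule C_AbsRing}.

(** The values of [op] outside [dom] carry no meaning.  Linearity is not part
    of the record: it follows from [generates] for the operators [A t], and holds
    for [integral_op] and its closure by construction. *)
Record operator := Operator { dom : X -> Prop; op : X -> X }.

Definition everywhere (L : X -> X) : operator := Operator (fun _ => True) L.

Definition op_plus (S T : operator) : operator :=
  Operator (fun x => dom S x /\ dom T x) (fun x => plus (op S x) (op T x)).

Definition op_comp (S T : operator) : operator :=
  Operator (fun x => dom T x /\ dom S (op T x)) (fun x => op S (op T x)).

Definition extends (S T : operator) : Prop :=
  forall x, dom T x -> dom S x /\ op S x = op T x.

Definition graph (T : operator) (p : X * X) : Prop :=
  dom T (fst p) /\ op T (fst p) = snd p.

(** [T] is closable iff it has a closure, i.e. iff the closure of its graph is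
    again the graph of an operator. *)
Definition is_closure (B T : operator) : Prop :=
  forall p : X * X, graph B p <-> adherent (graph T) p.

(** [is_linear] includes boundedness. *)
Definition is_C0_semigroup (S : R -> X -> X) : Prop :=
  (forall t, 0 <= t -> is_linear (S t)) /\
  (forall x, S 0 x = x) /\
  (forall s t x, 0 <= s -> 0 <= t -> S (s + t) x = S s (S t x)) /\
  (forall x, continuous_on (fun t => 0 <= t) (fun t => S t x)).

(** [B] is the generator of the strongly continuous semigroup [S],
    that is, [S t] is $e^{Bt}$. *)
Definition generates (B : operator) (S : R -> X -> X) : Prop :=
  is_C0_semigroup S /\
  forall x y, graph B (x, y) <->
    filterlim (fun h : R => scal (RtoC (/ h) : C_AbsRing) (minus (S h x) x))
      (at_right 0) (locally y).

(** [E t s] stands for $e^{A(t)s}$, and the product is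
    $e^{A(t_n)s_n}\cdots e^{A(t_0)s_0}$, with $n+1$ factors. *)
Fixpoint semigroup_prod (E : R -> R -> X -> X) (t s : nat -> R) (n : nat)
    (x : X) : X :=
  match n with
  | O => E (t O) (s O) x
  | S m => E (t n) (s n) (semigroup_prod E t s m x)
  end.

Definition stable (M omega : R) (E : R -> R -> X -> X) : Prop :=
  forall (n : nat) (t s : nat -> R),
    (forall i, (i <= n)%nat -> I01 (t i) /\ 0 <= s i) ->
    (forall i, (i < n)%nat -> t i <= t (S i)) ->
    forall x, norm (semigroup_prod E t s n x)
              <= M * exp (omega * sum_f_R0 s n) * norm x.

Definition maximal_continuity_subspace (A : R -> operator) (y : X) : Prop :=
  (forall t, I01 t -> dom (A t) y) /\ continuous_on I01 (fun t => op (A t) y).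

Definition is_C1_solution (A : R -> operator) (Y : X -> Prop) (s : R) (y : X)
    (x : R -> X) : Prop :=
  x s = y /\
  (forall t, Icc s 1 t -> Y (x t) /\ dom (A t) (x t)) /\
  exists x' : R -> X,
    continuous_on (Icc s 1) x' /\
    forall t, Icc s 1 t ->
      is_derive_within (V := real_of X) (Icc s 1) x t (x' t) /\
      x' t = op (A t) (x t).

(** Only the values [U t s] with [(s, t)] in [Delta01] matter.  [Y] is meant to
    be a dense subspace contained in the domains of all [A t]. *)
Definition is_evolution_system (A : R -> operator) (Y : X -> Prop)
    (U : R -> R -> X -> X) : Prop :=
  (forall s t, Delta01 (s, t) -> is_linear (U t s)) /\
  (forall y s, Y y -> 0 <= s < 1 ->
     is_C1_solution A Y s y (fun t => U t s y)) /\
  (forall r s t x, I01 r -> I01 s -> I01 t -> r <= s -> s <= t ->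
     U t s (U s r x) = U t r x) /\
  (forall x, continuous_on Delta01 (fun p => U (snd p) (fst p) x)).

Definition integral_op (A : R -> operator) (s t : R) : operator :=
  Operator (maximal_continuity_subspace A)
    (fun y => RInt (V := real_of X) (fun tau => op (A tau) y) s t).

End Operators.

Arguments operator X : clear implicits.

Definition double_integral (mu : R -> R -> C) (s t : R) : C :=
  RInt (V := C_R_CompleteNormedModule)
    (fun tau => RInt (V := C_R_CompleteNormedModule)
                  (fun sigma => mu tau sigma) s tau) s t.

(* Main.v *)
Require Import Defs.
From Stdlib Require Import Reals Lra Lia List ClassicalEpsilon.
From Coquelicot Require Import Coquelicot.
Open Scope R_scope.

(** Formally, the commutator of [A s] and [A t] is the scalar [mu s t], so that the
    Baker-Campbell-Hausdorff series stops after its first correction: a product of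
    exponentials of operators of the family is the exponential of their sum, up to a
    scalar factor whose exponent is half the sum of the commutators.  The proof turns
    this into statements about semigroups on the maximal continuity subspace [Y],
    which all the semigroups leave invariant.

    Let [T1] and [T2] be semigroups whose generators on [Y] are combinations of the
    operators [A r], with scalar commutator [c].  Uniqueness for the initial value
    problem gives the Weyl relation [T1 p T2 q = exp (p q c) T2 q T1 p]
    ([weyl_commutation]), whence [exp (- c t^2 / 2) T1 t T2 t] is a semigroup whose
    generator extends the sum of the two generators ([weyl_sum]).  By induction, the
    product of the factors [e^(A(t_i) h r)] for a partition of [[s, t]], times a
    scalar, is a semigroup in [r] whose generator extends a Riemann sum of [A]
    ([weyl_product]).  Stability bounds it uniformly in the partition.

    Duhamel's formula compares two such semigroups on [Y] ([weyl_comparison]).  The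
    difference is controlled by the difference of the two Riemann sums and by their
    commutator, and both tend to 0 as the partitions get finer: the commutator
    because the one of a generator with itself vanishes.  So the semigroups converge,
    and the limit is a semigroup [T] whose generator extends the integral of [A] over
    [[s, t]] on [Y] ([weyl_limit], [segment_semigroup_exists]).  Since [Y] is dense
    and invariant, it is a core, and the generator of [T] is the closure of the
    integral ([invariant_dense_core], [segment_generator_core]).

    The operators [U(t, s) = exp (1/2 ∫∫ mu) T 1] satisfy [U(t, s) U(s, r) = U(t, r)]:
    by [weyl_sum], multiplying the semigroups of two adjacent intervals gives the one
    of their union up to a scalar, which is the integral of [mu] over the rectangle by
    which the triangles of the double integrals differ ([evolution_cocycle]).  The
    cocycle identity reduces the differential equation to the derivative at the
    diagonal, which is elementary.  Finally, if [V] is another evolution system, then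
    [τ ↦ U(t, τ) V(τ, s) y] has right derivative 0, so that [V = U]
    ([evolution_unique]).

    Everywhere only right derivatives are used, through a mean value inequality for
    continuous functions ([mean_value_right]); this avoids vector-valued integrals of
    orbits and the uniform boundedness of unknown evolution systems. *)

(* The structures are given explicitly: the ones that unification finds depend
   on the shape of the arguments, and rewriting distinguishes them. *)
Notation "x ⊕ y" := (@plus (CompleteNormedModule.AbelianMonoid C_AbsRing _) x y)
  (at level 50, left associativity).
Notation "x ⊖ y" := (@minus (CompleteNormedModule.AbelianGroup C_AbsRing _) x y)
  (at level 50, left associativity).
Notation "𝟎" := (@zero (CompleteNormedModule.AbelianMonoid C_AbsRing _)).
Notation "c ⊙ x" :=
  (@scal C_Ring (CompleteNormedModule.ModuleSpace C_AbsRing _) (c%R : C) x)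
  (at level 40, left associativity).
Notation "‖ x ‖" := (@norm C_AbsRing (CompleteNormedModule.NormedModule C_AbsRing _) x)
  (at level 20, x at level 60).

(** * Linear identities *)

Section LinearIdentities.

Context {X : ModuleSpace C_Ring}.

(** The syntax of the linear combinations that [vec] compares; [VAtom n] is the
    [n]-th entry of a list of vectors. *)
Inductive vexpr :=
  | VAtom (n : nat) | VZero | VPlus (a b : vexpr) | VMinus (a b : vexpr)
  | VOpp (a : vexpr) | VScal (c : C) (a : vexpr).

Fixpoint vdenote (env : list X) (e : vexpr) : X :=
  match e with
  | VAtom n => nth n env zero
  | VZero => zero
  | VPlus a b => plus (vdenote env a) (vdenote env b)
  | VMinus a b => minus (vdenote env a) (vdenote env b)
  | VOpp a => opp (vdenote env a)
  | VScal c a => scal (c : C_Ring) (vdenote env a)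
  end.

Fixpoint vcoef (e : vexpr) (i : nat) : C :=
  match e with
  | VAtom n => if Nat.eqb n i then RtoC 1 else RtoC 0
  | VZero => RtoC 0
  | VPlus a b => Cplus (vcoef a i) (vcoef b i)
  | VMinus a b => Cminus (vcoef a i) (vcoef b i)
  | VOpp a => Copp (vcoef a i)
  | VScal c a => Cmult c (vcoef a i)
  end.

Fixpoint lincomb (f : nat -> C) (env : list X) : X :=
  match env with
  | nil => zero
  | x :: l => plus (scal (f O : C_Ring) x) (lincomb (fun i => f (S i)) l)
  end.

Lemma lincomb_ext f g env :
  (forall i, (i < length env)%nat -> f i = g i) -> lincomb f env = lincomb g env.
Proof.
  revert f g; induction env as [|x l IH]; intros f g H; simpl; [easy|].
  rewrite (H O) by (simpl; lia). f_equal.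
  apply IH; intros i Hi; apply H; simpl; lia.
Qed.

Lemma lincomb_zero env : lincomb (fun _ => RtoC 0) env = zero.
Proof.
  induction env as [|x l IH]; simpl; [easy|].
  rewrite IH. refine (eq_trans (plus_zero_r _) _). exact (scal_zero_l x).
Qed.

Lemma lincomb_plus f g env :
  lincomb (fun i => Cplus (f i) (g i)) env = plus (lincomb f env) (lincomb g env).
Proof.
  revert f g; induction env as [|x l IH]; intros f g; simpl.
  - symmetry; exact (plus_zero_r _).
  - rewrite (IH (fun i => f (S i)) (fun i => g (S i))).
    rewrite (scal_distr_r (f O : C_Ring) (g O) x : scal (Cplus (f O) (g O) : C_Ring) x = _).
    rewrite <- !plus_assoc; f_equal.
    rewrite !plus_assoc; f_equal. apply plus_comm.
Qed.

Lemma lincomb_scal c f env :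
  lincomb (fun i => Cmult c (f i)) env = scal (c : C_Ring) (lincomb f env).
Proof.
  revert f; induction env as [|x l IH]; intros f; simpl.
  - symmetry; exact (scal_zero_r _).
  - rewrite (IH (fun i => f (S i))), scal_distr_l. f_equal.
    symmetry; exact (scal_assoc (c : C_Ring) (f O) x).
Qed.

Lemma lincomb_opp f env :
  lincomb (fun i => Copp (f i)) env = opp (lincomb f env).
Proof.
  rewrite (lincomb_ext _ (fun i => Cmult (RtoC (-1)) (f i))).
  - rewrite lincomb_scal.
    replace (RtoC (-1) : C) with (opp one : C_Ring).
    + apply scal_opp_one.
    + apply injective_projections; simpl; ring.
  - intros i _. apply injective_projections; simpl; ring.
Qed.

Lemma lincomb_delta n env :
  lincomb (fun i => if Nat.eqb n i then RtoC 1 else RtoC 0) env = nth n env zero.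
Proof.
  revert n; induction env as [|x l IH]; intros [|n]; simpl; try easy.
  - rewrite lincomb_zero. refine (eq_trans (plus_zero_r _) _). exact (scal_one x).
  - rewrite IH. rewrite (scal_zero_l x : scal (RtoC 0 : C_Ring) x = zero).
    apply plus_zero_l.
Qed.

Lemma vdenote_lincomb env e : vdenote env e = lincomb (vcoef e) env.
Proof.
  induction e as [n| |a IHa b IHb|a IHa b IHb|a IHa|c a IHa]; simpl.
  - symmetry; apply lincomb_delta.
  - symmetry; apply lincomb_zero.
  - now rewrite IHa, IHb, <- lincomb_plus.
  - rewrite IHa, IHb. unfold minus. rewrite <- lincomb_opp, <- lincomb_plus. easy.
  - now rewrite IHa, <- lincomb_opp.
  - now rewrite IHa, <- lincomb_scal.
Qed.

Fixpoint same_coefs (n : nat) (a b : vexpr) : Prop :=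
  match n with
  | O => True
  | S m => vcoef a m = vcoef b m /\ same_coefs m a b
  end.

Lemma vexpr_eq env a b :
  same_coefs (length env) a b -> vdenote env a = vdenote env b.
Proof.
  intros H. rewrite !vdenote_lincomb. apply lincomb_ext.
  induction (length env) as [|n IH]; intros i Hi; [lia|].
  destruct H as [H1 H2]. destruct (Nat.eq_dec i n) as [->|]; [exact H1|].
  apply IH; [exact H2|lia].
Qed.

End LinearIdentities.

Ltac in_env x l :=
  lazymatch l with
  | nil => constr:(false)
  | x :: _ => constr:(true)
  | _ :: ?r => in_env x r
  end.
Ltac env_index x l :=
  lazymatch l with
  | x :: _ => constr:(O)
  | _ :: ?r => let n := env_index x r in constr:(S n)
  end.
Ltac atoms l e :=
  lazymatch e with
  | @plus _ ?a ?b => let l1 := atoms l a in atoms l1 b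
  | @minus _ ?a ?b => let l1 := atoms l a in atoms l1 b
  | @opp _ ?a => atoms l a
  | @scal _ _ ?c ?a => atoms l a
  | @zero _ => l
  | _ => lazymatch in_env e l with
         | true => l
         | false => constr:(e :: l)
         end
  end.
Ltac reify l e :=
  lazymatch e with
  | @plus _ ?a ?b => let a' := reify l a in let b' := reify l b in constr:(VPlus a' b')
  | @minus _ ?a ?b => let a' := reify l a in let b' := reify l b in constr:(VMinus a' b')
  | @opp _ ?a => let a' := reify l a in constr:(VOpp a')
  | @scal _ _ ?c ?a => let a' := reify l a in constr:(VScal c a')
  | @zero _ => constr:(VZero)
  | _ => let n := env_index e l in constr:(VAtom n)
  end.

(** Reduces an equality of linear combinations in a complex vector space to the
    equality of the coefficients of the atoms. *)
Ltac vec_coefs :=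
  lazymatch goal with
  | |- @eq ?T ?a ?b =>
    let l1 := atoms (@nil T) a in
    let l := atoms l1 b in
    let a' := reify l a in
    let b' := reify l b in
    refine (vexpr_eq l a' b' _);
    simpl; repeat split;
    rewrite ?RtoC_plus, ?RtoC_minus, ?RtoC_mult, ?RtoC_opp
  end.
Ltac vec := vec_coefs; ring.

(** * Right derivatives *)

Section RightDerivatives.

Context {X : CompleteNormedModule C_AbsRing}.
Implicit Types (x y z : X) (f u : R -> X).

Lemma norm_pos x : 0 <= ‖x‖.
Proof. exact (norm_ge_0 x). Qed.

Lemma norm_opposite x : ‖opp x‖ = ‖x‖.
Proof. exact (norm_opp x). Qed.

Lemma norm_null : ‖𝟎 : X‖ = 0.
Proof. exact (norm_zero (V := X)). Qed.

Lemma linear_sub (L : X -> X) x y : is_linear L -> L (x ⊖ y) = L x ⊖ L y.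
Proof. exact (linear_minus L x y). Qed.

Lemma linear_add (L : X -> X) x y : is_linear L -> L (x ⊕ y) = L x ⊕ L y.
Proof. intros H. exact (linear_plus L H x y). Qed.

Lemma linear_cscal (L : X -> X) (c : C) x : is_linear L -> L (c ⊙ x) = c ⊙ L x.
Proof. intros H. exact (linear_scal L H c x). Qed.

Lemma norm_cscal (c : C) x : ‖c ⊙ x‖ <= Cmod c * ‖x‖.
Proof. exact (norm_scal (c : C_AbsRing) x). Qed.

Lemma norm_real_scal (h : R) x : ‖h ⊙ x‖ <= Rabs h * ‖x‖.
Proof. rewrite <- Cmod_R. apply norm_cscal. Qed.

Lemma norm_plus_le x y a b : ‖x‖ <= a -> ‖y‖ <= b -> ‖x ⊕ y‖ <= a + b.
Proof.
  intros H1 H2. apply Rle_trans with (‖x‖ + ‖y‖); [exact (norm_triangle x y)|].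
  now apply Rplus_le_compat.
Qed.

Lemma norm_minus_le x y a b : ‖x‖ <= a -> ‖y‖ <= b -> ‖x ⊖ y‖ <= a + b.
Proof. intros H1 H2. apply norm_plus_le; [easy|]. now rewrite norm_opposite. Qed.

Lemma norm_minus_sym x y : ‖x ⊖ y‖ = ‖y ⊖ x‖.
Proof. rewrite <- norm_opposite. f_equal. vec. Qed.

Lemma norm_minus_trans y x z a b :
  ‖x ⊖ y‖ <= a -> ‖y ⊖ z‖ <= b -> ‖x ⊖ z‖ <= a + b.
Proof.
  intros H1 H2. replace (x ⊖ z) with ((x ⊖ y) ⊕ (y ⊖ z)) by vec.
  now apply norm_plus_le.
Qed.

Lemma norm_le_minus x y a : ‖x ⊖ y‖ <= a -> ‖x‖ <= a + ‖y‖.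
Proof.
  intros H. replace x with ((x ⊖ y) ⊕ y) by vec. now apply norm_plus_le; [|right].
Qed.

Lemma norm_real_scal_le (h : R) x a : 0 <= h -> ‖x‖ <= a -> ‖h ⊙ x‖ <= h * a.
Proof.
  intros Hh H. eapply Rle_trans; [apply norm_real_scal|].
  rewrite Rabs_pos_eq by easy. now apply Rmult_le_compat_l.
Qed.

Lemma norm_cscal_le (c : C) x a b : Cmod c <= a -> ‖x‖ <= b -> ‖c ⊙ x‖ <= a * b.
Proof.
  intros Hh H. eapply Rle_trans; [apply norm_cscal|].
  apply Rmult_le_compat; [apply Cmod_ge_0|apply norm_pos|easy|easy].
Qed.

Lemma Rle_of_eps (a b : R) : (forall eps, 0 < eps -> a <= b + eps) -> a <= b.
Proof.
  intros H. destruct (Rle_lt_dec a b) as [|Hl]; [easy|].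
  specialize (H ((a - b) / 2)). lra.
Qed.

Lemma eq_of_norm x y : ‖x ⊖ y‖ <= 0 -> x = y.
Proof.
  intros H. assert (E : ‖x ⊖ y‖ = 0) by (apply Rle_antisym; [easy|apply norm_pos]).
  apply norm_eq_zero in E. replace x with ((x ⊖ y) ⊕ y) by vec.
  rewrite E. vec.
Qed.

Lemma eq_of_norm_eps x y : (forall eps, 0 < eps -> ‖x ⊖ y‖ <= eps) -> x = y.
Proof.
  intros H. apply eq_of_norm, Rle_of_eps. intros e He. rewrite Rplus_0_l. now apply H.
Qed.

(** [g h = o(h)] as [h] decreases to 0. *)
Definition little_o (g : R -> X) : Prop :=
  forall eps, 0 < eps -> exists delta, 0 < delta /\
    forall h, 0 < h < delta -> ‖g h‖ <= eps * h.

Definition right_derivative f (t : R) (d : X) : Prop :=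
  little_o (fun h => f (t + h) ⊖ f t ⊖ h ⊙ d).

Definition continuous_Icc f (a b : R) : Prop :=
  forall t, a <= t <= b -> forall eps, 0 < eps -> exists delta, 0 < delta /\
    forall s, a <= s <= b -> Rabs (s - t) < delta -> ‖f s ⊖ f t‖ <= eps.

Lemma little_o_ext f g : (forall h, 0 < h -> f h = g h) -> little_o f -> little_o g.
Proof.
  intros E H eps He. destruct (H eps He) as (d & Hd & H1).
  exists d; split; [easy|]. intros h Hh. rewrite <- E by lra. now apply H1.
Qed.

Lemma little_o_plus f g : little_o f -> little_o g -> little_o (fun h => f h ⊕ g h).
Proof.
  intros H1 H2 eps He.
  destruct (H1 (eps / 2)) as (d1 & Hd1 & H1'); [lra|].
  destruct (H2 (eps / 2)) as (d2 & Hd2 & H2'); [lra|].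
  exists (Rmin d1 d2); split; [now apply Rmin_glb_lt|]. intros h Hh.
  pose proof (Rmin_l d1 d2). pose proof (Rmin_r d1 d2).
  replace (eps * h) with (eps / 2 * h + eps / 2 * h) by field.
  apply norm_plus_le; [apply H1'|apply H2']; lra.
Qed.

Lemma little_o_bound (K : R) f g :
  (forall h, 0 < h -> ‖g h‖ <= K * ‖f h‖) -> little_o f -> little_o g.
Proof.
  intros HK H eps He.
  assert (Hp : 0 < Rabs K + 1) by (pose proof (Rabs_pos K); lra).
  destruct (H (eps / (Rabs K + 1))) as (d & Hd & H1).
  { now apply Rdiv_lt_0_compat. }
  exists d; split; [easy|]. intros h Hh.
  eapply Rle_trans; [apply HK; lra|].
  apply Rle_trans with ((Rabs K + 1) * (eps / (Rabs K + 1) * h)).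
  - specialize (H1 h Hh). pose proof (norm_pos (f h)). pose proof (Rle_abs K).
    apply Rle_trans with ((Rabs K + 1) * ‖f h‖); [nra|].
    apply Rmult_le_compat_l; lra.
  - right. field. lra.
Qed.

Lemma little_o_scal (c : C) f : little_o f -> little_o (fun h => c ⊙ f h).
Proof. apply (little_o_bound (Cmod c)). intros h _. apply norm_cscal. Qed.

Lemma little_o_linear (L : X -> X) f : is_linear L -> little_o f -> little_o (fun h => L (f h)).
Proof.
  intros HL. destruct (linear_norm L HL) as (K & _ & HK).
  apply (little_o_bound K). intros h _. apply HK.
Qed.

Lemma right_derivative_unique f t d1 d2 :
  right_derivative f t d1 -> right_derivative f t d2 -> d1 = d2.
Proof.
  intros H1 H2. apply eq_of_norm_eps. intros eps He.
  destruct (H1 (eps / 2)) as (e1 & He1 & H1'); [lra|].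
  destruct (H2 (eps / 2)) as (e2 & He2 & H2'); [lra|].
  set (h := Rmin e1 e2 / 2).
  pose proof (Rmin_l e1 e2). pose proof (Rmin_r e1 e2).
  pose proof (Rmin_glb_lt e1 e2 0 He1 He2).
  assert (Hh : 0 < h) by (unfold h; lra).
  specialize (H1' h ltac:(unfold h; lra)). specialize (H2' h ltac:(unfold h; lra)).
  replace (d1 ⊖ d2) with
    (/ h ⊙ ((f (t + h) ⊖ f t ⊖ h ⊙ d2) ⊖ (f (t + h) ⊖ f t ⊖ h ⊙ d1))).
  - replace eps with (/ h * (eps / 2 * h + eps / 2 * h)) by (field; lra).
    apply norm_real_scal_le.
    + left; now apply Rinv_0_lt_compat.
    + now apply norm_minus_le.
  - assert (E : forall z : X, / h ⊙ (h ⊙ z) = z).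
    { intros z. transitivity ((RtoC (/ h * h)) ⊙ z); [vec|].
      rewrite Rinv_l by lra. vec. }
    rewrite <- (E (d1 ⊖ d2)). vec.
Qed.

(** The mean value inequality for right derivatives: the set of the points up to
    which the bound with slope [Q + eta] holds is closed on the right by
    continuity and open on the right by differentiability. *)
Lemma mean_value_right f (a b Q : R) :
  a <= b -> continuous_Icc f a b ->
  (forall t, a <= t < b -> forall eta, 0 < eta -> exists delta, 0 < delta /\
     forall h, 0 < h < delta -> t + h <= b -> ‖f (t + h) ⊖ f t‖ <= (Q + eta) * h) ->
  ‖f b ⊖ f a‖ <= Q * (b - a).
Proof.
  intros Hab Hc Hd.
  assert (Main : forall eta, 0 < eta -> ‖f b ⊖ f a‖ <= (Q + eta) * (b - a)).
  2:{ apply Rle_of_eps. intros e He.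
      assert (He' : 0 < e / (b - a + 1)) by (apply Rdiv_lt_0_compat; lra).
      eapply Rle_trans; [apply (Main _ He')|].
      assert (e / (b - a + 1) * (b - a + 1) = e) by (field; lra). nra. }
  intros eta Heta.
  set (S := fun t => a <= t <= b /\
                     forall s, a <= s <= t -> ‖f s ⊖ f a‖ <= (Q + eta) * (s - a)).
  assert (Sa : S a).
  { split; [lra|]. intros s Hs. replace s with a by lra.
    replace (f a ⊖ f a) with (𝟎 : X) by vec. rewrite norm_null. lra. }
  destruct (completeness S) as (m & Hub & Hlub).
  { exists b. intros t Ht. apply Ht. }
  { now exists a. }
  assert (Ham : a <= m) by now apply Hub.
  assert (Hmb : m <= b) by (apply Hlub; intros t Ht; apply Ht).
  assert (Hlt : forall s, a <= s < m -> ‖f s ⊖ f a‖ <= (Q + eta) * (s - a)).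
  { intros s Hs. destruct (classic (exists t, S t /\ s < t)) as [(t & Ht & Hst)|Hn].
    - apply Ht. lra.
    - exfalso. assert (m <= s); [|lra]. apply Hlub. intros t Ht.
      destruct (Rle_lt_dec t s); [easy|]. exfalso; apply Hn; now exists t. }
  assert (Sm : S m).
  { split; [easy|]. intros s Hs. destruct (Rlt_le_dec s m) as [Hsm|Hsm].
    { apply Hlt; lra. }
    replace s with m by lra. destruct (Rlt_le_dec a m) as [Ham'|Ham'].
    2:{ replace m with a by lra. apply Sa. lra. }
    apply Rle_of_eps. intros e He.
    destruct (Hc m ltac:(lra) (e / 2) ltac:(lra)) as (d & Hdp & Hd').
    pose proof (Rabs_pos (Q + eta)).
    set (q := e / 2 / (Rabs (Q + eta) + 1)).
    assert (Hq : 0 < q) by (apply Rdiv_lt_0_compat; lra).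
    assert (Hq' : q * (Rabs (Q + eta) + 1) = e / 2) by (unfold q; field; lra).
    set (k := Rmin (Rmin (d / 2) q) (m - a)).
    assert (Hk : 0 < k) by (unfold k; repeat apply Rmin_glb_lt; lra).
    assert (Hk1 : k <= Rmin (d / 2) q) by apply Rmin_l.
    assert (Hk2 : k <= m - a) by apply Rmin_r.
    assert (Hk3 : k <= d / 2) by (eapply Rle_trans; [apply Hk1|apply Rmin_l]).
    assert (Hk4 : k <= q) by (eapply Rle_trans; [apply Hk1|apply Rmin_r]).
    replace ((Q + eta) * (m - a) + e) with
      (e / 2 + ((Q + eta) * (m - a) + e / 2)) by field.
    apply (norm_minus_trans (f (m - k))).
    - rewrite norm_minus_sym. apply Hd'; [lra|].
      replace (m - k - m) with (- k) by ring. rewrite Rabs_Ropp, Rabs_pos_eq; lra.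
    - eapply Rle_trans; [apply Hlt; lra|].
      assert (Hn : - (Q + eta) * k <= Rabs (Q + eta) * q).
      { pose proof (Rle_abs (- (Q + eta))) as Ha. rewrite Rabs_Ropp in Ha.
        apply Rle_trans with (Rabs (Q + eta) * k); nra. }
      nra. }
  destruct (Rle_lt_or_eq_dec m b Hmb) as [Hlb|Hlb].
  2:{ rewrite <- Hlb. apply Sm. lra. }
  exfalso.
  destruct (Hd m ltac:(lra) eta Heta) as (d & Hdp & Hd').
  set (k := Rmin (d / 2) (b - m)).
  assert (Hk : 0 < k) by (apply Rmin_glb_lt; lra).
  assert (Hk1 : k <= d / 2) by apply Rmin_l.
  assert (Hk2 : k <= b - m) by apply Rmin_r.
  assert (S (m + k)); [|assert (m + k <= m) by (now apply Hub); lra].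
  split; [lra|]. intros s Hs. destruct (Rle_lt_dec s m) as [Hsm|Hsm].
  { apply Sm. lra. }
  replace ((Q + eta) * (s - a)) with
    ((Q + eta) * (s - m) + (Q + eta) * (m - a)) by ring.
  apply (norm_minus_trans (f m)).
  - replace s with (m + (s - m)) at 1 by ring. apply Hd'; lra.
  - apply Sm. lra.
Qed.

Lemma mean_value_right_derivative f (a b Q : R) :
  a <= b -> continuous_Icc f a b ->
  (forall t, a <= t < b -> exists d, right_derivative f t d /\ ‖d‖ <= Q) ->
  ‖f b ⊖ f a‖ <= Q * (b - a).
Proof.
  intros Hab Hc Hd. apply mean_value_right; [easy..|].
  intros t Ht eta Heta. destruct (Hd t Ht) as (d & H1 & H2).
  destruct (H1 eta Heta) as (e & He & H3). exists e; split; [easy|].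
  intros h Hh _. replace ((Q + eta) * h) with (eta * h + h * Q) by ring.
  replace (f (t + h) ⊖ f t) with ((f (t + h) ⊖ f t ⊖ h ⊙ d) ⊕ h ⊙ d) by vec.
  apply norm_plus_le; [now apply H3|]. apply norm_real_scal_le; lra.
Qed.

Lemma continuous_Icc_plus f g a b :
  continuous_Icc f a b -> continuous_Icc g a b ->
  continuous_Icc (fun t => f t ⊕ g t) a b.
Proof.
  intros H1 H2 t Ht eps He.
  destruct (H1 t Ht (eps / 2)) as (d1 & Hd1 & H1'); [lra|].
  destruct (H2 t Ht (eps / 2)) as (d2 & Hd2 & H2'); [lra|].
  exists (Rmin d1 d2); split; [now apply Rmin_glb_lt|]. intros s Hs Hst.
  pose proof (Rmin_l d1 d2). pose proof (Rmin_r d1 d2).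
  replace (f s ⊕ g s ⊖ (f t ⊕ g t)) with ((f s ⊖ f t) ⊕ (g s ⊖ g t)) by vec.
  replace eps with (eps / 2 + eps / 2) by field.
  apply norm_plus_le; [apply H1'|apply H2']; lra.
Qed.

Lemma continuous_Icc_line (x : X) a b : continuous_Icc (fun t => t ⊙ x) a b.
Proof.
  intros t Ht eps He. pose proof (norm_pos x).
  assert (Hq : 0 < eps / (‖x‖ + 1)) by (apply Rdiv_lt_0_compat; lra).
  exists (eps / (‖x‖ + 1)); split; [easy|]. intros s Hs Hst.
  cbv beta. replace (s ⊙ x ⊖ t ⊙ x) with ((s - t) ⊙ x) by vec.
  eapply Rle_trans; [apply norm_real_scal|].
  assert (eps / (‖x‖ + 1) * (‖x‖ + 1) = eps) by (field; lra).
  pose proof (Rabs_pos (s - t)). nra.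
Qed.

Lemma continuous_Icc_linear (L : X -> X) f a b :
  is_linear L -> continuous_Icc f a b -> continuous_Icc (fun t => L (f t)) a b.
Proof.
  intros HL H t Ht eps He. destruct (linear_norm L HL) as (K & HK & HL').
  destruct (H t Ht (eps / K)) as (d & Hd & H1); [now apply Rdiv_lt_0_compat|].
  exists d; split; [easy|]. intros s Hs Hst. rewrite <- (linear_sub L _ _ HL).
  eapply Rle_trans; [apply HL'|]. replace eps with (K * (eps / K)) by (field; lra).
  apply Rmult_le_compat_l; [lra|]. now apply H1.
Qed.

(** [t ↦ W b t (u t)] has the right derivative [W b t (d - g)]: the increment is
    [W b (t + h)] applied to the difference of the increments of [u] and of the
    orbit of [u t] under [W].  This form of the product rule uses only a bound
    of [W] and right derivatives. *)
Lemma duhamel_bound (W : R -> R -> X -> X) u (a b K eps : R) :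
  a <= b -> 0 <= K ->
  (forall s t, a <= s <= t -> t <= b -> is_linear (W t s)) ->
  (forall s t x, a <= s <= t -> t <= b -> ‖W t s x‖ <= K * ‖x‖) ->
  (forall r s t x, a <= r <= s -> s <= t <= b -> W t s (W s r x) = W t r x) ->
  (forall x, continuous_Icc (fun s => W b s x) a b) ->
  continuous_Icc u a b ->
  (forall t, a <= t < b -> exists d g, right_derivative u t d /\
     little_o (fun h => W (t + h) t (u t) ⊖ u t ⊖ h ⊙ g) /\ ‖d ⊖ g‖ <= eps) ->
  ‖W b b (u b) ⊖ W b a (u a)‖ <= K * eps * (b - a).
Proof.
  intros Hab HK HL HB HW Hc Hu Hd.
  apply (mean_value_right (fun t => W b t (u t)) a b); [easy| |].
  - intros t Ht e He.
    assert (Hq : 0 < e / 2 / (K + 1)) by (apply Rdiv_lt_0_compat; lra).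
    destruct (Hu t Ht _ Hq) as (d1 & Hd1 & H1).
    destruct (Hc (u t) t Ht (e / 2)) as (d2 & Hd2 & H2); [lra|].
    exists (Rmin d1 d2); split; [now apply Rmin_glb_lt|]. intros s Hs Hst.
    pose proof (Rmin_l d1 d2). pose proof (Rmin_r d1 d2).
    replace e with (e / 2 + e / 2) by field.
    apply (norm_minus_trans (W b s (u t))).
    + rewrite <- (linear_sub (W b s)) by (apply HL; lra).
      eapply Rle_trans; [apply HB; lra|].
      specialize (H1 s Hs ltac:(lra)).
      assert (e / 2 / (K + 1) * (K + 1) = e / 2) by (field; lra).
      pose proof (norm_pos (u s ⊖ u t)). nra.
    + apply H2; lra.
  - intros t Ht eta Heta. destruct (Hd t Ht) as (d & g & H1 & H2 & H3).
    set (q := eta / 2 / (K + 1)).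
    assert (Hq : 0 < q) by (apply Rdiv_lt_0_compat; lra).
    assert (Hq' : q * (K + 1) = eta / 2) by (unfold q; field; lra).
    destruct (H1 q Hq) as (d1 & Hd1 & H1').
    destruct (H2 q Hq) as (d2 & Hd2 & H2').
    exists (Rmin d1 d2); split; [now apply Rmin_glb_lt|]. intros h Hh Hhb.
    pose proof (Rmin_l d1 d2). pose proof (Rmin_r d1 d2).
    specialize (H1' h ltac:(lra)). specialize (H2' h ltac:(lra)).
    rewrite <- (HW t (t + h) b (u t)) by lra.
    rewrite <- (linear_sub (W b (t + h))) by (apply HL; lra).
    eapply Rle_trans; [apply HB; lra|].
    replace (u (t + h) ⊖ W (t + h) t (u t)) with
      ((u (t + h) ⊖ u t ⊖ h ⊙ d) ⊖ (W (t + h) t (u t) ⊖ u t ⊖ h ⊙ g)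
       ⊕ h ⊙ (d ⊖ g)) by vec.
    apply Rle_trans with (K * ((q * h + q * h) + h * eps)).
    + apply Rmult_le_compat_l; [easy|]. apply norm_plus_le.
      * now apply norm_minus_le.
      * apply norm_real_scal_le; lra.
    + nra.
Qed.

(** A continuous right derivative is a derivative: the mean value inequality for
    [r ↦ f r - r (g t)] on either side of [t]. *)
Lemma derivative_of_right_derivative f g (a b : R) :
  continuous_Icc f a b -> continuous_Icc g a b ->
  (forall t, a <= t < b -> right_derivative f t (g t)) ->
  forall t, a <= t <= b -> forall eps, 0 < eps -> exists delta, 0 < delta /\
    forall s, a <= s <= b -> Rabs (s - t) < delta ->
      ‖f s ⊖ f t ⊖ (s - t) ⊙ g t‖ <= eps * Rabs (s - t).
Proof.
  intros Hf Hg Hd t Ht eps He. destruct (Hg t Ht eps He) as (d & Hdp & H).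
  exists d; split; [easy|].
  assert (Main : forall p q, a <= p -> p <= q -> q <= b -> Rabs (p - t) < d ->
    Rabs (q - t) < d -> ‖f q ⊖ f p ⊖ (q - p) ⊙ g t‖ <= eps * (q - p)).
  { intros p q Hp Hpq Hq Hpd Hqd.
    replace (f q ⊖ f p ⊖ (q - p) ⊙ g t) with
      ((f q ⊕ q ⊙ opp (g t)) ⊖ (f p ⊕ p ⊙ opp (g t))) by vec.
    apply (mean_value_right_derivative (fun r => f r ⊕ r ⊙ opp (g t))); [easy| |].
    - apply continuous_Icc_plus; [|apply continuous_Icc_line].
      intros r Hr e He'. destruct (Hf r ltac:(lra) e He') as (d' & Hd' & H').
      exists d'; split; [easy|]. intros s Hs. apply H'. lra.
    - intros r Hr. exists (g r ⊖ g t). split.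
      + generalize (Hd r ltac:(lra)). apply little_o_ext. intros h Hh. vec.
      + apply H; [lra|]. apply Rabs_def1; apply Rabs_def2 in Hpd, Hqd; lra. }
  assert (Ht0 : Rabs (t - t) < d) by (rewrite Rminus_diag, Rabs_R0; easy).
  intros s Hs Hst. destruct (Rle_lt_dec t s) as [Hl|Hl].
  - rewrite Rabs_pos_eq by lra. apply Main; (easy || lra).
  - rewrite Rabs_left by lra.
    replace (f s ⊖ f t ⊖ (s - t) ⊙ g t) with (opp (f t ⊖ f s ⊖ (t - s) ⊙ g t)) by vec.
    rewrite norm_opposite. replace (- (s - t)) with (t - s) by ring.
    apply Main; (easy || lra).
Qed.

End RightDerivatives.

(** * Semigroups and their generators *)

Section Semigroups.

Context {X : CompleteNormedModule C_AbsRing}.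
Implicit Types (x y z w : X) (T : R -> X -> X).

Definition bounded_upto T (p K : R) : Prop :=
  0 <= K /\ forall t x, 0 <= t <= p -> ‖T t x‖ <= K * ‖x‖.

Record semigroup T : Prop := {
  sg_linear : forall t, 0 <= t -> is_linear (T t);
  sg_zero : forall x, T 0 x = x;
  sg_add : forall s t x, 0 <= s -> 0 <= t -> T (s + t) x = T s (T t x);
  sg_bounded : forall p, exists K, bounded_upto T p K;
  sg_continuous : forall x eps, 0 < eps -> exists delta, 0 < delta /\
    forall t, 0 <= t < delta -> ‖T t x ⊖ x‖ <= eps }.

Definition generator T x y : Prop := little_o (fun h => T h x ⊖ x ⊖ h ⊙ y).

Lemma semigroup_continuous_Icc T x p :
  semigroup T -> continuous_Icc (fun t => T t x) 0 p.
Proof.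
  intros HT t Ht eps He. destruct (sg_bounded T HT p) as (K & HK & HB).
  destruct (sg_continuous T HT x (eps / (K + 1))) as (d & Hd & H1).
  { apply Rdiv_lt_0_compat; lra. }
  exists d; split; [easy|].
  assert (Main : forall s t, 0 <= s <= t -> t <= p -> t - s < d ->
                 ‖T t x ⊖ T s x‖ <= eps).
  { clear t Ht. intros s t Hs Ht Hst.
    replace t with (s + (t - s)) by ring. rewrite (sg_add T HT) by lra.
    rewrite <- (linear_sub (T s)) by (apply (sg_linear T HT); lra).
    eapply Rle_trans; [apply HB; lra|]. specialize (H1 (t - s) ltac:(lra)).
    assert (eps / (K + 1) * (K + 1) = eps) by (field; lra).
    pose proof (norm_pos (T (t - s) x ⊖ x)). nra. }
  intros s Hs Hst. destruct (Rle_lt_dec s t).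
  - rewrite norm_minus_sym. rewrite Rabs_minus_sym, Rabs_pos_eq in Hst by lra.
    apply Main; lra.
  - rewrite Rabs_pos_eq in Hst by lra. apply Main; lra.
Qed.

Lemma generator_right_derivative T x y t :
  semigroup T -> generator T x y -> 0 <= t ->
  right_derivative (fun s => T s x) t (T t y).
Proof.
  intros HT H Ht. pose proof (sg_linear T HT t Ht) as HL.
  apply (little_o_ext (fun h => T t (T h x ⊖ x ⊖ h ⊙ y))).
  - intros h Hh. rewrite (sg_add T HT) by lra.
    rewrite !(linear_sub (T t)), (linear_cscal (T t)) by exact HL. reflexivity.
  - now apply little_o_linear.
Qed.

Lemma generator_unique T x y y' :
  semigroup T -> generator T x y -> generator T x y' -> y = y'.
Proof.
  intros HT H1 H2. apply (right_derivative_unique (fun t => T t x) 0).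
  - rewrite <- (sg_zero T HT y). now apply generator_right_derivative; [..|lra].
  - rewrite <- (sg_zero T HT y'). now apply generator_right_derivative; [..|lra].
Qed.

Lemma generator_orbit T x y t :
  semigroup T -> generator T x y -> 0 <= t -> generator T (T t x) (T t y).
Proof.
  intros HT H Ht. generalize (generator_right_derivative T x y t HT H Ht).
  apply little_o_ext. intros h Hh. rewrite <- (sg_add T HT) by lra.
  now rewrite Rplus_comm.
Qed.

Lemma generator_plus T x y x' y' :
  semigroup T -> generator T x y -> generator T x' y' -> generator T (x ⊕ x') (y ⊕ y').
Proof.
  intros HT H1 H2. generalize (little_o_plus _ _ H1 H2). apply little_o_ext.
  intros h Hh. rewrite (linear_add (T h)) by (apply (sg_linear T HT); lra). vec.
Qed.

Lemma generator_scal T (c : C) x y :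
  semigroup T -> generator T x y -> generator T (c ⊙ x) (c ⊙ y).
Proof.
  intros HT H. generalize (little_o_scal c _ H). apply little_o_ext.
  intros h Hh. rewrite (linear_cscal (T h)) by (apply (sg_linear T HT); lra). vec.
Qed.

Lemma generator_zero T : semigroup T -> generator T 𝟎 𝟎.
Proof.
  intros HT eps He. exists 1; split; [lra|]. intros h Hh.
  replace (T h 𝟎) with (𝟎 : X).
  - replace (𝟎 ⊖ 𝟎 ⊖ h ⊙ 𝟎) with (𝟎 : X) by vec.
    rewrite norm_null. nra.
  - symmetry. apply (linear_zero (T h)). apply (sg_linear T HT). lra.
Qed.

(** The orbit of [x] moves with velocity [T t z]; this replaces the integral
    [T h x - x = ∫ T t z dt] by an estimate. *)
Lemma orbit_increment_bound T x z w (h eps : R) :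
  semigroup T -> generator T x z -> 0 <= h ->
  (forall t, 0 <= t < h -> ‖T t z ⊖ w‖ <= eps) ->
  ‖T h x ⊖ x ⊖ h ⊙ w‖ <= h * eps.
Proof.
  intros HT Hx Hh H.
  replace (T h x ⊖ x ⊖ h ⊙ w) with
    ((T h x ⊕ h ⊙ opp w) ⊖ (T 0 x ⊕ 0 ⊙ opp w)) by (rewrite (sg_zero T HT); vec).
  replace (h * eps) with (eps * (h - 0)) by ring.
  apply (mean_value_right_derivative (fun t => T t x ⊕ t ⊙ opp w)); [easy| |].
  - apply continuous_Icc_plus; [now apply semigroup_continuous_Icc|].
    apply continuous_Icc_line.
  - intros t Ht. exists (T t z ⊖ w). split; [|now apply H].
    generalize (generator_right_derivative T x z t HT Hx ltac:(lra)).
    apply little_o_ext. intros k Hk. vec.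
Qed.

(** The bound of the increment of an orbit involves [x] and its image only
    through norms, so that it passes to limits of points of the graph. *)
Lemma generator_closed T x y :
  semigroup T ->
  (forall eps, 0 < eps -> exists x' y', generator T x' y' /\
     ‖x' ⊖ x‖ <= eps /\ ‖y' ⊖ y‖ <= eps) ->
  generator T x y.
Proof.
  intros HT H eps He. destruct (sg_bounded T HT 1) as (K & HK & HB).
  destruct (sg_continuous T HT y (eps / 2)) as (d & Hd & H1); [lra|].
  exists (Rmin d 1); split; [apply Rmin_glb_lt; lra|]. intros h Hh.
  pose proof (Rmin_l d 1). pose proof (Rmin_r d 1).
  set (q := h * eps / 2 / (2 * K + 1)).
  assert (Hq : 0 < q) by (apply Rdiv_lt_0_compat; nra).
  assert (Hq' : q * (2 * K + 1) = h * eps / 2) by (unfold q; field; lra).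
  destruct (H q Hq) as (x' & y' & Hg & Hx & Hy).
  assert (HL : is_linear (T h)) by (apply (sg_linear T HT); lra).
  replace (T h x ⊖ x ⊖ h ⊙ y) with
    ((T h x' ⊖ x' ⊖ h ⊙ y) ⊖ (T h (x' ⊖ x) ⊖ (x' ⊖ x)))
    by (rewrite (linear_sub (T h)) by easy; vec).
  apply Rle_trans with (h * (K * q + eps / 2) + (K * q + q)).
  2:{ assert (0 <= K * q) by (apply Rmult_le_pos; lra).
      assert (h * (K * q) <= 1 * (K * q)) by (apply Rmult_le_compat_r; lra). nra. }
  apply norm_minus_le.
  - apply (orbit_increment_bound T x' y'); [easy..|lra|]. intros t Ht.
    apply (norm_minus_trans (T t y)); [|apply H1; lra].
    rewrite <- (linear_sub (T t)) by (apply (sg_linear T HT); lra).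
    eapply Rle_trans; [apply HB; lra|]. now apply Rmult_le_compat_l.
  - apply norm_minus_le; [|easy].
    eapply Rle_trans; [apply HB; lra|]. now apply Rmult_le_compat_l.
Qed.

(** If [u' - B u] is at most [eps] for the generator [B] of [T], then [u] stays
    close to the orbit of its initial value.  With [eps = 0] this is the uniqueness
    of solutions, and with a perturbed generator the convergence of semigroups. *)
Lemma duhamel_semigroup T u (p K eps : R) :
  semigroup T -> 0 <= p -> bounded_upto T p K -> continuous_Icc u 0 p ->
  (forall t, 0 <= t < p -> exists d g, right_derivative u t d /\
     generator T (u t) g /\ ‖d ⊖ g‖ <= eps) ->
  ‖u p ⊖ T p (u 0)‖ <= K * eps * p.
Proof.
  intros HT Hp (HK & HB) Hu Hd.
  replace (u p) with (T (p - p) (u p))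
    by (unfold Rminus; rewrite Rplus_opp_r; apply (sg_zero T HT)).
  replace (T p (u 0)) with (T (p - 0) (u 0)) by now rewrite Rminus_0_r.
  replace (K * eps * p) with (K * eps * (p - 0)) by ring.
  apply (duhamel_bound (fun t s => T (t - s)) u 0 p K eps); [easy..| | | | |easy|].
  - intros s t H1 H2. apply (sg_linear T HT); lra.
  - intros s t x H1 H2. apply HB; lra.
  - intros r s t x H1 H2. rewrite <- (sg_add T HT) by lra. f_equal; ring.
  - intros x t Ht e He.
    destruct (semigroup_continuous_Icc T x p HT (p - t) ltac:(lra) e He)
      as (d & Hd' & H1).
    exists d; split; [easy|]. intros s Hs Hst. apply H1; [lra|].
    replace (p - s - (p - t)) with (- (s - t)) by ring. now rewrite Rabs_Ropp.
  - intros t Ht. destruct (Hd t Ht) as (d & g & H1 & H2 & H3).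
    exists d, g. split; [easy|]. split; [|easy].
    revert H2. apply little_o_ext. intros h Hh.
    now replace (t + h - t) with h by ring.
Qed.

(** [delta (orbit_sum T delta n y)] is a Riemann sum of [∫ T r y dr] over
    [[0, n delta]]. *)
Fixpoint orbit_sum T (delta : R) (n : nat) y : X :=
  match n with
  | O => 𝟎
  | S m => orbit_sum T delta m y ⊕ T (INR m * delta) y
  end.

Lemma orbit_sum_telescope T delta n y :
  semigroup T -> 0 <= delta ->
  orbit_sum T delta n (T delta y ⊖ y) = T (INR n * delta) y ⊖ y.
Proof.
  intros HT Hd. induction n as [|n IH].
  - simpl. rewrite Rmult_0_l, (sg_zero T HT). vec.
  - cbn [orbit_sum]. rewrite IH.
    assert (H : 0 <= INR n * delta) by (apply Rmult_le_pos; [apply pos_INR|easy]).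
    rewrite (linear_sub (T _)) by now apply (sg_linear T HT).
    rewrite <- (sg_add T HT) by easy.
    rewrite S_INR. replace (INR n * delta + delta) with ((INR n + 1) * delta) by ring.
    vec.
Qed.

Lemma orbit_sum_bound T delta n z w (eps : R) :
  (forall i, (i < n)%nat -> ‖T (INR i * delta) z ⊖ w‖ <= eps) ->
  ‖orbit_sum T delta n z ⊖ INR n ⊙ w‖ <= INR n * eps.
Proof.
  induction n as [|n IH]; intros H.
  - simpl. replace (𝟎 ⊖ 0 ⊙ w) with (𝟎 : X) by vec. rewrite norm_null. lra.
  - cbn [orbit_sum]. rewrite S_INR.
    replace (orbit_sum T delta n z ⊕ T (INR n * delta) z ⊖ (INR n + 1) ⊙ w)
      with ((orbit_sum T delta n z ⊖ INR n ⊙ w) ⊕ (T (INR n * delta) z ⊖ w)) by vec.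
    rewrite Rmult_plus_distr_r, Rmult_1_l. apply norm_plus_le.
    + apply IH. intros i Hi. apply H. lia.
    + apply H. lia.
Qed.

Lemma orbit_sum_norm T delta n z (K : R) :
  0 <= delta -> bounded_upto T (INR n * delta) K ->
  ‖orbit_sum T delta n z‖ <= INR n * (K * ‖z‖).
Proof.
  intros Hd (HK & HB).
  replace (orbit_sum T delta n z) with (orbit_sum T delta n z ⊖ INR n ⊙ 𝟎) by vec.
  apply orbit_sum_bound. intros i Hi.
  replace (T (INR i * delta) z ⊖ 𝟎) with (T (INR i * delta) z) by vec.
  apply HB. split; [apply Rmult_le_pos; [apply pos_INR|easy]|].
  apply Rmult_le_compat_r; [easy|]. now apply le_INR, Nat.lt_le_incl.
Qed.

Lemma orbit_sum_sub T delta n z z' :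
  semigroup T -> 0 <= delta ->
  orbit_sum T delta n (z ⊖ z') = orbit_sum T delta n z ⊖ orbit_sum T delta n z'.
Proof.
  intros HT Hd. induction n as [|n IH]; cbn [orbit_sum]; [vec|].
  rewrite IH, (linear_sub (T _)); [vec|]. apply (sg_linear T HT).
  apply Rmult_le_pos; [apply pos_INR|easy].
Qed.

Lemma orbit_sum_scal T delta n (c : C) y :
  semigroup T -> 0 <= delta ->
  orbit_sum T delta n (c ⊙ y) = c ⊙ orbit_sum T delta n y.
Proof.
  intros HT Hd. induction n as [|n IH]; cbn [orbit_sum]; [vec|].
  rewrite IH, (linear_cscal (T _)); [vec|]. apply (sg_linear T HT).
  apply Rmult_le_pos; [apply pos_INR|easy].
Qed.

Lemma generator_orbit_sum T delta n y z :
  semigroup T -> 0 <= delta -> generator T y z ->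
  generator T (orbit_sum T delta n y) (orbit_sum T delta n z).
Proof.
  intros HT Hd H. induction n as [|n IH]; simpl.
  - now apply generator_zero.
  - apply generator_plus; [easy..|]. apply generator_orbit; [easy..|].
    apply Rmult_le_pos; [apply pos_INR|easy].
Qed.

(** A dense subspace of the domain that is invariant under the semigroup is a
    core.  An element [x] of the domain is approximated in the graph norm by the
    average of the orbit over [[0, h]] of an element [y1] of the subspace close
    to [x]; the average is a Riemann sum, so that it stays in the subspace, and
    the generator maps it close to the difference quotient of [x]. *)
Lemma invariant_dense_core T (Y : X -> Prop) (G : X -> X) :
  semigroup T ->
  Y 𝟎 -> (forall y y', Y y -> Y y' -> Y (y ⊕ y')) ->
  (forall (c : C) y, Y y -> Y (c ⊙ y)) ->
  (forall t y, 0 <= t -> Y y -> Y (T t y)) ->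
  (forall y, Y y -> generator T y (G y)) ->
  (forall x eps, 0 < eps -> exists y, Y y /\ ‖y ⊖ x‖ <= eps) ->
  forall x z eps, generator T x z -> 0 < eps ->
    exists y, Y y /\ ‖y ⊖ x‖ <= eps /\ ‖G y ⊖ z‖ <= eps.
Proof.
  intros HT Y0 Yadd Yscal Yinv HG Ydense x z eps0 Hx He0.
  destruct (sg_bounded T HT 1) as (K & HK & HB).
  set (eps := eps0 / (2 * K + 2)).
  assert (He : 0 < eps) by (apply Rdiv_lt_0_compat; lra).
  assert (He' : eps * (2 * K + 2) = eps0) by (unfold eps; field; lra).
  destruct (Hx eps He) as (d1 & Hd1 & H1).
  destruct (sg_continuous T HT x eps He) as (d2 & Hd2 & H2).
  set (h := Rmin 1 (Rmin d1 d2) / 2).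
  assert (Hh0 : 0 < Rmin 1 (Rmin d1 d2)) by (repeat apply Rmin_glb_lt; lra).
  assert (Hh1 : Rmin 1 (Rmin d1 d2) <= 1) by apply Rmin_l.
  assert (Hh2 : Rmin 1 (Rmin d1 d2) <= Rmin d1 d2) by apply Rmin_r.
  pose proof (Rmin_l d1 d2) as Hh3. pose proof (Rmin_r d1 d2) as Hh4.
  assert (Hh : 0 < h) by (unfold h; lra).
  destruct (Ydense x (eps * h)) as (y1 & Hy1 & Hy1x); [now apply Rmult_lt_0_compat|].
  destruct (HG y1 Hy1 eps He) as (d3 & Hd3 & H3).
  destruct (nfloor_ex (h / d3)) as (n & _ & Hn).
  { apply Rle_mult_inv_pos; lra. }
  set (N := S n). assert (HN : INR N = INR n + 1) by apply S_INR.
  pose proof (pos_INR n).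
  set (delta := h / INR N).
  assert (Hdel : 0 < delta) by (apply Rdiv_lt_0_compat; lra).
  assert (HNd : INR N * delta = h) by (unfold delta; field; lra).
  assert (Hdel3 : delta < d3).
  { assert (Hh' : h / d3 * d3 = h) by (field; lra). nra. }
  assert (HBN : bounded_upto T (INR N * delta) K).
  { split; [easy|]. intros t w Ht. apply HB. rewrite HNd in Ht. unfold h in Ht; lra. }
  exists (/ INR N ⊙ orbit_sum T delta N y1).
  assert (HS : forall m, Y (orbit_sum T delta m y1)).
  { induction m as [|m IH]; simpl; [easy|]. apply Yadd; [easy|].
    apply Yinv; [|easy]. apply Rmult_le_pos; [apply pos_INR|lra]. }
  assert (Hinv : / INR N * INR N = 1) by (field; lra).
  assert (Hinv0 : 0 < / INR N) by (apply Rinv_0_lt_compat; lra).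
  split; [|split].
  - now apply Yscal.
  - replace (/ INR N ⊙ orbit_sum T delta N y1 ⊖ x) with
      (/ INR N ⊙ (orbit_sum T delta N (y1 ⊖ x)) ⊕
       / INR N ⊙ (orbit_sum T delta N x ⊖ INR N ⊙ x)).
    2:{ rewrite orbit_sum_sub by (easy || lra).
        replace x with ((/ INR N * INR N) ⊙ x) at 4 by (rewrite Hinv; vec). vec. }
    apply Rle_trans with (/ INR N * (INR N * (K * (eps * h))) + / INR N * (INR N * eps)).
    + apply norm_plus_le; apply norm_real_scal_le; try lra.
      * eapply Rle_trans; [apply orbit_sum_norm; [lra|exact HBN]|].
        apply Rmult_le_compat_l; [lra|]. now apply Rmult_le_compat_l.
      * apply orbit_sum_bound. intros i Hi. apply H2.
        assert (Hi' : INR i <= INR N) by now apply le_INR, Nat.lt_le_incl.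
        pose proof (pos_INR i). unfold h in HNd. split; [nra|].
        apply Rle_lt_trans with (INR N * delta); [nra|]. lra.
    + rewrite <- !Rmult_assoc, Hinv, !Rmult_1_l. unfold h. nra.
  - assert (Hg : G (/ INR N ⊙ orbit_sum T delta N y1) =
                 / INR N ⊙ orbit_sum T delta N (G y1)).
    { apply (generator_unique T (/ INR N ⊙ orbit_sum T delta N y1)); [easy|..].
      - now apply HG, Yscal.
      - apply generator_scal; [easy|]. apply generator_orbit_sum; [easy|lra|].
        now apply HG. }
    rewrite Hg.
    set (A1 := orbit_sum T delta N (T delta y1 ⊖ y1 ⊖ delta ⊙ G y1)).
    assert (HA1 : A1 = T h y1 ⊖ y1 ⊖ delta ⊙ orbit_sum T delta N (G y1)).
    { unfold A1. rewrite orbit_sum_sub by (easy || lra).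
      rewrite orbit_sum_telescope by (easy || lra). rewrite HNd. f_equal. f_equal.
      apply orbit_sum_scal; [easy|lra]. }
    assert (HL : is_linear (T h)) by (apply (sg_linear T HT); lra).
    assert (E : h ⊙ (/ INR N ⊙ orbit_sum T delta N (G y1) ⊖ z) =
      (T h (y1 ⊖ x) ⊖ (y1 ⊖ x)) ⊖ A1 ⊕ (T h x ⊖ x ⊖ h ⊙ z)).
    { rewrite HA1, (linear_sub (T h)) by easy. unfold delta. vec_coefs; [..|ring].
      all: unfold Rdiv; rewrite ?RtoC_mult; ring. }
    replace (/ INR N ⊙ orbit_sum T delta N (G y1) ⊖ z) with
      (/ h ⊙ (h ⊙ (/ INR N ⊙ orbit_sum T delta N (G y1) ⊖ z))).
    2:{ transitivity ((/ h * h) ⊙ (/ INR N ⊙ orbit_sum T delta N (G y1) ⊖ z)).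
        - vec.
        - rewrite Rinv_l by lra. vec. }
    rewrite E.
    apply Rle_trans with (/ h * ((K * (eps * h) + eps * h) +
                                 INR N * (K * (eps * delta)) + eps * h)).
    + apply norm_real_scal_le; [left; now apply Rinv_0_lt_compat|].
      apply norm_plus_le; [apply norm_minus_le|].
      * apply norm_minus_le; [|easy].
        eapply Rle_trans; [apply HB; unfold h; lra|]. now apply Rmult_le_compat_l.
      * eapply Rle_trans; [apply orbit_sum_norm; [lra|exact HBN]|].
        apply Rmult_le_compat_l; [lra|]. apply Rmult_le_compat_l; [easy|].
        apply H3. lra.
      * apply H1. unfold h; lra.
    + replace (INR N * (K * (eps * delta))) with (K * eps * (INR N * delta)) by ring.
      rewrite HNd. right. rewrite <- He'. field. lra.
Qed.

End Semigroups.

(** * The complex exponential *)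

Lemma Cexp_plus a b : Cexp (a + b) = (Cexp a * Cexp b)%C.
Proof.
  destruct a as [a1 a2], b as [b1 b2]. unfold Cexp; simpl.
  rewrite exp_plus, cos_plus, sin_plus.
  apply injective_projections; simpl; ring.
Qed.

Lemma Cexp_0 : Cexp (RtoC 0) = RtoC 1.
Proof.
  unfold Cexp; simpl. rewrite exp_0, cos_0, sin_0.
  apply injective_projections; simpl; ring.
Qed.

Lemma Cmod_Cexp z : Cmod (Cexp z) = exp (Re z).
Proof.
  unfold Cexp. rewrite Cmod_mult, Cmod_R.
  rewrite Rabs_pos_eq by (left; apply exp_pos).
  replace (Cmod (cos (Im z), sin (Im z))) with 1; [ring|].
  unfold Cmod; simpl. symmetry. rewrite <- sqrt_1 at 3. f_equal.
  generalize (sin2_cos2 (Im z)); unfold Rsqr; lra.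
Qed.

Lemma Cmod_Re z : Rabs (Re z) <= Cmod z.
Proof. unfold Re. eapply Rle_trans; [|apply Rmax_Cmod]. apply Rmax_l. Qed.

Lemma exp_mono a b : a <= b -> exp a <= exp b.
Proof.
  intros [H| ->]; [left; now apply exp_increasing|right; easy].
Qed.

Lemma Cmod_Cexp_le z : Cmod (Cexp z) <= exp (Cmod z).
Proof.
  rewrite Cmod_Cexp. pose proof (Cmod_Re z). pose proof (Rle_abs (Re z)).
  apply exp_mono; lra.
Qed.

Lemma is_derive_0_expansion (f : R -> R) l eps :
  is_derive f 0 l -> 0 < eps -> exists delta, 0 < delta /\
    forall h, Rabs h < delta -> Rabs (f h - f 0 - l * h) <= eps * Rabs h.
Proof.
  intros H He. apply is_derive_Reals in H.
  destruct (H eps He) as (d & Hd). exists d; split; [apply cond_pos|].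
  intros h Hh. destruct (Req_dec h 0) as [->|Hn].
  - rewrite Rabs_R0. replace (f 0 - f 0 - l * 0) with 0 by ring.
    rewrite Rabs_R0. lra.
  - specialize (Hd h Hn Hh). rewrite Rplus_0_l in Hd.
    replace (f h - f 0 - l * h) with (((f h - f 0) / h - l) * h) by (field; easy).
    rewrite Rabs_mult. apply Rmult_le_compat_r; [apply Rabs_pos|lra].
Qed.

Lemma Cexp_derivative_0 (z : C) eps :
  0 < eps -> exists delta, 0 < delta /\
    forall h : R, Rabs h < delta ->
      Cmod (Cexp (h * z) - 1 - h * z)%C <= eps * Rabs h.
Proof.
  intros He. destruct z as [a b].
  destruct (is_derive_0_expansion (fun h => exp (h * a) * cos (h * b)) a (eps / 2))
    as (d1 & Hd1 & H1); [|lra|].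
  { auto_derive; [easy|]. rewrite !Rmult_0_l, exp_0, cos_0, sin_0. ring. }
  destruct (is_derive_0_expansion (fun h => exp (h * a) * sin (h * b)) b (eps / 2))
    as (d2 & Hd2 & H2); [|lra|].
  { auto_derive; [easy|]. rewrite !Rmult_0_l, exp_0, cos_0, sin_0. ring. }
  exists (Rmin d1 d2); split; [now apply Rmin_glb_lt|]. intros h Hh.
  pose proof (Rmin_l d1 d2). pose proof (Rmin_r d1 d2).
  specialize (H1 h ltac:(lra)). specialize (H2 h ltac:(lra)).
  cbv beta in H1, H2. rewrite !Rmult_0_l, exp_0, cos_0 in H1.
  rewrite !Rmult_0_l, exp_0, sin_0 in H2.
  replace (Cexp (h * (a, b)) - 1 - h * (a, b))%C with
    (RtoC (exp (h * a) * cos (h * b) - 1 * 1 - a * h) +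
     Ci * RtoC (exp (h * a) * sin (h * b) - 1 * 0 - b * h))%C.
  2:{ unfold Cexp; simpl. rewrite !Rmult_0_l, Rminus_0_r, Rplus_0_r.
      apply injective_projections; simpl; ring. }
  eapply Rle_trans; [apply Cmod_triangle|].
  rewrite Cmod_mult, Cmod_Ci, !Cmod_R. lra.
Qed.

Lemma Cexp_continuous_0 (z : C) eps :
  0 < eps -> exists delta, 0 < delta /\
    forall h : R, Rabs h < delta -> Cmod (Cexp (h * z) - 1)%C <= eps.
Proof.
  intros He. destruct (Cexp_derivative_0 z 1 Rlt_0_1) as (d & Hd & H).
  pose proof (Cmod_ge_0 z).
  assert (Hq : 0 < eps / (1 + Cmod z)) by (apply Rdiv_lt_0_compat; lra).
  exists (Rmin d (eps / (1 + Cmod z))); split; [now apply Rmin_glb_lt|].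
  intros h Hh. pose proof (Rmin_l d (eps / (1 + Cmod z))).
  pose proof (Rmin_r d (eps / (1 + Cmod z))).
  replace (Cexp (h * z) - 1)%C with ((Cexp (h * z) - 1 - h * z) + h * z)%C by ring.
  eapply Rle_trans; [apply Cmod_triangle|].
  specialize (H h ltac:(lra)). rewrite (Cmod_mult h z), Cmod_R.
  assert (eps / (1 + Cmod z) * (1 + Cmod z) = eps) by (field; lra).
  pose proof (Rabs_pos h). nra.
Qed.

(** Uniform in the direction of [w]; it follows from the derivatives in the
    directions 1 and [Ci]. *)
Lemma Cexp_lipschitz_0 :
  exists delta, 0 < delta /\ forall w, Cmod w < delta -> Cmod (Cexp w - 1)%C <= 8 * Cmod w.
Proof.
  destruct (Cexp_derivative_0 1 1 Rlt_0_1) as (d1 & Hd1 & H1).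
  destruct (Cexp_derivative_0 Ci 1 Rlt_0_1) as (d2 & Hd2 & H2).
  exists (Rmin 1 (Rmin d1 d2)); split; [repeat apply Rmin_glb_lt; lra|]. intros [a b] Hw.
  pose proof (Rmin_l d1 d2). pose proof (Rmin_r d1 d2).
  pose proof (Rmin_l 1 (Rmin d1 d2)). pose proof (Rmin_r 1 (Rmin d1 d2)).
  pose proof (Rmax_Cmod (a, b)) as Hm. simpl in Hm.
  pose proof (Rmax_l (Rabs a) (Rabs b)). pose proof (Rmax_r (Rabs a) (Rabs b)).
  specialize (H1 a ltac:(lra)). specialize (H2 b ltac:(lra)).
  assert (Ha : Cmod (Cexp (a * 1) - 1) <= 2 * Rabs a).
  { replace (Cexp (a * 1) - 1)%C with ((Cexp (a * 1) - 1 - a * 1) + a)%C by ring.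
    eapply Rle_trans; [apply Cmod_triangle|]. rewrite Cmod_R. lra. }
  assert (Hb : Cmod (Cexp (b * Ci) - 1) <= 2 * Rabs b).
  { replace (Cexp (b * Ci) - 1)%C with ((Cexp (b * Ci) - 1 - b * Ci) + b * Ci)%C by ring.
    eapply Rle_trans; [apply Cmod_triangle|].
    rewrite (Cmod_mult b Ci), Cmod_R, Cmod_Ci. lra. }
  replace (Cexp (a, b)) with (Cexp (a * 1) * Cexp (b * Ci))%C
    by (rewrite <- Cexp_plus; f_equal; apply injective_projections; simpl; ring).
  set (u := Cexp (a * 1)) in *. set (v := Cexp (b * Ci)) in *.
  replace (u * v - 1)%C with ((u - 1) * (v - 1) + ((u - 1) + (v - 1)))%C by ring.
  eapply Rle_trans; [apply Cmod_triangle|].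
  eapply Rle_trans; [apply Rplus_le_compat_l, Cmod_triangle|]. rewrite Cmod_mult.
  pose proof (Cmod_ge_0 (u - 1)). pose proof (Cmod_ge_0 (v - 1)).
  pose proof (Rabs_pos a). pose proof (Rabs_pos b).
  assert (Cmod (u - 1) * Cmod (v - 1) <= 2 * Rabs a * (2 * 1)).
  { apply Rmult_le_compat; lra. }
  lra.
Qed.

Lemma Cexp_continuous_at_0 eps :
  0 < eps -> exists delta, 0 < delta /\
    forall w, Cmod w < delta -> Cmod (Cexp w - 1)%C <= eps.
Proof.
  intros He. destruct Cexp_lipschitz_0 as (d & Hd & H).
  exists (Rmin d (eps / 8)); split; [apply Rmin_glb_lt; lra|]. intros w Hw.
  pose proof (Rmin_l d (eps / 8)). pose proof (Rmin_r d (eps / 8)).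
  specialize (H w ltac:(lra)). lra.
Qed.

Section ScalarFactors.

Context {X : CompleteNormedModule C_AbsRing}.
Implicit Types (x y z w : X) (v f : R -> X).

Lemma little_o_bounded_scal (e : R -> C) (K : R) f (d : R) :
  0 < d -> (forall h, 0 < h < d -> Cmod (e h) <= K) -> little_o f ->
  little_o (fun h => e h ⊙ f h).
Proof.
  intros Hd HK Hf eps He.
  assert (HK0 : 0 <= K).
  { eapply Rle_trans; [apply Cmod_ge_0|apply (HK (d / 2)); lra]. }
  destruct (Hf (eps / (K + 1))) as (d1 & Hd1 & H1); [apply Rdiv_lt_0_compat; lra|].
  exists (Rmin d d1); split; [now apply Rmin_glb_lt|]. intros h Hh.
  pose proof (Rmin_l d d1). pose proof (Rmin_r d d1).
  eapply Rle_trans; [apply norm_cscal_le; [apply HK; lra|apply H1; lra]|].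
  assert (eps / (K + 1) * (K + 1) = eps) by (field; lra).
  assert (0 < eps / (K + 1)) by (apply Rdiv_lt_0_compat; lra). nra.
Qed.

Lemma little_o_scal_vector (e : R -> C) x :
  (forall eps, 0 < eps -> exists delta, 0 < delta /\
     forall h, 0 < h < delta -> Cmod (e h) <= eps * h) ->
  little_o (fun h => e h ⊙ x).
Proof.
  intros H eps He. pose proof (norm_pos x).
  destruct (H (eps / (‖x‖ + 1))) as (d & Hd & Hd'); [apply Rdiv_lt_0_compat; lra|].
  exists d; split; [easy|]. intros h Hh.
  eapply Rle_trans; [apply norm_cscal_le; [now apply Hd'|apply Rle_refl]|].
  assert (eps / (‖x‖ + 1) * (‖x‖ + 1) = eps) by (field; lra).
  assert (0 < eps / (‖x‖ + 1)) by (apply Rdiv_lt_0_compat; lra). nra.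
Qed.

Lemma little_o_times v :
  (forall eps, 0 < eps -> exists delta, 0 < delta /\
     forall h, 0 < h < delta -> ‖v h‖ <= eps) ->
  little_o (fun h => h ⊙ v h).
Proof.
  intros H eps He. destruct (H eps He) as (d & Hd & H1).
  exists d; split; [easy|]. intros h Hh. rewrite Rmult_comm.
  apply norm_real_scal_le; [lra|now apply H1].
Qed.

Lemma right_derivative_Cexp v t d (c : C) :
  right_derivative v t d ->
  right_derivative (fun s => Cexp (s * c) ⊙ v s) t (Cexp (t * c) ⊙ (d ⊕ c ⊙ v t)).
Proof.
  intros H.
  destruct (Cexp_continuous_0 c 1 Rlt_0_1) as (d0 & Hd0 & H0).
  assert (S1 : little_o (fun h => Cexp (h * c) ⊙ (v (t + h) ⊖ v t ⊖ h ⊙ d))).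
  { apply (little_o_bounded_scal (fun h => Cexp (RtoC h * c)) 2 _ d0); [easy| |easy].
    intros h Hh. replace (Cexp (h * c)) with ((Cexp (h * c) - 1) + 1)%C by ring.
    eapply Rle_trans; [apply Cmod_triangle|]. rewrite Cmod_1.
    specialize (H0 h). rewrite Rabs_pos_eq in H0 by lra. specialize (H0 ltac:(lra)).
    lra. }
  assert (S2 : little_o (fun h => (Cexp (h * c) - 1 - h * c)%C ⊙ v t)).
  { apply little_o_scal_vector. intros eps He.
    destruct (Cexp_derivative_0 c eps He) as (d1 & Hd1 & H1).
    exists d1; split; [easy|]. intros h Hh. specialize (H1 h).
    rewrite Rabs_pos_eq in H1 by lra. apply H1; lra. }
  assert (S3 : little_o (fun h => h ⊙ ((Cexp (h * c) - 1)%C ⊙ d))).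
  { apply little_o_times. intros eps He. pose proof (norm_pos d).
    destruct (Cexp_continuous_0 c (eps / (‖d‖ + 1))) as (d1 & Hd1 & Hd1').
    { apply Rdiv_lt_0_compat; lra. }
    exists d1; split; [easy|]. intros h Hh. specialize (Hd1' h).
    rewrite Rabs_pos_eq in Hd1' by lra. specialize (Hd1' ltac:(lra)).
    eapply Rle_trans; [apply norm_cscal_le; [apply Hd1'|apply Rle_refl]|].
    assert (eps / (‖d‖ + 1) * (‖d‖ + 1) = eps) by (field; lra).
    assert (0 < eps / (‖d‖ + 1)) by (apply Rdiv_lt_0_compat; lra). nra. }
  generalize (little_o_scal (Cexp (t * c)) _ (little_o_plus _ _ (little_o_plus _ _ S1 S2) S3)).
  apply little_o_ext. intros h Hh.
  replace (Cexp (RtoC (t + h) * c)) with (Cexp (t * c) * Cexp (h * c))%C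
    by (rewrite RtoC_plus, <- Cexp_plus; f_equal; ring).
  vec.
Qed.

Lemma continuous_Icc_Cexp v a b (c : C) :
  continuous_Icc v a b -> continuous_Icc (fun s => Cexp (s * c) ⊙ v s) a b.
Proof.
  intros H t Ht eps He.
  set (e0 := Cmod (Cexp (t * c)) + 1).
  assert (He0 : 1 <= e0) by (unfold e0; pose proof (Cmod_ge_0 (Cexp (t * c))); lra).
  pose proof (norm_pos (v t)).
  assert (HQ : 0 < e0 * (2 + ‖v t‖)) by (apply Rmult_lt_0_compat; lra).
  set (q := Rmin 1 (eps / (e0 * (2 + ‖v t‖)))).
  assert (Hq : 0 < q) by (apply Rmin_glb_lt; [lra|now apply Rdiv_lt_0_compat]).
  assert (Hq1 : q <= 1) by apply Rmin_l.
  assert (Hq2 : q <= eps / (e0 * (2 + ‖v t‖))) by apply Rmin_r.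
  destruct (H t Ht q Hq) as (d1 & Hd1 & H1).
  destruct (Cexp_continuous_0 c q Hq) as (d2 & Hd2 & H2).
  exists (Rmin d1 d2); split; [now apply Rmin_glb_lt|]. intros s Hs Hst.
  pose proof (Rmin_l d1 d2). pose proof (Rmin_r d1 d2).
  specialize (H1 s Hs ltac:(lra)). specialize (H2 (s - t) ltac:(lra)).
  replace (Cexp (s * c)) with (Cexp (t * c) * Cexp (RtoC (s - t) * c))%C
    by (rewrite RtoC_minus, <- Cexp_plus; f_equal; ring).
  set (e := Cexp (RtoC (s - t) * c)) in *.
  replace ((Cexp (t * c) * e)%C ⊙ v s ⊖ Cexp (t * c) ⊙ v t) with
    (Cexp (t * c) ⊙ ((e - 1)%C ⊙ (v s ⊖ v t) ⊕ (v s ⊖ v t) ⊕ (e - 1)%C ⊙ v t)) by vec.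
  apply Rle_trans with (e0 * (1 * q + q + q * ‖v t‖)).
  - apply norm_cscal_le; [unfold e0; lra|].
    apply norm_plus_le; [apply norm_plus_le; [|easy]|];
      apply norm_cscal_le; (lra || apply Rle_refl || easy).
  - replace eps with (eps / (e0 * (2 + ‖v t‖)) * (e0 * (2 + ‖v t‖))) by (field; lra).
    replace (e0 * (1 * q + q + q * ‖v t‖)) with (q * (e0 * (2 + ‖v t‖))) by ring.
    apply Rmult_le_compat_r; lra.
Qed.

End ScalarFactors.

(** * Filters and norms *)

Section FiltersAndNorms.

Context {X : CompleteNormedModule C_AbsRing}.
Implicit Types (x y z w : X) (T : R -> X -> X).

Lemma locally_norm_iff x (P : X -> Prop) :
  locally x P <-> exists eps, 0 < eps /\ forall z, ‖z ⊖ x‖ < eps -> P z.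
Proof.
  split.
  - intros H. apply (locally_norm_le_locally
      (V := CompleteNormedModule.NormedModule C_AbsRing X)) in H.
    destruct H as (e & He). exists e. split; [apply cond_pos|]. intros z Hz. now apply He.
  - intros (e & He & H). apply (locally_le_locally_norm
      (V := CompleteNormedModule.NormedModule C_AbsRing X)).
    exists (mkposreal e He). intros z Hz. now apply H.
Qed.

Lemma locally_norm_le x eps : 0 < eps -> locally x (fun z => ‖z ⊖ x‖ <= eps).
Proof. intros He. apply locally_norm_iff. exists eps. split; [easy|]. intros z Hz. lra. Qed.

Lemma adherent_norm_iff (P : X -> Prop) x :
  adherent P x <-> forall eps, 0 < eps -> exists z, P z /\ ‖z ⊖ x‖ <= eps.
Proof.
  split.
  - intros H eps He. apply H. now apply locally_norm_le.
  - intros H Q HQ. apply locally_norm_iff in HQ. destruct HQ as (e & He & HQ).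
    destruct (H (e / 2)) as (z & Hz & Hzx); [lra|]. exists z. split; [easy|].
    apply HQ. lra.
Qed.

Lemma adherent_pair_norm_iff (P : X * X -> Prop) x y :
  adherent P (x, y) <-> forall eps, 0 < eps ->
    exists x' y', P (x', y') /\ ‖x' ⊖ x‖ <= eps /\ ‖y' ⊖ y‖ <= eps.
Proof.
  split.
  - intros H eps He.
    destruct (H (fun p => ‖fst p ⊖ x‖ <= eps /\ ‖snd p ⊖ y‖ <= eps)) as ((x' & y') & H1 & H2).
    + destruct (locally_norm_le x eps He) as (e1 & H1).
      destruct (locally_norm_le y eps He) as (e2 & H2).
      assert (Hm : 0 < Rmin e1 e2) by (apply Rmin_glb_lt; apply cond_pos).
      exists (mkposreal _ Hm). intros (x' & y') (Hx & Hy). split; simpl.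
      * apply H1. eapply ball_le; [|exact Hx]. apply Rmin_l.
      * apply H2. eapply ball_le; [|exact Hy]. apply Rmin_r.
    + now exists x', y'.
  - intros H Q (e & HQ). pose proof (cond_pos e).
    destruct (H (e / 2)) as (x' & y' & HP & Hx & Hy); [lra|].
    exists (x', y'). split; [easy|]. apply HQ.
    split; apply (norm_compat1 (V := CompleteNormedModule.NormedModule C_AbsRing X)).
    + apply Rle_lt_trans with (e / 2); [exact Hx|lra].
    + apply Rle_lt_trans with (e / 2); [exact Hy|lra].
Qed.

Lemma continuous_on_norm_iff (D : R -> Prop) (f : R -> X) :
  continuous_on D f <-> forall t, D t -> forall eps, 0 < eps -> exists delta, 0 < delta /\
    forall s, D s -> Rabs (s - t) < delta -> ‖f s ⊖ f t‖ <= eps.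
Proof.
  split.
  - intros H t Ht eps He. destruct (H t Ht _ (locally_norm_le (f t) eps He)) as (d & Hd).
    exists d. split; [apply cond_pos|]. intros s Hs Hst. now apply Hd.
  - intros H t Ht P HP. apply locally_norm_iff in HP. destruct HP as (e & He & HP).
    destruct (H t Ht (e / 2)) as (d & Hd & H1); [lra|].
    exists (mkposreal d Hd). intros s Hst Hs. apply HP.
    apply Rle_lt_trans with (e / 2); [|lra]. now apply H1.
Qed.

Lemma continuous_on_plane_norm_iff (D : R * R -> Prop) (f : R * R -> X) :
  continuous_on D f <->
  forall s t, D (s, t) -> forall eps, 0 < eps -> exists delta, 0 < delta /\
    forall s' t', D (s', t') -> Rabs (s' - s) < delta -> Rabs (t' - t) < delta ->
      ‖f (s', t') ⊖ f (s, t)‖ <= eps.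
Proof.
  split.
  - intros H s t Ht eps He.
    destruct (H (s, t) Ht _ (locally_norm_le (f (s, t)) eps He)) as (d & Hd).
    exists d. split; [apply cond_pos|]. intros s' t' Hs Hss Htt.
    apply (Hd (s', t')); [|easy]. now split.
  - intros H (s & t) Ht P HP. apply locally_norm_iff in HP. destruct HP as (e & He & HP).
    destruct (H s t Ht (e / 2)) as (d & Hd & H1); [lra|].
    exists (mkposreal d Hd). intros (s' & t') (Hss & Htt) Hs. apply HP.
    apply Rle_lt_trans with (e / 2); [|lra]. now apply H1.
Qed.

Lemma generator_filterlim T x y :
  filterlim (fun h : R => scal (RtoC (/ h) : C_AbsRing) (minus (T h x) x))
    (at_right 0) (locally y) <-> generator T x y.
Proof.
  split.
  - intros H eps He. destruct (H _ (locally_norm_le y eps He)) as (d & Hd).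
    exists d. split; [apply cond_pos|]. intros h Hh.
    assert (Hb : ‖(/ h) ⊙ (T h x ⊖ x) ⊖ y‖ <= eps).
    { apply (Hd h); [|lra]. change (Rabs (h - 0) < d).
      rewrite Rminus_0_r, Rabs_pos_eq; lra. }
    replace (T h x ⊖ x ⊖ h ⊙ y) with (h ⊙ ((/ h) ⊙ (T h x ⊖ x) ⊖ y)).
    + rewrite Rmult_comm. apply norm_real_scal_le; [lra|easy].
    + transitivity ((h * / h) ⊙ (T h x ⊖ x) ⊖ h ⊙ y); [vec|].
      rewrite Rinv_r by lra. vec.
  - intros H P HP. apply locally_norm_iff in HP. destruct HP as (e & He & HP).
    destruct (H (e / 2)) as (d & Hd & H1); [lra|].
    exists (mkposreal d Hd). intros h Hh Hh0. apply HP.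
    change (Rabs (h - 0) < d) in Hh. rewrite Rminus_0_r, Rabs_pos_eq in Hh by lra.
    specialize (H1 h ltac:(lra)).
    apply Rle_lt_trans with (/ h * (e / 2 * h)).
    + replace (_ ⊖ y) with ((/ h) ⊙ (T h x ⊖ x ⊖ h ⊙ y)).
      * apply norm_real_scal_le; [left; now apply Rinv_0_lt_compat|easy].
      * transitivity ((/ h) ⊙ (T h x ⊖ x) ⊖ (/ h * h) ⊙ y); [vec|].
        rewrite Rinv_l by lra. vec.
    + replace (/ h * (e / 2 * h)) with (e / 2) by (field; lra). lra.
Qed.

Lemma semigroup_C0 T : semigroup T -> is_C0_semigroup T.
Proof.
  intros H. split; [|split; [|split]].
  - apply (sg_linear _ H).
  - apply (sg_zero _ H).
  - intros s t x Hs Ht. now apply (sg_add _ H).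
  - intros x. apply continuous_on_norm_iff. intros t Ht eps He.
    destruct (semigroup_continuous_Icc T x (t + 1) H t ltac:(lra) eps He) as (d & Hd & H1).
    exists (Rmin d 1). split; [apply Rmin_glb_lt; lra|]. intros s Hs Hst.
    pose proof (Rmin_l d 1). pose proof (Rmin_r d 1).
    apply H1; [|lra]. apply Rabs_def2 in Hst. lra.
Qed.

Lemma C0_semigroup T :
  is_C0_semigroup T -> (forall p, exists K, bounded_upto T p K) -> semigroup T.
Proof.
  intros (H1 & H2 & H3 & H4) HB. split; [easy..| |easy|].
  - intros s t x Hs Ht. now apply H3.
  - intros x eps He. pose proof (proj1 (continuous_on_norm_iff _ _) (H4 x)) as Hc.
    destruct (Hc 0 (Rle_refl 0) eps He) as (d & Hd & H).
    exists d. split; [easy|]. intros t Ht. rewrite <- (H2 x) at 2. apply H; [lra|].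
    rewrite Rminus_0_r, Rabs_pos_eq; lra.
Qed.

Lemma is_derive_within_norm_iff (D : R -> Prop) (f : R -> X) (t : R) l : D t ->
  is_derive_within (V := real_of X) D f t l <->
  forall eps, 0 < eps -> exists delta, 0 < delta /\
    forall s, D s -> Rabs (s - t) < delta ->
      ‖f s ⊖ f t ⊖ (s - t) ⊙ l‖ <= eps * Rabs (s - t).
Proof.
  intros Ht. split.
  - intros (_ & H) eps He.
    assert (Hlim : is_filter_lim (within D (locally t)) t).
    { intros P (e & HP). exists e. intros s Hs _. now apply HP. }
    destruct (H t Hlim (mkposreal eps He)) as (d & Hd).
    exists d. split; [apply cond_pos|]. intros s Hs Hst. exact (Hd s Hst Hs).
  - intros H. split.
    + apply (is_linear_scal_l (V := real_of X)).
    + intros t0 Ht0.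
      assert (Et : t0 = t).
      { apply Rminus_diag_uniq. destruct (Req_dec (t0 - t) 0) as [|Hn]; [easy|exfalso].
        assert (Hp : 0 < Rabs (t0 - t)) by now apply Rabs_pos_lt.
        destruct (Ht0 (fun z : R => Rabs (z - t0) < Rabs (t0 - t))) as (d & Hd).
        { exists (mkposreal _ Hp). intros z Hz. exact Hz. }
        specialize (Hd t (ball_center t d) Ht). cbv beta in Hd.
        rewrite Rabs_minus_sym in Hd. lra. }
      subst t0. intros eps. destruct (H eps (cond_pos eps)) as (d & Hd & H1).
      exists (mkposreal d Hd). intros s Hst Hs. exact (H1 s Hs Hst).
Qed.

End FiltersAndNorms.

(** * Riemann sums *)

Fixpoint riemann_sum {V : NormedModule R_AbsRing} (f : R -> V) (t : nat -> R) (h : R)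
    (n : nat) : V :=
  match n with
  | O => scal h (f (t O))
  | S k => plus (scal h (f (t n))) (riemann_sum f t h k)
  end.

Lemma continuous_of_norm {V : NormedModule R_AbsRing} (f : R -> V) (t : R) :
  (forall eps, 0 < eps -> exists delta, 0 < delta /\
     forall s, Rabs (s - t) < delta -> norm (minus (f s) (f t)) <= eps) ->
  continuous f t.
Proof.
  intros H P HP. apply locally_norm_le_locally in HP. destruct HP as (e & He).
  destruct (H (e / 2)) as (d & Hd & H1).
  { apply is_pos_div_2. }
  exists (mkposreal d Hd). intros s Hs. apply He.
  apply Rle_lt_trans with (e / 2); [now apply H1|].
  pose proof (cond_pos e). lra.
Qed.

Lemma uniform_continuity_Icc {V : NormedModule R_AbsRing} (f : R -> V) a b eps :
  (forall t, a <= t <= b -> continuous f t) -> 0 < eps ->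
  exists delta, 0 < delta /\ forall x y, a <= x <= b -> a <= y <= b ->
    Rabs (x - y) <= delta -> norm (minus (f x) (f y)) <= eps.
Proof.
  intros H He. destruct (unifcont_normed_1d f a b H (mkposreal eps He)) as (d & Hd).
  exists (d / 2). split; [apply is_pos_div_2|]. intros x y Hx Hy Hxy.
  left. apply (Hd y x Hy Hx). change (Rabs (x - y) < d).
  pose proof (cond_pos d). lra.
Qed.

Lemma minus_plus_plus {V : AbelianGroup} (p q r s : V) :
  minus (plus p q) (plus s r) = plus (minus p r) (minus q s).
Proof.
  unfold minus. rewrite opp_plus, <- !plus_assoc. f_equal.
  rewrite (plus_comm (opp s)), !plus_assoc. f_equal. apply plus_comm.
Qed.

Section RiemannSums.

Context {V : CompleteNormedModule R_AbsRing}.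

Lemma RInt_minus_const_le (f : R -> V) (a b eps : R) (v : V) :
  a <= b -> (forall x, a <= x <= b -> continuous f x) ->
  (forall x, a <= x <= b -> norm (minus (f x) v) <= eps) ->
  norm (minus (RInt f a b) (scal (b - a) v)) <= (b - a) * eps.
Proof.
  intros Hab Hf HB.
  apply (norm_RInt_le_const (fun x => minus (f x) v) a b); [easy..|].
  apply (is_RInt_minus f (fun _ => v) a b (RInt f a b) (scal (b - a) v)).
  - apply (RInt_correct f), ex_RInt_continuous. intros z Hz. apply Hf.
    now rewrite Rmin_left, Rmax_right in Hz.
  - apply (is_RInt_const a b v).
Qed.

(** The modulus of continuity at the scale of the mesh is a hypothesis, so that the
    error is uniform over equicontinuous families, as in [segment_commutator_small]. *)
Lemma riemann_sum_error (f : R -> V) (a b eps : R) (n : nat) :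
  a <= b -> (forall x, a <= x <= b -> continuous f x) ->
  (forall x y, a <= x <= b -> a <= y <= b -> Rabs (x - y) <= (b - a) / INR (S n) ->
     norm (minus (f x) (f y)) <= eps) ->
  norm (minus (RInt f a b)
    (riemann_sum f (fun i => a + INR i * ((b - a) / INR (S n)))
       ((b - a) / INR (S n)) n)) <= (b - a) * eps.
Proof.
  intros Hab Hf He.
  assert (HN : 0 < INR (S n)) by (apply lt_0_INR; lia).
  set (h := (b - a) / INR (S n)) in *.
  assert (Hh : 0 <= h) by (apply Rdiv_le_0_compat; lra).
  assert (HNh : INR (S n) * h = b - a) by (unfold h; field; lra).
  set (t := fun i => a + INR i * h).
  assert (Ht : forall i, (i <= S n)%nat -> a <= t i <= b).
  { intros i Hi. apply le_INR in Hi. pose proof (pos_INR i). unfold t. nra. }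
  assert (Hex : forall c d, a <= c -> c <= d -> d <= b -> ex_RInt f c d).
  { intros c d Hc Hcd Hd. apply (ex_RInt_continuous f). intros z Hz.
    rewrite Rmin_left, Rmax_right in Hz by easy. apply Hf; lra. }
  assert (Hstep : forall k, (k <= n)%nat ->
    norm (minus (RInt f (t k) (t (S k))) (scal h (f (t k)))) <= h * eps).
  { intros k Hk. replace h with (t (S k) - t k) by (unfold t; rewrite S_INR; ring).
    pose proof (Ht k ltac:(lia)). pose proof (Ht (S k) ltac:(lia)).
    assert (E : t (S k) = t k + h) by (unfold t; rewrite S_INR; ring).
    apply RInt_minus_const_le; [lra| |].
    - intros x Hx. apply Hf; lra.
    - intros x Hx. apply He; [lra..|]. rewrite Rabs_pos_eq; lra. }
  assert (Main : forall k, (k <= n)%nat ->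
    norm (minus (RInt f a (t (S k))) (riemann_sum f t h k)) <= INR (S k) * h * eps).
  { induction k as [|k IH]; intros Hk.
    - simpl riemann_sum. replace a with (t O) at 1 by (unfold t; simpl; ring).
      replace (INR 1 * h * eps) with (h * eps) by (simpl; ring). now apply Hstep.
    - pose proof (Ht (S k) ltac:(lia)). pose proof (Ht (S (S k)) ltac:(lia)).
      assert (E : t (S (S k)) = t (S k) + h) by (unfold t; rewrite (S_INR (S k)); ring).
      rewrite <- (RInt_Chasles f a (t (S k)) (t (S (S k)))).
      2, 3: apply Hex; lra.
      cbn [riemann_sum].
      replace (minus _ _) with
        (plus (minus (RInt f a (t (S k))) (riemann_sum f t h k))
           (minus (RInt f (t (S k)) (t (S (S k)))) (scal h (f (t (S k)))))).
      + eapply Rle_trans; [exact (norm_triangle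
          (V := CompleteNormedModule.NormedModule R_AbsRing V) _ _)|].
        specialize (IH ltac:(lia)). specialize (Hstep (S k) Hk).
        replace (INR (S (S k)) * h * eps) with (INR (S k) * h * eps + h * eps)
          by (rewrite (S_INR (S k)); ring).
        now apply Rplus_le_compat.
      + symmetry; exact (minus_plus_plus _ _ _ _). }
  specialize (Main n ltac:(lia)).
  replace (t (S n)) with b in Main by (unfold t; lra).
  now rewrite HNh in Main.
Qed.

End RiemannSums.

(** * Semigroups with scalar commutators *)

Section ScalarCommutators.

Context {X : CompleteNormedModule C_AbsRing}.
Context (A : R -> operator X) (E : R -> R -> X -> X) (mu : R -> R -> C).
Implicit Types (x y z w : X) (T : R -> X -> X) (G : X -> X) (m : R -> C).

Definition continuity_space y : Prop :=
  (forall t, dom (A t) y) /\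
  forall t eps, 0 < eps -> exists delta, 0 < delta /\
    forall s, Rabs (s - t) < delta -> ‖op (A s) y ⊖ op (A t) y‖ <= eps.

Definition scalar_continuous m : Prop :=
  forall t eps, 0 < eps -> exists delta, 0 < delta /\
    forall s, Rabs (s - t) < delta -> Cmod (m s - m t) <= eps.

Context (E_semigroup : forall t, semigroup (E t)).
Context (A_generator : forall t x y, graph (A t) (x, y) <-> generator (E t) x y).
Context (A_commutes : forall s t tau x, 0 <= tau -> dom (A s) x ->
  dom (A s) (E t tau x) /\
  op (A s) (E t tau x) = E t tau (op (A s) x ⊕ (mu s t * tau)%C ⊙ x)).
Context (Y_dense : forall x eps, 0 < eps ->
  exists y, continuity_space y /\ ‖y ⊖ x‖ <= eps).
Context (mu_uniform : forall eps, 0 < eps -> exists delta, 0 < delta /\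
  forall a b c d, Rabs (a - c) <= delta -> Rabs (b - d) <= delta ->
    Cmod (mu a b - mu c d) <= eps).

Notation Y := continuity_space.

Lemma A_op t x : dom (A t) x -> generator (E t) x (op (A t) x).
Proof. intros H. apply A_generator. now split. Qed.

Lemma A_graph t x y : generator (E t) x y -> dom (A t) x /\ op (A t) x = y.
Proof. intros H. now apply A_generator in H. Qed.

Lemma A_plus t x y : dom (A t) x -> dom (A t) y ->
  dom (A t) (x ⊕ y) /\ op (A t) (x ⊕ y) = op (A t) x ⊕ op (A t) y.
Proof. intros Hx Hy. apply A_graph, generator_plus; [easy|now apply A_op..]. Qed.

Lemma A_scal t (c : C) x : dom (A t) x ->
  dom (A t) (c ⊙ x) /\ op (A t) (c ⊙ x) = c ⊙ op (A t) x.
Proof. intros Hx. apply A_graph, generator_scal; [easy|now apply A_op]. Qed.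

Lemma A_closed t x y :
  (forall eps, 0 < eps -> exists x', dom (A t) x' /\
     ‖x' ⊖ x‖ <= eps /\ ‖op (A t) x' ⊖ y‖ <= eps) ->
  dom (A t) x /\ op (A t) x = y.
Proof.
  intros H. apply A_graph, generator_closed; [easy|]. intros eps He.
  destruct (H eps He) as (x' & H1 & H2). exists x', (op (A t) x'). split; [|easy].
  now apply A_op.
Qed.

Lemma Y_zero : Y 𝟎.
Proof.
  assert (H : forall t, dom (A t) 𝟎 /\ op (A t) 𝟎 = 𝟎).
  { intros t. now apply A_graph, generator_zero. }
  split; [intros t; apply H|]. intros t eps He. exists 1; split; [lra|].
  intros s _. rewrite !(proj2 (H _)). replace (𝟎 ⊖ 𝟎) with (𝟎 : X) by vec.
  rewrite norm_null. lra.
Qed.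

Lemma Y_plus x y : Y x -> Y y -> Y (x ⊕ y).
Proof.
  intros (Hx & Cx) (Hy & Cy). split.
  { intros t. now apply A_plus. }
  intros t eps He.
  destruct (Cx t (eps / 2)) as (d1 & Hd1 & H1); [lra|].
  destruct (Cy t (eps / 2)) as (d2 & Hd2 & H2); [lra|].
  exists (Rmin d1 d2); split; [now apply Rmin_glb_lt|]. intros s Hs.
  pose proof (Rmin_l d1 d2). pose proof (Rmin_r d1 d2).
  rewrite (proj2 (A_plus s x y (Hx s) (Hy s))), (proj2 (A_plus t x y (Hx t) (Hy t))).
  replace (op (A s) x ⊕ op (A s) y ⊖ (op (A t) x ⊕ op (A t) y)) with
    ((op (A s) x ⊖ op (A t) x) ⊕ (op (A s) y ⊖ op (A t) y)) by vec.
  replace eps with (eps / 2 + eps / 2) by field.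
  apply norm_plus_le; [apply H1|apply H2]; lra.
Qed.

Lemma Y_scal (c : C) x : Y x -> Y (c ⊙ x).
Proof.
  intros (Hx & Cx). split.
  { intros t. now apply A_scal. }
  intros t eps He. pose proof (Cmod_ge_0 c).
  assert (Hq : 0 < eps / (Cmod c + 1)) by (apply Rdiv_lt_0_compat; lra).
  destruct (Cx t _ Hq) as (d1 & Hd1 & H1).
  exists d1; split; [easy|]. intros s Hs.
  rewrite (proj2 (A_scal s c x (Hx s))), (proj2 (A_scal t c x (Hx t))).
  replace (c ⊙ op (A s) x ⊖ c ⊙ op (A t) x) with
    (c ⊙ (op (A s) x ⊖ op (A t) x)) by vec.
  eapply Rle_trans; [apply norm_cscal_le; [apply Rle_refl|now apply H1]|].
  assert (eps / (Cmod c + 1) * (Cmod c + 1) = eps) by (field; lra). nra.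
Qed.

(** The abstract form of a semigroup generated by an integral [∫ A r dν(r)], where
    the commutator of [A r] with the generator is the scalar [m r = ∫ mu r s dν(s)].
    It covers multiples of a single [A s], finite sums, and limits of those. *)
Record weyl T G m : Prop := {
  weyl_semigroup : semigroup T;
  weyl_generator : forall y, Y y -> generator T y (G y);
  weyl_commutes : forall r t y, 0 <= t -> Y y ->
    dom (A r) (T t y) /\
    op (A r) (T t y) = T t (op (A r) y ⊕ (m r * t)%C ⊙ y);
  weyl_continuous : scalar_continuous m }.

(** Satisfied by [G y = ∫ A r y dν(r)] and [l m = ∫ m dν]: integrating the
    commutators [m r] of [A r] with the generator of [T] against [ν] gives the
    commutator of [G] with it. *)
Definition pairing G (l : (R -> C) -> C) : Prop :=
  forall T G' m, weyl T G' m -> forall t y, 0 <= t -> Y y ->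
    G (T t y) = T t (G y ⊕ (l m * t)%C ⊙ y).

(** [A s (T t y) - A r (T t y)] is the image under [T t] of
    [A s y - A r y + (m s - m r) t y]. *)
Lemma weyl_invariant T G m t y : weyl T G m -> 0 <= t -> Y y -> Y (T t y).
Proof.
  intros HT Ht Hy. split.
  { intros r. now apply (weyl_commutes T G m HT). }
  intros r eps He.
  pose proof (sg_linear T (weyl_semigroup T G m HT) t Ht) as HL.
  destruct (linear_norm (T t) HL) as (K & HK & HB).
  pose proof (norm_pos y).
  assert (Hq1 : 0 < eps / 2 / K) by (apply Rdiv_lt_0_compat; lra).
  assert (Hq2 : 0 < eps / 2 / (K * ((t + 1) * (‖y‖ + 1))))
    by (apply Rdiv_lt_0_compat; [lra|repeat apply Rmult_lt_0_compat; lra]).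
  destruct (proj2 Hy r _ Hq1) as (d1 & Hd1 & H1).
  destruct (weyl_continuous T G m HT r _ Hq2) as (d2 & Hd2 & H2).
  exists (Rmin d1 d2); split; [now apply Rmin_glb_lt|]. intros s Hs.
  pose proof (Rmin_l d1 d2). pose proof (Rmin_r d1 d2).
  rewrite !(fun r => proj2 (weyl_commutes T G m HT r t y Ht Hy)).
  rewrite <- (linear_sub (T t)) by easy.
  eapply Rle_trans; [apply HB|].
  replace (op (A s) y ⊕ (m s * t)%C ⊙ y ⊖ (op (A r) y ⊕ (m r * t)%C ⊙ y))
    with ((op (A s) y ⊖ op (A r) y) ⊕ ((m s - m r) * t)%C ⊙ y) by vec.
  apply Rle_trans with
    (K * (eps / 2 / K + eps / 2 / (K * ((t + 1) * (‖y‖ + 1))) * t * ‖y‖)).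
  - apply Rmult_le_compat_l; [lra|]. apply norm_plus_le; [apply H1; lra|].
    apply norm_cscal_le; [|apply Rle_refl].
    rewrite Cmod_mult, Cmod_R, Rabs_pos_eq by easy.
    apply Rmult_le_compat_r; [easy|]. apply H2; lra.
  - replace (K * (eps / 2 / K + eps / 2 / (K * ((t + 1) * (‖y‖ + 1))) * t * ‖y‖))
      with (eps / 2 + eps / 2 * (t / (t + 1)) * (‖y‖ / (‖y‖ + 1))) by (field; lra).
    assert (Ht1 : 0 <= t / (t + 1) <= 1).
    { split; [apply Rdiv_le_0_compat; lra|]. apply Rle_div_l; lra. }
    assert (Hy1 : 0 <= ‖y‖ / (‖y‖ + 1) <= 1).
    { split; [apply Rdiv_le_0_compat; lra|]. apply Rle_div_l; lra. }
    assert (t / (t + 1) * (‖y‖ / (‖y‖ + 1)) <= 1) by nra. nra.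
Qed.

(** A generator commutes with its own semigroup. *)
Lemma weyl_G_orbit T G m t y :
  weyl T G m -> 0 <= t -> Y y -> G (T t y) = T t (G y).
Proof.
  intros HT Ht Hy. pose proof (weyl_semigroup T G m HT).
  apply (generator_unique T (T t y)); [easy| |].
  - apply (weyl_generator T G m HT). now apply (weyl_invariant T G m).
  - apply generator_orbit; [easy| |easy]. now apply (weyl_generator T G m HT).
Qed.

(** A generator has no commutator with itself: comparing the two expressions for
    [G (T t y)] gives [l m (T t y) = 0] for [t > 0], and then [t] tends to 0.  For the
    integrals of [A] this replaces the antisymmetry of [mu]. *)
Lemma weyl_pairing_self T G m l y :
  weyl T G m -> pairing G l -> Y y -> l m ⊙ y = 𝟎.
Proof.
  intros HT HG Hy. pose proof (weyl_semigroup T G m HT) as HS.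
  assert (H : forall t, 0 < t -> l m ⊙ T t y = 𝟎).
  { intros t Ht. pose proof (HG T G m HT t y ltac:(lra) Hy) as H1.
    rewrite (weyl_G_orbit T G m t y HT) in H1 by (easy || lra).
    rewrite (linear_add (T t)), (linear_cscal (T t)) in H1 by (apply (sg_linear T HS); lra).
    replace (l m ⊙ T t y) with
      (/ t ⊙ ((T t (G y) ⊕ (l m * t)%C ⊙ T t y) ⊖ T t (G y))).
    - rewrite <- H1. vec.
    - transitivity ((l m * RtoC (/ t * t))%C ⊙ T t y); [vec|].
      rewrite Rinv_l by lra. vec. }
  apply eq_of_norm_eps. intros eps He. pose proof (Cmod_ge_0 (l m)).
  destruct (sg_continuous T HS y (eps / (Cmod (l m) + 1))) as (d & Hd & H1).
  { apply Rdiv_lt_0_compat; lra. }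
  replace (l m ⊙ y ⊖ 𝟎) with (l m ⊙ T (d / 2) y ⊖ l m ⊙ (T (d / 2) y ⊖ y)) by vec.
  rewrite H by lra.
  replace (𝟎 ⊖ l m ⊙ (T (d / 2) y ⊖ y)) with ((- l m)%C ⊙ (T (d / 2) y ⊖ y)) by vec.
  eapply Rle_trans; [apply norm_cscal_le; [apply Rle_refl|apply H1; lra]|].
  rewrite Cmod_opp.
  assert (eps / (Cmod (l m) + 1) * (Cmod (l m) + 1) = eps) by (field; lra).
  assert (0 < eps / (Cmod (l m) + 1)) by (apply Rdiv_lt_0_compat; lra). nra.
Qed.

Lemma linear_eq_on_Y (L1 L2 : X -> X) :
  is_linear L1 -> is_linear L2 -> (forall y, Y y -> L1 y = L2 y) ->
  forall x, L1 x = L2 x.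
Proof.
  intros H1 H2 HY x. apply eq_of_norm_eps. intros eps He.
  destruct (linear_norm L1 H1) as (K1 & HK1 & B1).
  destruct (linear_norm L2 H2) as (K2 & HK2 & B2).
  destruct (Y_dense x (eps / (K1 + K2))) as (y & Hy & Hyx).
  { apply Rdiv_lt_0_compat; lra. }
  replace (L1 x ⊖ L2 x) with (L2 (y ⊖ x) ⊖ L1 (y ⊖ x)).
  - replace eps with (K2 * (eps / (K1 + K2)) + K1 * (eps / (K1 + K2))) by (field; lra).
    apply norm_minus_le; (eapply Rle_trans; [apply B1 || apply B2|]);
      apply Rmult_le_compat_l; lra.
  - rewrite (linear_sub L1), (linear_sub L2), (HY y Hy) by easy. vec.
Qed.

Lemma is_linear_cscal (c : C) (L : X -> X) : is_linear L -> is_linear (fun x => c ⊙ L x).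
Proof.
  intros H. apply (is_linear_comp L (fun x => scal (c : C_AbsRing) x)); [easy|].
  exact (is_linear_scal_r (K := C_AbsRing)
    (V := CompleteNormedModule.NormedModule C_AbsRing X) c Cmult_comm).
Qed.

(** The Weyl form of the canonical commutation relation: as functions of [p], both
    sides solve the initial value problem for the generator of [T1] with initial
    value [T2 q y]. *)
Lemma weyl_commutation T1 G1 m1 T2 G2 m2 l p q x :
  weyl T1 G1 m1 -> pairing G1 l -> weyl T2 G2 m2 -> 0 <= p -> 0 <= q ->
  T1 p (T2 q x) = Cexp (p * (q * l m2))%C ⊙ T2 q (T1 p x).
Proof.
  intros H1 Hp1 H2 Hp Hq.
  pose proof (weyl_semigroup _ _ _ H1) as S1. pose proof (weyl_semigroup _ _ _ H2) as S2.
  pose proof (sg_linear _ S2 q Hq) as L2.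
  revert x. apply linear_eq_on_Y.
  { apply (is_linear_comp (T2 q) (T1 p)); [easy|]. now apply (sg_linear _ S1). }
  { apply is_linear_cscal. apply (is_linear_comp (T1 p) (T2 q)); [|easy].
    now apply (sg_linear _ S1). }
  intros y Hy. set (c := (q * l m2)%C).
  destruct (sg_bounded T1 S1 p) as (K & HK).
  set (u := fun t : R => Cexp (t * c) ⊙ T2 q (T1 t y)).
  assert (Hu0 : u 0 = T2 q y).
  { unfold u. rewrite Cmult_0_l, Cexp_0, (sg_zero T1 S1). vec. }
  symmetry. change (u p = T1 p (T2 q y)). rewrite <- Hu0.
  apply eq_of_norm. replace 0 with (K * 0 * p) at 2 by ring.
  apply (duhamel_semigroup T1 u p K 0); [easy..| |].
  { apply (continuous_Icc_Cexp (fun s => T2 q (T1 s y))).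
    apply continuous_Icc_linear; [easy|].
    now apply semigroup_continuous_Icc. }
  intros t Ht.
  assert (HY1 : Y (T1 t y)) by (apply (weyl_invariant T1 G1 m1); [easy|lra|easy]).
  exists (Cexp (t * c) ⊙ (T2 q (T1 t (G1 y)) ⊕ c ⊙ T2 q (T1 t y))).
  exists (Cexp (t * c) ⊙ G1 (T2 q (T1 t y))). split; [|split].
  - apply (right_derivative_Cexp (fun s => T2 q (T1 s y)) t).
    generalize (little_o_linear (T2 q) _ L2 (generator_right_derivative T1 y (G1 y) t S1
      (weyl_generator _ _ _ H1 y Hy) ltac:(lra))).
    apply little_o_ext. intros h Hh.
    now rewrite !(linear_sub (T2 q)), (linear_cscal (T2 q)).
  - apply generator_scal; [easy|]. apply (weyl_generator _ _ _ H1).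
    now apply (weyl_invariant T2 G2 m2).
  - rewrite (Hp1 T2 G2 m2 H2 q _ Hq HY1), (weyl_G_orbit T1 G1 m1 t y H1) by (easy || lra).
    rewrite (linear_add (T2 q)), (linear_cscal (T2 q)) by easy.
    replace (l m2 * q)%C with c by (unfold c; ring).
    replace (_ ⊖ _) with (𝟎 : X) by vec. rewrite norm_null. lra.
Qed.

Lemma weyl_ext T T' G G' m m' :
  (forall t x, 0 <= t -> T t x = T' t x) -> (forall y, Y y -> G y = G' y) ->
  (forall r, m r = m' r) -> weyl T G m -> weyl T' G' m'.
Proof.
  intros HT HG Hm H. pose proof (weyl_semigroup _ _ _ H) as S. split.
  - split.
    + intros t Ht. apply (is_linear_ext (T t)); [intros x; now apply HT|].
      now apply (sg_linear _ S).
    + intros x. rewrite <- HT by lra. apply (sg_zero _ S).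
    + intros s t x Hs Ht. rewrite <- !HT by lra. now apply (sg_add _ S).
    + intros p. destruct (sg_bounded _ S p) as (K & HK & HB). exists K.
      split; [easy|]. intros t x Ht. rewrite <- HT by lra. now apply HB.
    + intros x eps He. destruct (sg_continuous _ S x eps He) as (d & Hd & H1).
      exists d; split; [easy|]. intros t Ht. rewrite <- HT by lra. now apply H1.
  - intros y Hy. rewrite <- HG by easy.
    generalize (weyl_generator _ _ _ H y Hy). apply little_o_ext.
    intros h Hh. now rewrite HT by lra.
  - intros r t y Ht Hy. rewrite <- !HT, <- Hm by easy.
    now apply (weyl_commutes _ _ _ H).
  - intros t eps He. destruct (weyl_continuous _ _ _ H t eps He) as (d & Hd & H1).
    exists d; split; [easy|]. intros s Hs. rewrite <- !Hm. now apply H1.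
Qed.

(** The scalar factor [exp (c t^2)] does not change a derivative at [t = 0]. *)
Lemma Cexp_square_small (c : C) eps :
  0 < eps -> exists delta, 0 < delta /\
    forall t : R, 0 <= t < delta -> Cmod (Cexp (RtoC (t * t) * c) - 1)%C <= eps * t.
Proof.
  intros He. destruct (Cexp_derivative_0 c 1 Rlt_0_1) as (d & Hd & H).
  pose proof (Cmod_ge_0 c).
  assert (Hq : 0 < eps / (1 + Cmod c)) by (apply Rdiv_lt_0_compat; lra).
  assert (Hq' : eps / (1 + Cmod c) * (1 + Cmod c) = eps) by (field; lra).
  set (q := eps / (1 + Cmod c)) in *.
  exists (Rmin (Rmin 1 d) q); split; [repeat apply Rmin_glb_lt; lra|].
  intros t Ht. pose proof (Rmin_l (Rmin 1 d) q). pose proof (Rmin_r (Rmin 1 d) q).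
  pose proof (Rmin_l 1 d). pose proof (Rmin_r 1 d).
  assert (Htt : 0 <= t * t) by nra.
  specialize (H (t * t)). rewrite Rabs_pos_eq in H by easy. specialize (H ltac:(nra)).
  replace (Cexp (RtoC (t * t) * c) - 1)%C with
    ((Cexp (RtoC (t * t) * c) - 1 - RtoC (t * t) * c) + RtoC (t * t) * c)%C by ring.
  eapply Rle_trans; [apply Cmod_triangle|].
  rewrite (Cmod_mult (RtoC (t * t)) c), Cmod_R, Rabs_pos_eq by easy.
  apply Rle_trans with (t * t * (1 + Cmod c)); [lra|].
  rewrite <- Hq'. assert (0 <= t * (1 + Cmod c)) by (apply Rmult_le_pos; lra). nra.
Qed.

(** The product [T1 t T2 t] has the right derivative at 0, but it is not a semigroup;
    the scalar factor compensates [T1 q T2 p = exp (p q (l m2)) T2 p T1 q], because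
    [(p + q)^2 = p^2 + q^2 + 2 p q]. *)
Lemma weyl_sum T1 G1 m1 T2 G2 m2 l :
  weyl T1 G1 m1 -> pairing G1 l -> weyl T2 G2 m2 ->
  weyl (fun t x => Cexp (RtoC (t * t) * (- (l m2) / 2))%C ⊙ T1 t (T2 t x))
       (fun y => G1 y ⊕ G2 y) (fun r => (m1 r + m2 r)%C).
Proof.
  intros H1 Hp1 H2.
  pose proof (weyl_semigroup _ _ _ H1) as S1. pose proof (weyl_semigroup _ _ _ H2) as S2.
  set (c := (- (l m2) / 2)%C).
  assert (Hcont : forall x eps, 0 < eps -> exists delta, 0 < delta /\
    forall t, 0 <= t < delta -> ‖T1 t (T2 t x) ⊖ x‖ <= eps).
  { intros x eps He. destruct (sg_bounded T1 S1 1) as (K & HK & HB).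
    destruct (sg_continuous T1 S1 x (eps / 2)) as (d1 & Hd1 & C1); [lra|].
    assert (Hq : 0 < eps / 2 / (K + 1)) by (apply Rdiv_lt_0_compat; lra).
    assert (Hq' : eps / 2 / (K + 1) * (K + 1) = eps / 2) by (field; lra).
    destruct (sg_continuous T2 S2 x _ Hq) as (d2 & Hd2 & C2).
    exists (Rmin 1 (Rmin d1 d2)); split; [repeat apply Rmin_glb_lt; lra|].
    intros t Ht. pose proof (Rmin_l 1 (Rmin d1 d2)). pose proof (Rmin_r 1 (Rmin d1 d2)).
    pose proof (Rmin_l d1 d2). pose proof (Rmin_r d1 d2).
    replace eps with (eps / 2 + eps / 2) by field.
    apply (norm_minus_trans (T1 t x)); [|apply C1; lra].
    rewrite <- (linear_sub (T1 t)) by (apply (sg_linear _ S1); lra).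
    eapply Rle_trans; [apply HB; lra|]. specialize (C2 t ltac:(lra)).
    pose proof (norm_pos (T2 t x ⊖ x)). nra. }
  split; [split|..].
  - intros t Ht. apply is_linear_cscal, (is_linear_comp (T2 t) (T1 t)).
    + now apply (sg_linear _ S2).
    + now apply (sg_linear _ S1).
  - intros x. rewrite Rmult_0_l, Cmult_0_l, Cexp_0, (sg_zero _ S2), (sg_zero _ S1). vec.
  - intros s t x Hs Ht. rewrite (sg_add _ S2), (sg_add _ S1) by easy.
    rewrite (weyl_commutation T1 G1 m1 T2 G2 m2 l t s) by easy.
    rewrite (linear_cscal (T2 s)) by now apply (sg_linear _ S2).
    rewrite !(linear_cscal (T1 s)) by now apply (sg_linear _ S1).
    replace (RtoC ((s + t) * (s + t)) * c)%C with
      ((RtoC (s * s) * c + RtoC (t * t) * c) - t * (s * l m2))%C.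
    2:{ unfold c. rewrite !RtoC_mult, RtoC_plus. field. }
    assert (E1 : (Cexp (t * (s * l m2)) * Cexp (- (t * (s * l m2))))%C = RtoC 1).
    { rewrite <- Cexp_plus, <- Cexp_0. f_equal. ring. }
    unfold Cminus. rewrite !Cexp_plus.
    set (e := Cexp (t * (s * l m2))) in *.
    set (e' := Cexp (- (t * (s * l m2)))) in *.
    transitivity ((Cexp (RtoC (s * s) * c) * Cexp (RtoC (t * t) * c) * (e * e'))%C
                    ⊙ T1 s (T2 s (T1 t (T2 t x)))); [vec|].
    rewrite E1. vec.
  - intros p. destruct (sg_bounded T1 S1 p) as (K1 & HK1 & B1).
    destruct (sg_bounded T2 S2 p) as (K2 & HK2 & B2).
    exists (exp (p * p * Cmod c) * (K1 * K2)). pose proof (Cmod_ge_0 c). split.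
    + apply Rmult_le_pos; [left; apply exp_pos|now apply Rmult_le_pos].
    + intros t x Ht. rewrite Rmult_assoc. apply norm_cscal_le.
      * eapply Rle_trans; [apply Cmod_Cexp_le|].
        rewrite Cmod_mult, Cmod_R, Rabs_pos_eq by nra.
        apply exp_mono, Rmult_le_compat_r; [easy|nra].
      * eapply Rle_trans; [apply B1; lra|]. rewrite Rmult_assoc.
        apply Rmult_le_compat_l; [easy|]. apply B2; lra.
  - intros x eps He. destruct (Hcont x (eps / 4)) as (d1 & Hd1 & C1); [lra|].
    pose proof (norm_pos x). pose proof (Cmod_ge_0 c).
    destruct (Cexp_square_small c (eps / 4 / (‖x‖ + 1))) as (d2 & Hd2 & C2).
    { apply Rdiv_lt_0_compat; lra. }
    destruct (Cexp_square_small c 1 Rlt_0_1) as (d3 & Hd3 & C3).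
    exists (Rmin 1 (Rmin d1 (Rmin d2 d3))); split; [repeat apply Rmin_glb_lt; lra|].
    intros t Ht. pose proof (Rmin_l 1 (Rmin d1 (Rmin d2 d3))).
    pose proof (Rmin_r 1 (Rmin d1 (Rmin d2 d3))).
    pose proof (Rmin_l d1 (Rmin d2 d3)). pose proof (Rmin_r d1 (Rmin d2 d3)).
    pose proof (Rmin_l d2 d3). pose proof (Rmin_r d2 d3).
    specialize (C1 t ltac:(lra)). specialize (C2 t ltac:(lra)).
    specialize (C3 t ltac:(lra)).
    set (e := Cexp (RtoC (t * t) * c)) in *.
    replace (e ⊙ T1 t (T2 t x) ⊖ x) with
      ((T1 t (T2 t x) ⊖ x) ⊕ (e - 1)%C ⊙ (T1 t (T2 t x) ⊖ x) ⊕ (e - 1)%C ⊙ x) by vec.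
    apply Rle_trans with (eps / 4 + 1 * t * (eps / 4) +
                          eps / 4 / (‖x‖ + 1) * t * ‖x‖).
    + apply norm_plus_le; [apply norm_plus_le; [easy|]|];
        apply norm_cscal_le; (easy || apply Rle_refl).
    + assert (eps / 4 / (‖x‖ + 1) * (‖x‖ + 1) = eps / 4) by (field; lra).
      assert (0 < eps / 4 / (‖x‖ + 1)) by (apply Rdiv_lt_0_compat; lra).
      assert (eps / 4 / (‖x‖ + 1) * t * ‖x‖ <= eps / 4 / (‖x‖ + 1) * ‖x‖); [|nra].
      apply Rmult_le_compat_r; [easy|]. nra.
  - intros y Hy.
    pose proof (weyl_generator _ _ _ H1 y Hy) as D1.
    pose proof (weyl_generator _ _ _ H2 y Hy) as D2.
    destruct (sg_bounded T1 S1 1) as (K1 & HK1 & B1).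
    assert (Q1 : little_o (fun h => T1 h (T2 h y ⊖ y ⊖ h ⊙ G2 y))).
    { intros eps He.
      assert (Hq : 0 < eps / (K1 + 1)) by (apply Rdiv_lt_0_compat; lra).
      assert (Hq' : eps / (K1 + 1) * (K1 + 1) = eps) by (field; lra).
      destruct (D2 _ Hq) as (d & Hd & HD).
      exists (Rmin 1 d); split; [apply Rmin_glb_lt; lra|]. intros h Hh.
      pose proof (Rmin_l 1 d). pose proof (Rmin_r 1 d).
      eapply Rle_trans; [apply B1; lra|]. specialize (HD h ltac:(lra)).
      apply Rle_trans with (K1 * (eps / (K1 + 1) * h)).
      - now apply Rmult_le_compat_l.
      - rewrite <- Hq' at 2. nra. }
    assert (Q2 : little_o (fun h => h ⊙ (T1 h (G2 y) ⊖ G2 y))).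
    { apply little_o_times. intros eps He.
      destruct (sg_continuous T1 S1 (G2 y) eps He) as (d & Hd & HD).
      exists d; split; [easy|]. intros h Hh. apply HD; lra. }
    assert (Q3 : little_o (fun h => (Cexp (RtoC (h * h) * c) - 1)%C ⊙ T1 h (T2 h y))).
    { intros eps He. pose proof (norm_pos y).
      destruct (Hcont y 1 Rlt_0_1) as (d1 & Hd1 & C1).
      assert (Hq : 0 < eps / (‖y‖ + 1)) by (apply Rdiv_lt_0_compat; lra).
      assert (Hq' : eps / (‖y‖ + 1) * (1 + ‖y‖) = eps) by (field; lra).
      destruct (Cexp_square_small c _ Hq) as (d2 & Hd2 & C2).
      exists (Rmin d1 d2); split; [now apply Rmin_glb_lt|]. intros h Hh.
      pose proof (Rmin_l d1 d2). pose proof (Rmin_r d1 d2).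
      replace (eps * h) with (eps / (‖y‖ + 1) * h * (1 + ‖y‖))
        by (rewrite <- Hq' at 2; ring).
      apply norm_cscal_le; [apply C2; lra|].
      apply (norm_le_minus _ y). apply C1; lra. }
    generalize (little_o_plus _ _ (little_o_plus _ _ (little_o_plus _ _ Q1 Q2) D1) Q3).
    apply little_o_ext. intros h Hh.
    rewrite !(linear_sub (T1 h)), (linear_cscal (T1 h)) by (apply (sg_linear _ S1); lra).
    vec.
  - intros r t y Ht Hy.
    assert (HY2 : Y (T2 t y)) by (apply (weyl_invariant T2 G2 m2); easy).
    destruct (weyl_commutes _ _ _ H1 r t _ Ht HY2) as (E1 & E2).
    destruct (weyl_commutes _ _ _ H2 r t _ Ht Hy) as (E3 & E4).
    destruct (A_scal r (Cexp (RtoC (t * t) * c)) _ E1) as (E5 & E6).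
    split; [easy|]. rewrite E6, E2, E4.
    pose proof (sg_linear _ S1 t Ht) as L1. pose proof (sg_linear _ S2 t Ht) as L2.
    rewrite !(linear_add (T1 t)), !(linear_cscal (T1 t)) by easy.
    rewrite !(linear_add (T2 t)), !(linear_cscal (T2 t)) by easy.
    rewrite !(linear_add (T1 t)), !(linear_cscal (T1 t)) by easy. vec.
  - intros t eps He.
    destruct (weyl_continuous _ _ _ H1 t (eps / 2)) as (d1 & Hd1 & C1); [lra|].
    destruct (weyl_continuous _ _ _ H2 t (eps / 2)) as (d2 & Hd2 & C2); [lra|].
    exists (Rmin d1 d2); split; [now apply Rmin_glb_lt|]. intros s Hs.
    pose proof (Rmin_l d1 d2). pose proof (Rmin_r d1 d2).
    replace (m1 s + m2 s - (m1 t + m2 t))%C with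
      ((m1 s - m1 t) + (m2 s - m2 t))%C by ring.
    eapply Rle_trans; [apply Cmod_triangle|].
    specialize (C1 s ltac:(lra)). specialize (C2 s ltac:(lra)). lra.
Qed.

Lemma mu_continuous t : scalar_continuous (fun s => mu s t).
Proof.
  intros s eps He. destruct (mu_uniform eps He) as (d & Hd & H).
  exists d; split; [easy|]. intros r Hr. apply H; [lra|].
  unfold Rminus. rewrite Rplus_opp_r, Rabs_R0. lra.
Qed.

Lemma semigroup_scale T h : semigroup T -> 0 <= h -> semigroup (fun t => T (h * t)).
Proof.
  intros HT Hh. split.
  - intros t Ht. apply (sg_linear _ HT). now apply Rmult_le_pos.
  - intros x. rewrite Rmult_0_r. apply (sg_zero _ HT).
  - intros s t x Hs Ht. rewrite Rmult_plus_distr_l.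
    apply (sg_add _ HT); now apply Rmult_le_pos.
  - intros p. destruct (sg_bounded _ HT (h * p)) as (K & HK & HB). exists K.
    split; [easy|]. intros t x Ht. apply HB. split; [apply Rmult_le_pos; lra|].
    apply Rmult_le_compat_l; lra.
  - intros x eps He. destruct (sg_continuous _ HT x eps He) as (d & Hd & H).
    assert (Hq : 0 < d / (h + 1)) by (apply Rdiv_lt_0_compat; lra).
    assert (Hq' : d / (h + 1) * (h + 1) = d) by (field; lra).
    exists (d / (h + 1)); split; [easy|]. intros t Ht. apply H. nra.
Qed.

Lemma generator_scale T h x y :
  semigroup T -> 0 <= h -> generator T x y -> generator (fun t => T (h * t)) x (h ⊙ y).
Proof.
  intros HT Hh H eps He.
  destruct (Rle_lt_or_eq_dec 0 h Hh) as [Hp| <-].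
  - assert (Hq : 0 < eps / h) by now apply Rdiv_lt_0_compat.
    destruct (H _ Hq) as (d & Hd & H1).
    assert (Hd' : d / h * h = d) by (field; lra).
    exists (d / h); split; [now apply Rdiv_lt_0_compat|]. intros t Ht.
    replace (t ⊙ (h ⊙ y)) with ((h * t) ⊙ y) by vec.
    replace (eps * t) with (eps / h * (h * t)) by (field; lra).
    apply H1. nra.
  - exists 1; split; [lra|]. intros t Ht. rewrite Rmult_0_l, (sg_zero _ HT).
    replace (x ⊖ x ⊖ t ⊙ (0 ⊙ y)) with (𝟎 : X) by vec. rewrite norm_null. nra.
Qed.

Lemma weyl_base s h : 0 <= h ->
  weyl (fun t => E s (h * t)) (fun y => h ⊙ op (A s) y) (fun r => (h * mu r s)%C).
Proof.
  intros Hh. split.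
  - now apply semigroup_scale.
  - intros y Hy. apply generator_scale; [easy..|]. apply A_op, Hy.
  - intros r t y Ht Hy.
    destruct (A_commutes r s (h * t) y (Rmult_le_pos _ _ Hh Ht) (proj1 Hy r)) as (H1 & H2).
    split; [easy|]. rewrite H2, RtoC_mult. f_equal. vec.
  - intros t eps He.
    assert (Hq : 0 < eps / (h + 1)) by (apply Rdiv_lt_0_compat; lra).
    assert (Hq' : eps / (h + 1) * (h + 1) = eps) by (field; lra).
    destruct (mu_continuous s t _ Hq) as (d & Hd & H).
    exists d; split; [easy|]. intros r Hr.
    replace (h * mu r s - h * mu t s)%C with (h * (mu r s - mu t s))%C by ring.
    rewrite Cmod_mult, Cmod_R, Rabs_pos_eq by easy. specialize (H r Hr). nra.
Qed.

Lemma pairing_A s h : pairing (fun y => h ⊙ op (A s) y) (fun m => (h * m s)%C).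
Proof.
  intros T G m HT t y Ht Hy. rewrite (proj2 (weyl_commutes T G m HT s t y Ht Hy)).
  rewrite <- (linear_cscal (T t)) by (apply (sg_linear T (weyl_semigroup _ _ _ HT)); lra).
  f_equal. vec.
Qed.

Lemma pairing_plus G1 l1 G2 l2 :
  pairing G1 l1 -> pairing G2 l2 ->
  pairing (fun y => G1 y ⊕ G2 y) (fun m => (l1 m + l2 m)%C).
Proof.
  intros H1 H2 T G m HT t y Ht Hy.
  rewrite (H1 T G m HT t y Ht Hy), (H2 T G m HT t y Ht Hy).
  rewrite <- (linear_add (T t)) by (apply (sg_linear T (weyl_semigroup _ _ _ HT)); lra).
  f_equal. vec.
Qed.

Definition op_sum (t : nat -> R) (h : R) (n : nat) y : X :=
  riemann_sum (V := real_of X) (fun r => op (A r) y) t h n.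

Definition scalar_sum (t : nat -> R) (h : R) (n : nat) m : C :=
  riemann_sum (V := C_R_NormedModule) m t h n.

Lemma op_sum_S t h n y : op_sum t h (S n) y = h ⊙ op (A (t (S n))) y ⊕ op_sum t h n y.
Proof. reflexivity. Qed.

Lemma scalar_sum_0 t h m : scalar_sum t h O m = (h * m (t O))%C.
Proof. apply injective_projections; simpl; unfold scal; simpl; unfold mult; simpl; ring. Qed.

Lemma scalar_sum_S t h n m :
  scalar_sum t h (S n) m = (h * m (t (S n)) + scalar_sum t h n m)%C.
Proof.
  unfold scalar_sum. cbn [riemann_sum].
  apply injective_projections; simpl; unfold scal, plus; simpl; unfold mult; simpl; ring.
Qed.

Lemma scalar_sum_bound t h n m (B : R) : 0 <= h ->
  (forall r, Cmod (m r) <= B) -> Cmod (scalar_sum t h n m) <= INR (S n) * h * B.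
Proof.
  intros Hh HB.
  assert (Hs : forall r, Cmod (h * m r) <= h * B).
  { intros r. rewrite Cmod_mult, Cmod_R, Rabs_pos_eq by easy.
    now apply Rmult_le_compat_l. }
  induction n as [|n IH].
  - rewrite scalar_sum_0. simpl INR. rewrite Rmult_1_l. apply Hs.
  - rewrite scalar_sum_S, (S_INR (S n)). eapply Rle_trans; [apply Cmod_triangle|].
    specialize (Hs (t (S n))). lra.
Qed.

Lemma scalar_sum_minus t h n m m' :
  (scalar_sum t h n m - scalar_sum t h n m')%C =
  scalar_sum t h n (fun r => (m r - m' r)%C).
Proof.
  induction n as [|n IH].
  - rewrite !scalar_sum_0. ring.
  - rewrite !scalar_sum_S, <- IH. ring.
Qed.

Lemma pairing_op_sum t h n : pairing (op_sum t h n) (scalar_sum t h n).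
Proof.
  induction n as [|n IH].
  - intros T G m HT r y Hr Hy. rewrite scalar_sum_0. now apply (pairing_A (t O) h T G m).
  - intros T G m HT r y Hr Hy. rewrite scalar_sum_S, !op_sum_S.
    now apply (pairing_plus _ _ _ _ (pairing_A (t (S n)) h) IH T G m).
Qed.

(** By the Baker-Campbell-Hausdorff formula, half of this scalar is the exponent
    that separates the product of the exponentials from the exponential of the sum. *)
Fixpoint commutator_sum (t : nat -> R) (h : R) (n : nat) : C :=
  match n with
  | O => RtoC 0
  | S k => (h * scalar_sum t h k (mu (t (S k))) + commutator_sum t h k)%C
  end.

(** A semigroup in [r], although the product alone is not one. *)
Definition product_semigroup (t : nat -> R) (h : R) (n : nat) (r : R) x : X :=
  Cexp (RtoC (r * r) * (- commutator_sum t h n / 2))%C ⊙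
  semigroup_prod E t (fun _ => h * r) n x.

(** One more factor multiplies the scalar of the product by the one in [weyl_sum]
    for the last factor and the product of the earlier ones. *)
Lemma weyl_product t h n : 0 <= h ->
  weyl (product_semigroup t h n) (op_sum t h n) (fun r => scalar_sum t h n (mu r)).
Proof.
  intros Hh. induction n as [|n IH].
  - apply (weyl_ext (fun r => E (t O) (h * r)) _ (fun y => h ⊙ op (A (t O)) y) _
             (fun r => (h * mu r (t O))%C)); [|easy| |now apply weyl_base].
    + intros r x _. unfold product_semigroup. simpl semigroup_prod.
      cbn [commutator_sum].
      replace (RtoC (r * r) * (- 0 / 2))%C with (RtoC 0) by field.
      rewrite Cexp_0. vec.
    + intros r. now rewrite scalar_sum_0.
  - generalize (weyl_sum _ _ _ _ _ _ _ (weyl_base (t (S n)) h Hh)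
      (pairing_A (t (S n)) h) IH).
    apply weyl_ext; [|easy|intros r; now rewrite scalar_sum_S].
    intros r x Hr. unfold product_semigroup. cbn [semigroup_prod commutator_sum].
    rewrite (linear_cscal (E (t (S n)) (h * r)))
      by (apply (sg_linear _ (E_semigroup _)); now apply Rmult_le_pos).
    replace (RtoC (r * r) * (- (h * scalar_sum t h n (mu (t (S n))) +
               commutator_sum t h n) / 2))%C with
      (RtoC (r * r) * (- (h * scalar_sum t h n (mu (t (S n)))) / 2) +
       RtoC (r * r) * (- commutator_sum t h n / 2))%C by field.
    rewrite Cexp_plus. vec.
Qed.

Context (M omega Cmu : R) (M_nonneg : 0 <= M).
Context (mu_bounded : forall s t, Cmod (mu s t) <= Cmu).
Context (E_stable : forall (n : nat) (t s : nat -> R),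
  (forall i, (i <= n)%nat -> 0 <= s i) ->
  (forall i, (i < n)%nat -> t i <= t (S i)) ->
  forall x, ‖semigroup_prod E t s n x‖ <= M * exp (omega * sum_f_R0 s n) * ‖x‖).

(** The bound on [[0, p]] of the products for partitions of an interval of length at
    most 1.  The factor [M], from the stability of the family, is independent of the
    number of factors. *)
Definition growth (p : R) : R := exp (p * p * Cmu) * (M * exp (Rabs omega * p)).

Lemma growth_nonneg p : 0 <= growth p.
Proof.
  apply Rmult_le_pos; [left; apply exp_pos|].
  apply Rmult_le_pos; [easy|left; apply exp_pos].
Qed.

Lemma Cmu_nonneg : 0 <= Cmu.
Proof. eapply Rle_trans; [apply Cmod_ge_0|apply (mu_bounded 0 0)]. Qed.

Lemma commutator_sum_bound t h n : 0 <= h -> INR (S n) * h <= 1 ->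
  Cmod (commutator_sum t h n) <= INR (S n) * h * Cmu.
Proof.
  intros Hh. pose proof Cmu_nonneg. induction n as [|n IH]; intros Hn.
  - simpl commutator_sum. rewrite Cmod_0. simpl. nra.
  - cbn [commutator_sum]. rewrite (S_INR (S n)) in *. specialize (IH ltac:(lra)).
    eapply Rle_trans; [apply Cmod_triangle|].
    rewrite Cmod_mult, Cmod_R, Rabs_pos_eq by easy.
    pose proof (scalar_sum_bound t h n (mu (t (S n))) Cmu Hh (mu_bounded _)) as H1.
    assert (Cmod (scalar_sum t h n (mu (t (S n)))) <= Cmu).
    { eapply Rle_trans; [exact H1|]. rewrite <- (Rmult_1_l Cmu) at 2.
      apply Rmult_le_compat_r; lra. }
    assert (h * Cmod (scalar_sum t h n (mu (t (S n)))) <= h * Cmu)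
      by now apply Rmult_le_compat_l.
    lra.
Qed.

Lemma sum_f_R0_const a n : sum_f_R0 (fun _ => a) n = INR (S n) * a.
Proof.
  induction n as [|n IH]; [simpl; ring|].
  rewrite tech5, IH, (S_INR (S n)). ring.
Qed.

Lemma product_semigroup_bound t h n p :
  0 <= h -> INR (S n) * h <= 1 -> (forall i, (i < n)%nat -> t i <= t (S i)) ->
  bounded_upto (product_semigroup t h n) p (growth p).
Proof.
  intros Hh Hn Ht. split; [apply growth_nonneg|]. intros r x Hr.
  pose proof Cmu_nonneg. unfold growth. rewrite Rmult_assoc. apply norm_cscal_le.
  - eapply Rle_trans; [apply Cmod_Cexp_le|]. apply exp_mono.
    rewrite Cmod_mult, Cmod_R, Rabs_pos_eq by nra.
    apply Rmult_le_compat; [nra|apply Cmod_ge_0|nra|].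
    replace (- commutator_sum t h n / 2)%C with
      (RtoC (- / 2) * commutator_sum t h n)%C by (rewrite RtoC_opp, RtoC_inv; [field|lra]).
    rewrite Cmod_mult, Cmod_R, Rabs_Ropp, Rabs_pos_eq by lra.
    pose proof (commutator_sum_bound t h n Hh Hn).
    assert (INR (S n) * h * Cmu <= 1 * Cmu) by now apply Rmult_le_compat_r.
    pose proof (Cmod_ge_0 (commutator_sum t h n)). lra.
  - eapply Rle_trans; [apply E_stable; [|easy]|].
    { intros _ _. apply Rmult_le_pos; lra. }
    apply Rmult_le_compat_r; [apply norm_pos|]. apply Rmult_le_compat_l; [easy|].
    apply exp_mono. rewrite sum_f_R0_const.
    pose proof (Rle_abs omega). pose proof (Rabs_pos omega). pose proof (pos_INR (S n)).
    assert (Hb : 0 <= INR (S n) * (h * r) <= p).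
    { rewrite <- Rmult_assoc. assert (0 <= INR (S n) * h) by now apply Rmult_le_pos.
      nra. }
    apply Rle_trans with (Rabs omega * (INR (S n) * (h * r))).
    + apply Rmult_le_compat_r; lra.
    + apply Rmult_le_compat_l; lra.
Qed.

(** * Limits of semigroups with scalar commutators *)

Definition tends (u : nat -> X) x : Prop :=
  forall eps, 0 < eps -> exists N, forall n, (N <= n)%nat -> ‖u n ⊖ x‖ <= eps.

Definition tends_C (u : nat -> C) (c : C) : Prop :=
  forall eps, 0 < eps -> exists N, forall n, (N <= n)%nat -> Cmod (u n - c) <= eps.

Lemma tends_unique u x y : tends u x -> tends u y -> x = y.
Proof.
  intros H1 H2. apply eq_of_norm_eps. intros eps He.
  destruct (H1 (eps / 2)) as (N1 & H1'); [lra|].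
  destruct (H2 (eps / 2)) as (N2 & H2'); [lra|].
  replace eps with (eps / 2 + eps / 2) by field.
  apply (norm_minus_trans (u (N1 + N2)%nat)).
  - rewrite norm_minus_sym. apply H1'. lia.
  - apply H2'. lia.
Qed.

Lemma tends_const x : tends (fun _ => x) x.
Proof.
  intros eps He. exists O. intros n _. replace (x ⊖ x) with (𝟎 : X) by vec.
  rewrite norm_null. lra.
Qed.

Lemma tends_ext u v x : (forall n, u n = v n) -> tends u x -> tends v x.
Proof.
  intros E' H eps He. destruct (H eps He) as (N & HN). exists N. intros n Hn.
  rewrite <- E'. now apply HN.
Qed.

Lemma tends_plus u v x y : tends u x -> tends v y -> tends (fun n => u n ⊕ v n) (x ⊕ y).
Proof.
  intros H1 H2 eps He.
  destruct (H1 (eps / 2)) as (N1 & H1'); [lra|].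
  destruct (H2 (eps / 2)) as (N2 & H2'); [lra|].
  exists (N1 + N2)%nat. intros n Hn.
  replace (u n ⊕ v n ⊖ (x ⊕ y)) with ((u n ⊖ x) ⊕ (v n ⊖ y)) by vec.
  replace eps with (eps / 2 + eps / 2) by field.
  apply norm_plus_le; [apply H1'|apply H2']; lia.
Qed.

Lemma tends_scal (c : C) u x : tends u x -> tends (fun n => c ⊙ u n) (c ⊙ x).
Proof.
  intros H eps He. pose proof (Cmod_ge_0 c).
  assert (Hq : 0 < eps / (Cmod c + 1)) by (apply Rdiv_lt_0_compat; lra).
  assert (Hq' : eps / (Cmod c + 1) * (Cmod c + 1) = eps) by (field; lra).
  destruct (H _ Hq) as (N & HN). exists N. intros n Hn.
  replace (c ⊙ u n ⊖ c ⊙ x) with (c ⊙ (u n ⊖ x)) by vec.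
  eapply Rle_trans; [apply norm_cscal_le; [apply Rle_refl|now apply HN]|]. nra.
Qed.

Lemma tends_C_scal (c : nat -> C) d x : tends_C c d -> tends (fun n => c n ⊙ x) (d ⊙ x).
Proof.
  intros H eps He. pose proof (norm_pos x).
  assert (Hq : 0 < eps / (‖x‖ + 1)) by (apply Rdiv_lt_0_compat; lra).
  assert (Hq' : eps / (‖x‖ + 1) * (‖x‖ + 1) = eps) by (field; lra).
  destruct (H _ Hq) as (N & HN). exists N. intros n Hn.
  replace (c n ⊙ x ⊖ d ⊙ x) with ((c n - d)%C ⊙ x) by vec.
  eapply Rle_trans; [apply norm_cscal_le; [now apply HN|apply Rle_refl]|]. nra.
Qed.

Lemma tends_linear (L : X -> X) u x : is_linear L -> tends u x -> tends (fun n => L (u n)) (L x).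
Proof.
  intros HL H eps He. destruct (linear_norm L HL) as (K & HK & HB).
  destruct (H (eps / K)) as (N & HN); [now apply Rdiv_lt_0_compat|].
  exists N. intros n Hn. rewrite <- (linear_sub L) by easy.
  eapply Rle_trans; [apply HB|]. replace eps with (K * (eps / K)) by (field; lra).
  apply Rmult_le_compat_l; [lra|]. now apply HN.
Qed.

Lemma tends_norm_le u x y (B : R) N :
  tends u x -> (forall n, (N <= n)%nat -> ‖u n ⊖ y‖ <= B) -> ‖x ⊖ y‖ <= B.
Proof.
  intros H HB. apply Rle_of_eps. intros eps He. destruct (H eps He) as (N1 & H1).
  rewrite Rplus_comm. apply (norm_minus_trans (u (N + N1)%nat)).
  - rewrite norm_minus_sym. apply H1. lia.
  - apply HB. lia.
Qed.

Lemma cauchy_tends u :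
  (forall eps, 0 < eps -> exists N, forall n k, (N <= n)%nat -> (N <= k)%nat ->
     ‖u n ⊖ u k‖ <= eps) ->
  exists x, tends u x.
Proof.
  intros H.
  destruct (proj1 (filterlim_locally_cauchy (U := X) (F := eventually) u)) as (x & Hx).
  - intros eps. destruct (H (eps / 2)) as (N & HN); [apply is_pos_div_2|].
    exists (fun n => (N <= n)%nat). split; [now exists N|].
    intros n k Hn Hk. apply (norm_compat1 (V := CompleteNormedModule.NormedModule C_AbsRing X)).
    apply Rle_lt_trans with (eps / 2); [now apply HN|].
    pose proof (cond_pos eps). lra.
  - exists x. intros eps He.
    assert (Hl : locally x (fun z => ‖z ⊖ x‖ <= eps)).
    { apply (locally_le_locally_norm
        (V := CompleteNormedModule.NormedModule C_AbsRing X)).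
      exists (mkposreal eps He). intros z Hz. left. exact Hz. }
    destruct (Hx _ Hl) as (N & HN). now exists N.
Qed.

Section LimitOfSemigroups.

Context (Tn : nat -> R -> X -> X) (Gn : nat -> X -> X) (mn : nat -> R -> C).
Context (K : R -> R) (T : R -> X -> X) (G : X -> X) (m : R -> C).
Context (Tn_weyl : forall n, weyl (Tn n) (Gn n) (mn n)).
Context (Tn_bounded : forall n p, bounded_upto (Tn n) p (K p)).
Context (Tn_tends : forall t x, 0 <= t -> tends (fun n => Tn n t x) (T t x)).
Context (Gn_tends : forall y, Y y -> tends (fun n => Gn n y) (G y)).
Context (mn_tends : forall r, tends_C (fun n => mn n r) (m r)).
Context (m_continuous : scalar_continuous m).

Let Tn_sg n : semigroup (Tn n) := weyl_semigroup _ _ _ (Tn_weyl n).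

Lemma limit_tends_op t u x : 0 <= t -> tends u x ->
  tends (fun n => Tn n t (u n)) (T t x).
Proof.
  intros Ht Hu eps He. destruct (Tn_bounded O t) as (HK & _).
  assert (Hq : 0 < eps / 2 / (K t + 1)) by (apply Rdiv_lt_0_compat; lra).
  assert (Hq' : eps / 2 / (K t + 1) * (K t + 1) = eps / 2) by (field; lra).
  destruct (Hu _ Hq) as (N1 & H1).
  destruct (Tn_tends t x Ht (eps / 2)) as (N2 & H2); [lra|].
  exists (N1 + N2)%nat. intros n Hn. replace eps with (eps / 2 + eps / 2) by field.
  apply (norm_minus_trans (Tn n t x)); [|apply H2; lia].
  rewrite <- (linear_sub (Tn n t)) by now apply (sg_linear _ (Tn_sg n)).
  eapply Rle_trans; [apply (Tn_bounded n t); lra|].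
  specialize (H1 n ltac:(lia)). pose proof (norm_pos (u n ⊖ x)). nra.
Qed.

Lemma limit_bounded p : bounded_upto T p (K p).
Proof.
  destruct (Tn_bounded O p) as (HK & _). split; [easy|]. intros t x Ht.
  replace (T t x) with (T t x ⊖ 𝟎) by vec.
  apply (tends_norm_le (fun n => Tn n t x) _ _ _ O); [now apply Tn_tends|].
  intros n _. replace (Tn n t x ⊖ 𝟎) with (Tn n t x) by vec. now apply (Tn_bounded n p).
Qed.

(** For [y] in the continuity space, the bound on the velocity [Gn n y] is uniform
    in [n]; density and the uniform bound of the semigroups give the rest. *)
Lemma limit_equicontinuous x eps : 0 < eps ->
  exists N delta, 0 < delta /\ forall n t, (N <= n)%nat -> 0 <= t < delta ->
    ‖Tn n t x ⊖ x‖ <= eps.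
Proof.
  intros He. destruct (Tn_bounded O 1) as (HK & _).
  set (q := eps / 2 / (K 1 + 1)).
  assert (Hq : 0 < q) by (apply Rdiv_lt_0_compat; lra).
  assert (Hq' : q * (K 1 + 1) = eps / 2) by (unfold q; field; lra).
  destruct (Y_dense x q Hq) as (y & Hy & Hyx).
  destruct (Gn_tends y Hy 1 Rlt_0_1) as (N & HN).
  set (B := K 1 * (1 + ‖G y‖)).
  pose proof (norm_pos (G y)).
  assert (HB : 0 <= B) by (unfold B; nra).
  assert (Hd : 0 < eps / 2 / (B + 1)) by (apply Rdiv_lt_0_compat; lra).
  assert (Hd' : eps / 2 / (B + 1) * (B + 1) = eps / 2) by (field; lra).
  set (d := eps / 2 / (B + 1)) in *.
  exists N, (Rmin 1 d). split; [apply Rmin_glb_lt; lra|]. intros n t Hn Ht.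
  pose proof (Rmin_l 1 d). pose proof (Rmin_r 1 d).
  replace (Tn n t x ⊖ x) with
    ((Tn n t y ⊖ y ⊖ t ⊙ 𝟎) ⊕ ((y ⊖ x) ⊖ Tn n t (y ⊖ x))).
  2:{ rewrite (linear_sub (Tn n t)) by (apply (sg_linear _ (Tn_sg n)); lra). vec. }
  apply Rle_trans with (t * B + (q + K 1 * q)); [|nra].
  apply norm_plus_le.
  - apply (orbit_increment_bound (Tn n) y (Gn n y)); [apply Tn_sg| |lra|].
    { now apply (weyl_generator _ _ _ (Tn_weyl n)). }
    intros s Hs. replace (Tn n s (Gn n y) ⊖ 𝟎) with (Tn n s (Gn n y)) by vec.
    eapply Rle_trans; [apply (Tn_bounded n 1); lra|]. unfold B.
    apply Rmult_le_compat_l; [easy|]. apply norm_le_minus. now apply HN.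
  - apply norm_minus_le; [easy|].
    eapply Rle_trans; [apply (Tn_bounded n 1); lra|]. now apply Rmult_le_compat_l.
Qed.

(** The derivative at 0 passes to the limit by the bound on the increments of the
    orbits, which is uniform in [n], and the commutation relation because [A r] is
    closed. *)
Lemma weyl_limit : weyl T G m.
Proof.
  split; [split|..].
  - intros t Ht. split.
    + intros x y. apply (tends_unique (fun n => Tn n t (x ⊕ y))); [now apply Tn_tends|].
      apply (tends_ext (fun n => Tn n t x ⊕ Tn n t y)).
      * intros n. symmetry. apply (linear_add (Tn n t)). now apply (sg_linear _ (Tn_sg n)).
      * apply tends_plus; now apply Tn_tends.
    + intros c x. apply (tends_unique (fun n => Tn n t (c ⊙ x))); [now apply Tn_tends|].
      apply (tends_ext (fun n => c ⊙ Tn n t x)).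
      * intros n. symmetry. apply (linear_cscal (Tn n t)).
        now apply (sg_linear _ (Tn_sg n)).
      * apply tends_scal; now apply Tn_tends.
    + destruct (limit_bounded t) as (HK & HB). exists (K t + 1). split; [lra|].
      intros x. eapply Rle_trans; [apply HB; lra|].
      apply Rmult_le_compat_r; [apply norm_pos|lra].
  - intros x. apply (tends_unique (fun n => Tn n 0 x)); [apply Tn_tends; lra|].
    apply (tends_ext (fun _ => x)); [|apply tends_const].
    intros n. symmetry. apply (sg_zero _ (Tn_sg n)).
  - intros s t x Hs Ht.
    apply (tends_unique (fun n => Tn n (s + t) x)); [apply Tn_tends; lra|].
    apply (tends_ext (fun n => Tn n s (Tn n t x))).
    + intros n. symmetry. now apply (sg_add _ (Tn_sg n)).
    + apply limit_tends_op; [easy|]. now apply Tn_tends.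
  - intros p. exists (K p). apply limit_bounded.
  - intros x eps He. destruct (limit_equicontinuous x eps He) as (N & d & Hd & H).
    exists d; split; [easy|]. intros t Ht.
    apply (tends_norm_le (fun n => Tn n t x) _ _ _ N); [apply Tn_tends; lra|].
    intros n Hn. now apply H.
  - intros y Hy eps He. destruct (Tn_bounded O 1) as (HK & _).
    destruct (limit_equicontinuous (G y) (eps / 2)) as (N & d & Hd & H); [lra|].
    set (q := eps / 2 / (K 1 + 1)).
    assert (Hq : 0 < q) by (apply Rdiv_lt_0_compat; lra).
    assert (Hq' : q * (K 1 + 1) = eps / 2) by (unfold q; field; lra).
    destruct (Gn_tends y Hy q Hq) as (N' & H').
    exists (Rmin 1 d). split; [apply Rmin_glb_lt; lra|]. intros h Hh.
    pose proof (Rmin_l 1 d). pose proof (Rmin_r 1 d).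
    replace (T h y ⊖ y ⊖ h ⊙ G y) with (T h y ⊖ (y ⊕ h ⊙ G y)) by vec.
    apply (tends_norm_le (fun n => Tn n h y) _ _ _ (N + N')%nat); [apply Tn_tends; lra|].
    intros n Hn. replace (Tn n h y ⊖ (y ⊕ h ⊙ G y)) with (Tn n h y ⊖ y ⊖ h ⊙ G y) by vec.
    rewrite Rmult_comm.
    apply (orbit_increment_bound (Tn n) y (Gn n y)); [apply Tn_sg| |lra|].
    { now apply (weyl_generator _ _ _ (Tn_weyl n)). }
    intros t Ht. replace eps with (eps / 2 + eps / 2) by field.
    apply (norm_minus_trans (Tn n t (G y))); [|apply H; [lia|lra]].
    rewrite <- (linear_sub (Tn n t)) by (apply (sg_linear _ (Tn_sg n)); lra).
    eapply Rle_trans; [apply (Tn_bounded n 1); lra|].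
    specialize (H' n ltac:(lia)). pose proof (norm_pos (Gn n y ⊖ G y)). nra.
  - intros r t y Ht Hy. apply A_closed.
    assert (C1 : tends (fun n => Tn n t y) (T t y)) by now apply Tn_tends.
    assert (C2 : tends (fun n => Tn n t (op (A r) y ⊕ (mn n r * t)%C ⊙ y))
                       (T t (op (A r) y ⊕ (m r * t)%C ⊙ y))).
    { apply limit_tends_op; [easy|]. apply tends_plus; [apply tends_const|].
      replace ((m r * t)%C ⊙ y) with (m r ⊙ (t ⊙ y)) by vec.
      apply (tends_ext (fun n => mn n r ⊙ (t ⊙ y))); [intros n; vec|].
      now apply tends_C_scal. }
    intros eps He. destruct (C1 eps He) as (N1 & H1). destruct (C2 eps He) as (N2 & H2).
    set (n := (N1 + N2)%nat). exists (Tn n t y).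
    destruct (weyl_commutes _ _ _ (Tn_weyl n) r t y Ht Hy) as (H3 & H4).
    split; [easy|]. split; [apply H1; lia|]. rewrite H4. apply H2. lia.
  - easy.
Qed.

End LimitOfSemigroups.

(** Duhamel's formula: along the orbit [u] of [y] under [T'], the difference of
    [u'] and [G u] is [T' t (G' y - G y - t (l m') y)]. *)
Lemma weyl_comparison T G m l T' G' m' (p K K' : R) y :
  weyl T G m -> pairing G l -> weyl T' G' m' -> 0 <= p ->
  bounded_upto T p K -> bounded_upto T' p K' -> Y y ->
  ‖T' p y ⊖ T p y‖ <= K * (K' * (‖G' y ⊖ G y‖ + p * ‖l m' ⊙ y‖)) * p.
Proof.
  intros H1 Hp H2 Hpp HK HK' Hy.
  pose proof (weyl_semigroup _ _ _ H1) as S1. pose proof (weyl_semigroup _ _ _ H2) as S2.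
  replace (T p y) with (T p (T' 0 y)) by now rewrite (sg_zero _ S2).
  apply (duhamel_semigroup T (fun t => T' t y)); [easy..| |].
  { now apply semigroup_continuous_Icc. }
  intros t Ht. exists (T' t (G' y)), (G (T' t y)). split; [|split].
  - apply generator_right_derivative; [easy| |lra]. now apply (weyl_generator _ _ _ H2).
  - apply (weyl_generator _ _ _ H1). apply (weyl_invariant _ _ _ _ _ H2); [lra|easy].
  - rewrite (Hp _ _ _ H2 t y) by (easy || lra).
    rewrite <- (linear_sub (T' t)) by (apply (sg_linear _ S2); lra).
    destruct HK' as (HK0 & HB). eapply Rle_trans; [apply HB; lra|].
    apply Rmult_le_compat_l; [easy|].
    replace (G' y ⊖ (G y ⊕ (l m' * t)%C ⊙ y)) with
      ((G' y ⊖ G y) ⊖ t ⊙ (l m' ⊙ y)) by vec.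
    apply norm_minus_le; [apply Rle_refl|].
    eapply Rle_trans; [apply norm_real_scal|]. rewrite Rabs_pos_eq by lra.
    apply Rmult_le_compat_r; [apply norm_pos|lra].
Qed.

(** * The semigroups generated by the integrals *)

Definition op_integral (a b : R) y : X :=
  RInt (V := real_of X) (fun r => op (A r) y) a b.

Definition scalar_integral (a b : R) m : C :=
  RInt (V := C_R_CompleteNormedModule) m a b.

Lemma op_continuous y t :
  Y y -> continuous (U := real_of X) (fun r => op (A r) y) t.
Proof.
  intros Hy. apply (continuous_of_norm (V := real_of X)).
  intros eps He. exact (proj2 Hy t eps He).
Qed.

Lemma scalar_continuous_continuous m t :
  scalar_continuous m -> continuous (U := C_R_NormedModule) m t.
Proof.
  intros Hm. apply (continuous_of_norm (V := C_R_NormedModule)).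
  intros eps He. destruct (Hm t eps He) as (d & Hd & H).
  exists d; split; [easy|]. intros s Hs. rewrite <- Cmod_norm. now apply H.
Qed.

Lemma mu_row_continuous r : scalar_continuous (mu r).
Proof.
  intros t eps He. destruct (mu_uniform eps He) as (d & Hd & H).
  exists d; split; [easy|]. intros s Hs. apply H; [|lra].
  unfold Rminus. rewrite Rplus_opp_r, Rabs_R0. lra.
Qed.

Lemma ex_op_integral y a b : Y y -> ex_RInt (V := real_of X) (fun r => op (A r) y) a b.
Proof.
  intros Hy. apply (ex_RInt_continuous (V := real_of X)). intros z _. now apply op_continuous.
Qed.

Lemma ex_scalar_integral m a b :
  scalar_continuous m -> ex_RInt (V := C_R_CompleteNormedModule) m a b.
Proof.
  intros Hm. apply (ex_RInt_continuous (V := C_R_CompleteNormedModule)). intros z _.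
  now apply scalar_continuous_continuous.
Qed.

Lemma op_integral_Chasles a b c y :
  Y y -> op_integral a b y ⊕ op_integral b c y = op_integral a c y.
Proof.
  intros Hy. apply (RInt_Chasles (V := real_of X)); now apply ex_op_integral.
Qed.

Lemma scalar_integral_Chasles a b c m :
  scalar_continuous m ->
  (scalar_integral a b m + scalar_integral b c m)%C = scalar_integral a c m.
Proof.
  intros Hm. apply (RInt_Chasles (V := C_R_CompleteNormedModule));
    now apply ex_scalar_integral.
Qed.

Lemma scalar_integral_minus a b m m' :
  scalar_continuous m -> scalar_continuous m' ->
  (scalar_integral a b m - scalar_integral a b m')%C =
  scalar_integral a b (fun r => (m r - m' r)%C).
Proof.
  intros H1 H2. symmetry.
  apply (RInt_minus (V := C_R_CompleteNormedModule) m m'); now apply ex_scalar_integral.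
Qed.

Lemma scalar_integral_bound a b m (B : R) :
  (exists v, is_RInt (V := C_R_NormedModule) m a b v) ->
  (forall r, Rmin a b <= r <= Rmax a b -> Cmod (m r) <= B) ->
  Cmod (scalar_integral a b m) <= Rabs (b - a) * B.
Proof.
  intros Hm HB. rewrite Cmod_norm.
  apply (norm_RInt_le_const_abs (V := C_R_NormedModule) m a b).
  - intros r Hr. rewrite <- Cmod_norm. now apply HB.
  - apply (RInt_correct (V := C_R_CompleteNormedModule) m). exact Hm.
Qed.

Lemma op_integral_bound a b y (B : R) : Y y ->
  (forall r, Rmin a b <= r <= Rmax a b -> ‖op (A r) y‖ <= B) ->
  ‖op_integral a b y‖ <= Rabs (b - a) * B.
Proof.
  intros Hy HB.
  apply (norm_RInt_le_const_abs (V := real_of X) (fun r => op (A r) y) a b).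
  - exact HB.
  - apply (RInt_correct (V := real_of X)). now apply ex_op_integral.
Qed.

Lemma mu_integral_bound a b r :
  Cmod (scalar_integral a b (mu r)) <= Rabs (b - a) * Cmu.
Proof.
  apply scalar_integral_bound; [|intros; apply mu_bounded].
  apply ex_scalar_integral, mu_row_continuous.
Qed.

Lemma mu_integral_continuous a b :
  scalar_continuous (fun r => scalar_integral a b (mu r)).
Proof.
  intros r eps He.
  assert (Hab : 0 < Rabs (b - a) + 1) by (pose proof (Rabs_pos (b - a)); lra).
  assert (Hq : 0 < eps / (Rabs (b - a) + 1)) by now apply Rdiv_lt_0_compat.
  assert (Hq' : eps / (Rabs (b - a) + 1) * (Rabs (b - a) + 1) = eps) by (field; lra).
  destruct (mu_uniform _ Hq) as (d & Hd & H).
  exists d; split; [easy|]. intros s Hs.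
  rewrite scalar_integral_minus by apply mu_row_continuous.
  apply Rle_trans with (Rabs (b - a) * (eps / (Rabs (b - a) + 1))); [|lra].
  apply scalar_integral_bound.
  - eexists. apply (is_RInt_minus (V := C_R_NormedModule) (mu s) (mu r));
      apply (RInt_correct (V := C_R_CompleteNormedModule));
      apply ex_scalar_integral, mu_row_continuous.
  - intros t _. apply H; [lra|]. unfold Rminus. rewrite Rplus_opp_r, Rabs_R0. lra.
Qed.

Definition step (a b : R) (n : nat) : R := (b - a) / INR (S n).
Definition node (a b : R) (n : nat) (i : nat) : R := a + INR i * step a b n.

Lemma step_nonneg a b n : a <= b -> 0 <= step a b n.
Proof. intros H. apply Rdiv_le_0_compat; [lra|]. apply lt_0_INR; lia. Qed.

Lemma INR_step a b n : INR (S n) * step a b n = b - a.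
Proof. unfold step. field. apply not_0_INR. lia. Qed.

Lemma step_eventually_small a b (delta : R) : a <= b -> 0 < delta ->
  exists N, forall n, (N <= n)%nat -> step a b n <= delta.
Proof.
  intros Hab Hd. destruct (nfloor_ex ((b - a) / delta)) as (N & _ & HN).
  { apply Rdiv_le_0_compat; lra. }
  exists N. intros n Hn. apply le_INR in Hn.
  pose proof (INR_step a b n) as E1. rewrite S_INR in E1.
  pose proof (step_nonneg a b n Hab).
  assert (E2 : (b - a) / delta * delta = b - a) by (field; lra).
  pose proof (pos_INR n).
  destruct (Rle_lt_dec (step a b n) delta) as [|Hl]; [easy|exfalso]. nra.
Qed.

Lemma op_sum_tends a b y : a <= b -> Y y ->
  tends (fun n => op_sum (node a b n) (step a b n) n y) (op_integral a b y).
Proof.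
  intros Hab Hy eps He.
  assert (Hq : 0 < eps / (b - a + 1)) by (apply Rdiv_lt_0_compat; lra).
  assert (Hq' : eps / (b - a + 1) * (b - a + 1) = eps) by (field; lra).
  destruct (uniform_continuity_Icc (V := real_of X) (fun r => op (A r) y) a b _
    (fun t _ => op_continuous y t Hy) Hq) as (d & Hd & H).
  destruct (step_eventually_small a b d Hab Hd) as (N & HN).
  exists N. intros n Hn. rewrite norm_minus_sym.
  apply Rle_trans with ((b - a) * (eps / (b - a + 1))); [|lra].
  apply (riemann_sum_error (V := real_of X) (fun r => op (A r) y) a b); [easy| |].
  - intros x _. now apply op_continuous.
  - intros r s Hr Hs Hrs. apply H; [easy..|]. eapply Rle_trans; [exact Hrs|].
    now apply HN.
Qed.

Lemma scalar_sum_error a b m (eps : R) n : a <= b -> scalar_continuous m ->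
  (forall r s, Rabs (r - s) <= step a b n -> Cmod (m r - m s) <= eps) ->
  Cmod (scalar_integral a b m - scalar_sum (node a b n) (step a b n) n m)
    <= (b - a) * eps.
Proof.
  intros Hab Hm H. rewrite Cmod_norm.
  apply (riemann_sum_error (V := C_R_CompleteNormedModule) m a b); [easy| |].
  - intros x _. now apply scalar_continuous_continuous.
  - intros r s _ _ Hrs. rewrite <- Cmod_norm. now apply H.
Qed.

Lemma scalar_sum_tends a b m : a <= b -> scalar_continuous m ->
  tends_C (fun n => scalar_sum (node a b n) (step a b n) n m) (scalar_integral a b m).
Proof.
  intros Hab Hm eps He.
  assert (Hq : 0 < eps / (b - a + 1)) by (apply Rdiv_lt_0_compat; lra).
  assert (Hq' : eps / (b - a + 1) * (b - a + 1) = eps) by (field; lra).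
  destruct (uniform_continuity_Icc (V := C_R_NormedModule) m a b _
    (fun t _ => scalar_continuous_continuous m t Hm) Hq) as (d & Hd & H).
  destruct (step_eventually_small a b d Hab Hd) as (N & HN).
  exists N. intros n Hn. rewrite <- Cmod_opp, Copp_minus_distr, Cmod_norm.
  apply Rle_trans with ((b - a) * (eps / (b - a + 1))); [|lra].
  apply (riemann_sum_error (V := C_R_CompleteNormedModule) m a b); [easy| |].
  - intros x _. now apply scalar_continuous_continuous.
  - intros r s Hr Hs Hrs. apply H; [easy..|]. eapply Rle_trans; [exact Hrs|].
    now apply HN.
Qed.

(** By passage to the limit in the Riemann sums, which spares an exchange of the
    integral with the bounded operator [T t]. *)
Lemma pairing_integral a b : a <= b -> pairing (op_integral a b) (scalar_integral a b).
Proof.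
  intros Hab T G m HT t y Ht Hy.
  pose proof (weyl_semigroup _ _ _ HT) as S.
  pose proof (sg_linear _ S t Ht) as L.
  apply (tends_unique (fun n => op_sum (node a b n) (step a b n) n (T t y))).
  - apply op_sum_tends; [easy|]. now apply (weyl_invariant _ _ _ _ _ HT).
  - apply (tends_ext (fun n => T t (op_sum (node a b n) (step a b n) n y ⊕
      scalar_sum (node a b n) (step a b n) n m ⊙ (t ⊙ y)))).
    + intros n. rewrite (pairing_op_sum _ _ _ T G m HT t y Ht Hy). f_equal. vec.
    + replace ((scalar_integral a b m * t)%C ⊙ y) with
        (scalar_integral a b m ⊙ (t ⊙ y)) by vec.
      apply tends_linear; [easy|]. apply tends_plus; [now apply op_sum_tends|].
      apply tends_C_scal, scalar_sum_tends; [easy|]. now apply (weyl_continuous _ _ _ HT).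
Qed.

Definition segment_product (a b : R) (n : nat) : R -> X -> X :=
  product_semigroup (node a b n) (step a b n) n.

Definition segment_scalar (a b : R) (n : nat) m : C :=
  scalar_sum (node a b n) (step a b n) n m.

Lemma segment_product_bound a b n p : a <= b <= a + 1 ->
  bounded_upto (segment_product a b n) p (growth p).
Proof.
  intros Hab. pose proof (step_nonneg a b n ltac:(lra)).
  apply product_semigroup_bound; [easy|rewrite INR_step; lra|].
  intros i _. unfold node. rewrite S_INR. lra.
Qed.

Lemma segment_product_weyl a b n : a <= b ->
  weyl (segment_product a b n) (op_sum (node a b n) (step a b n) n)
    (fun r => segment_scalar a b n (mu r)).
Proof. intros Hab. now apply weyl_product, step_nonneg. Qed.

(** The commutator of two Riemann sums of [A] is small: it differs little from
    the commutator of the second one with itself. *)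
Lemma segment_commutator_small a b eps y : a <= b <= a + 1 -> Y y -> 0 < eps ->
  exists N, forall n k, (N <= n)%nat -> (N <= k)%nat ->
    ‖segment_scalar a b n (fun r => segment_scalar a b k (mu r)) ⊙ y‖ <= eps.
Proof.
  intros Hab Hy He. pose proof (norm_pos y).
  assert (Hq : 0 < eps / 2 / (‖y‖ + 1)) by (apply Rdiv_lt_0_compat; lra).
  assert (Hq' : eps / 2 / (‖y‖ + 1) * (‖y‖ + 1) = eps / 2) by (field; lra).
  set (q := eps / 2 / (‖y‖ + 1)) in *.
  destruct (mu_uniform q Hq) as (d & Hd & Hmu).
  destruct (step_eventually_small a b d ltac:(lra) Hd) as (N & HN).
  exists N. intros n k Hn Hk.
  set (m := fun r => segment_scalar a b k (mu r)).
  assert (Hm : scalar_continuous m).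
  { apply (weyl_continuous _ _ _ (segment_product_weyl a b k ltac:(lra))). }
  assert (Hmod : forall r s, Rabs (r - s) <= d -> Cmod (m r - m s) <= q).
  { intros r s Hrs. unfold m, segment_scalar. rewrite scalar_sum_minus.
    eapply Rle_trans; [apply (scalar_sum_bound _ _ _ _ q); [apply step_nonneg; lra|]|].
    - intros t. apply Hmu; [easy|]. unfold Rminus. rewrite Rplus_opp_r, Rabs_R0. lra.
    - rewrite INR_step. nra. }
  assert (Herr : forall i, (N <= i)%nat ->
    Cmod (scalar_integral a b m - segment_scalar a b i m) <= q).
  { intros i Hi. apply Rle_trans with ((b - a) * q); [|nra].
    apply scalar_sum_error; [lra|easy|]. intros r s Hrs. apply Hmod.
    specialize (HN i Hi). lra. }
  assert (E0 : segment_scalar a b k m ⊙ y = 𝟎).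
  { apply (weyl_pairing_self _ _ _ _ _ (segment_product_weyl a b k ltac:(lra))
      (pairing_op_sum _ _ _) Hy). }
  replace (segment_scalar a b n m ⊙ y) with
    (((scalar_integral a b m - segment_scalar a b k m) -
      (scalar_integral a b m - segment_scalar a b n m))%C ⊙ y
     ⊕ segment_scalar a b k m ⊙ y) by vec.
  rewrite E0. replace (_ ⊕ 𝟎) with
    (((scalar_integral a b m - segment_scalar a b k m) -
      (scalar_integral a b m - segment_scalar a b n m))%C ⊙ y) by vec.
  apply Rle_trans with ((q + q) * ‖y‖); [|nra].
  apply norm_cscal_le; [|apply Rle_refl].
  unfold Cminus at 1. eapply Rle_trans; [apply Cmod_triangle|]. rewrite Cmod_opp.
  apply Rplus_le_compat; now apply Herr.
Qed.

(** Two of the semigroups are compared by [weyl_comparison]: their generators are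
    Riemann sums with the same limit, and their commutator tends to 0. *)
Lemma segment_product_cauchy a b p x : a <= b <= a + 1 -> 0 <= p ->
  exists z, tends (fun n => segment_product a b n p x) z.
Proof.
  intros Hab Hp. apply cauchy_tends. intros eps He.
  pose proof (growth_nonneg p) as HK. set (K := growth p) in *.
  set (q := eps / 3 / (K + 1)).
  assert (Hq : 0 < q) by (apply Rdiv_lt_0_compat; lra).
  assert (Hq' : q * (K + 1) = eps / 3) by (unfold q; field; lra).
  destruct (Y_dense x q Hq) as (y & Hy & Hyx).
  assert (HKp : 0 <= K * K * p) by (apply Rmult_le_pos; [now apply Rmult_le_pos|easy]).
  set (e := eps / 3 / (K * K * p * (2 + p) + 1)).
  assert (He1 : 0 < K * K * p * (2 + p) + 1).
  { assert (0 <= K * K * p * (2 + p)) by (apply Rmult_le_pos; lra). lra. }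
  assert (Hee : 0 < e) by (apply Rdiv_lt_0_compat; lra).
  assert (Hee' : e * (K * K * p * (2 + p) + 1) = eps / 3) by (unfold e; field; lra).
  destruct (segment_commutator_small a b e y Hab Hy Hee) as (N1 & H1).
  destruct (op_sum_tends a b y ltac:(lra) Hy e Hee) as (N2 & H2).
  exists (N1 + N2)%nat. intros n k Hn Hk.
  assert (Hx : forall i, ‖segment_product a b i p x ⊖ segment_product a b i p y‖ <= eps / 3).
  { intros i.
    pose proof (weyl_semigroup _ _ _ (segment_product_weyl a b i ltac:(lra))) as S.
    rewrite <- (linear_sub (segment_product a b i p)) by now apply (sg_linear _ S).
    eapply Rle_trans; [apply (segment_product_bound a b i p Hab); lra|].
    fold K. rewrite norm_minus_sym in Hyx. pose proof (norm_pos (x ⊖ y)). nra. }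
  replace eps with (eps / 3 + (eps / 3 + eps / 3)) by field.
  apply (norm_minus_trans (segment_product a b n p y)); [apply Hx|].
  apply (norm_minus_trans (segment_product a b k p y)).
  2:{ rewrite norm_minus_sym. apply Hx. }
  eapply Rle_trans.
  { apply (weyl_comparison _ _ _ _ _ _ _ p K K y (segment_product_weyl a b k ltac:(lra))
      (pairing_op_sum _ _ _) (segment_product_weyl a b n ltac:(lra))); try easy.
    - now apply segment_product_bound.
    - now apply segment_product_bound. }
  apply Rle_trans with (K * (K * ((e + e) + p * e)) * p).
  - apply Rmult_le_compat_r; [easy|]. apply Rmult_le_compat_l; [easy|].
    apply Rmult_le_compat_l; [easy|]. apply Rplus_le_compat.
    + apply (norm_minus_trans (op_integral a b y)); [apply H2; lia|].
      rewrite norm_minus_sym. apply H2; lia.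
    + apply Rmult_le_compat_l; [easy|]. apply H1; lia.
  - rewrite <- Hee'. lra.
Qed.

Lemma segment_semigroup_exists a b : a <= b <= a + 1 ->
  exists T, weyl T (op_integral a b) (fun r => scalar_integral a b (mu r)) /\
    forall p, bounded_upto T p (growth p).
Proof.
  intros Hab.
  set (T := fun p x => epsilon (inhabits 𝟎)
    (fun z => tends (fun n => segment_product a b n p x) z)).
  assert (HT : forall p x, 0 <= p -> tends (fun n => segment_product a b n p x) (T p x)).
  { intros p x Hp. apply epsilon_spec. now apply segment_product_cauchy. }
  exists T. split.
  - apply (weyl_limit (segment_product a b)
      (fun n => op_sum (node a b n) (step a b n) n)
      (fun n r => segment_scalar a b n (mu r)) growth); [| |exact HT| | |].
    + intros n. apply segment_product_weyl. lra.
    + intros n p. now apply segment_product_bound.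
    + intros y Hy. apply op_sum_tends; [lra|easy].
    + intros r. apply scalar_sum_tends; [lra|apply mu_row_continuous].
    + apply mu_integral_continuous.
  - apply (limit_bounded (segment_product a b) growth); [|easy].
    intros n p. now apply segment_product_bound.
Qed.

(** * The evolution system *)

(** Chosen by its properties; [weyl_unique] shows that they determine it. *)
Definition segment_semigroup (a b : R) : R -> X -> X :=
  epsilon (inhabits (fun _ x => x)) (fun T =>
    weyl T (op_integral a b) (fun r => scalar_integral a b (mu r)) /\
    forall p, bounded_upto T p (growth p)).

Lemma segment_weyl a b : a <= b <= a + 1 ->
  weyl (segment_semigroup a b) (op_integral a b) (fun r => scalar_integral a b (mu r)).
Proof. intros Hab. exact (proj1 (epsilon_spec _ _ (segment_semigroup_exists a b Hab))). Qed.

Lemma segment_bound a b p : a <= b <= a + 1 ->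
  bounded_upto (segment_semigroup a b) p (growth p).
Proof. intros Hab. exact (proj2 (epsilon_spec _ _ (segment_semigroup_exists a b Hab)) p). Qed.

(** The orbits of [T'] in the continuity space solve the initial value problem for
    the generator of [T]. *)
Lemma weyl_unique T G m T' G' m' t x :
  weyl T G m -> weyl T' G' m' -> (forall y, Y y -> G y = G' y) -> 0 <= t ->
  T' t x = T t x.
Proof.
  intros H1 H2 HG Ht. revert x.
  pose proof (weyl_semigroup _ _ _ H1) as S1. pose proof (weyl_semigroup _ _ _ H2) as S2.
  apply linear_eq_on_Y; [now apply (sg_linear _ S2)|now apply (sg_linear _ S1)|].
  intros y Hy. destruct (sg_bounded T S1 t) as (K & HK).
  apply eq_of_norm. replace (T t y) with (T t (T' 0 y)) by now rewrite (sg_zero _ S2).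
  replace 0 with (K * 0 * t) at 2 by ring.
  apply (duhamel_semigroup T (fun t => T' t y)); [easy..| |].
  { now apply semigroup_continuous_Icc. }
  intros s Hs. exists (T' s (G' y)), (T' s (G' y)). split; [|split].
  - apply generator_right_derivative; [easy| |lra]. now apply (weyl_generator _ _ _ H2).
  - rewrite <- (weyl_G_orbit _ _ _ s y H2) by (easy || lra).
    assert (HY : Y (T' s y)) by (apply (weyl_invariant _ _ _ _ _ H2); [lra|easy]).
    rewrite <- HG by easy. now apply (weyl_generator _ _ _ H1).
  - replace (_ ⊖ _) with (𝟎 : X) by vec. rewrite norm_null. lra.
Qed.

(** The product on the right generates the sum of the integrals over [[a, b]] and
    [[b, c]], hence equals the semigroup on the left. *)
Lemma segment_cocycle a b c p x : a <= b -> b <= c -> c <= a + 1 -> 0 <= p ->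
  segment_semigroup a c p x =
  Cexp (RtoC (p * p) *
        (- scalar_integral b c (fun r => scalar_integral a b (mu r)) / 2))%C
  ⊙ segment_semigroup b c p (segment_semigroup a b p x).
Proof.
  intros Hab Hbc Hac Hp.
  assert (W1 := segment_weyl b c ltac:(lra)).
  assert (W2 := segment_weyl a b ltac:(lra)).
  assert (W3 := segment_weyl a c ltac:(lra)).
  apply (weyl_unique _ _ _ _ _ _ p x
    (weyl_sum _ _ _ _ _ _ _ W1 (pairing_integral b c Hbc) W2) W3); [|easy].
  intros y Hy. rewrite <- (op_integral_Chasles a b c y Hy). vec.
Qed.

Lemma inner_integral_continuous a :
  scalar_continuous (fun r => scalar_integral a r (mu r)).
Proof.
  intros r eps He. pose proof Cmu_nonneg.
  destruct (mu_integral_continuous a r r (eps / 2)) as (d1 & Hd1 & H1); [lra|].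
  assert (Hq : 0 < eps / 2 / (Cmu + 1)) by (apply Rdiv_lt_0_compat; lra).
  assert (Hq' : eps / 2 / (Cmu + 1) * (Cmu + 1) = eps / 2) by (field; lra).
  set (q := eps / 2 / (Cmu + 1)) in *.
  exists (Rmin d1 q); split; [now apply Rmin_glb_lt|]. intros s Hs.
  pose proof (Rmin_l d1 q). pose proof (Rmin_r d1 q).
  rewrite <- (scalar_integral_Chasles a r s (mu s)) by apply mu_row_continuous.
  replace (scalar_integral a r (mu s) + scalar_integral r s (mu s) -
           scalar_integral a r (mu r))%C with
    ((scalar_integral a r (mu s) - scalar_integral a r (mu r)) +
     scalar_integral r s (mu s))%C by ring.
  eapply Rle_trans; [apply Cmod_triangle|].
  specialize (H1 s ltac:(lra)). pose proof (mu_integral_bound r s s).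
  assert (Rabs (s - r) * Cmu <= q * Cmu) by (apply Rmult_le_compat_r; lra).
  lra.
Qed.

Lemma scalar_integral_plus a b m m' :
  scalar_continuous m -> scalar_continuous m' ->
  scalar_integral a b (fun r => (m r + m' r)%C) =
  (scalar_integral a b m + scalar_integral a b m')%C.
Proof.
  intros H1 H2.
  apply (RInt_plus (V := C_R_CompleteNormedModule) m m'); now apply ex_scalar_integral.
Qed.

Lemma scalar_integral_ext a b m m' :
  (forall r, m r = m' r) -> scalar_integral a b m = scalar_integral a b m'.
Proof. intros H. apply (RInt_ext (V := C_R_CompleteNormedModule)). intros r _. apply H. Qed.

Lemma double_integral_scalar a b :
  double_integral mu a b = scalar_integral a b (fun r => scalar_integral a r (mu r)).
Proof. reflexivity. Qed.

Lemma double_integral_shift a b c d :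
  scalar_integral c d (fun r => scalar_integral a r (mu r)) =
  (scalar_integral c d (fun r => scalar_integral a b (mu r)) +
   scalar_integral c d (fun r => scalar_integral b r (mu r)))%C.
Proof.
  rewrite <- (scalar_integral_plus c d (fun r => scalar_integral a b (mu r))
    (fun r => scalar_integral b r (mu r)) (mu_integral_continuous a b)
    (inner_integral_continuous b)).
  apply scalar_integral_ext. intros r. symmetry.
  apply scalar_integral_Chasles, mu_row_continuous.
Qed.

(** The triangle over [[a, c]] consists of the triangles over [[a, b]] and [[b, c]]
    and a rectangle; the rectangle contributes the scalar in [segment_cocycle]. *)
Lemma double_integral_Chasles a b c :
  double_integral mu a c =
  (double_integral mu a b + double_integral mu b c +
   scalar_integral b c (fun r => scalar_integral a b (mu r)))%C.
Proof.
  rewrite !double_integral_scalar.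
  rewrite <- (scalar_integral_Chasles a b c) by apply inner_integral_continuous.
  rewrite (double_integral_shift a b b c). ring.
Qed.

Lemma inner_integral_bound a b c : 0 <= a <= 1 -> 0 <= b <= 1 -> 0 <= c <= 1 ->
  Cmod (scalar_integral b c (fun r => scalar_integral a r (mu r))) <= Rabs (c - b) * Cmu.
Proof.
  intros Ha Hb Hc. apply scalar_integral_bound.
  - apply ex_scalar_integral, inner_integral_continuous.
  - intros r Hr. eapply Rle_trans; [apply mu_integral_bound|].
    rewrite <- (Rmult_1_l Cmu) at 2. apply Rmult_le_compat_r; [apply Cmu_nonneg|].
    assert (0 <= r <= 1).
    { pose proof (Rmin_glb b c 0 ltac:(lra) ltac:(lra)).
      pose proof (Rmax_lub b c 1 ltac:(lra) ltac:(lra)). lra. }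
    apply Rabs_le. lra.
Qed.

Lemma double_integral_lipschitz a b c d :
  0 <= a <= 1 -> 0 <= b <= 1 -> 0 <= c <= 1 -> 0 <= d <= 1 ->
  Cmod (double_integral mu c d - double_integral mu a b) <=
  (2 * Rabs (c - a) + Rabs (d - b)) * Cmu.
Proof.
  intros Ha Hb Hc Hd. rewrite !double_integral_scalar. pose proof Cmu_nonneg.
  pose proof (inner_integral_continuous c) as Hi.
  rewrite <- (scalar_integral_Chasles c a d) by easy.
  rewrite <- (scalar_integral_Chasles a b d) by easy.
  rewrite (double_integral_shift c a a b).
  match goal with |- Cmod ?z <= _ => replace z with
    (scalar_integral c a (fun r => scalar_integral c r (mu r)) +
     (scalar_integral a b (fun r => scalar_integral c a (mu r)) +
      scalar_integral b d (fun r => scalar_integral c r (mu r))))%C by ring end.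
  pose proof (inner_integral_bound c c a Hc Hc Ha).
  pose proof (inner_integral_bound c b d Hc Hb Hd).
  assert (Cmod (scalar_integral a b (fun r => scalar_integral c a (mu r))) <=
          Rabs (c - a) * Cmu).
  { apply Rle_trans with (Rabs (b - a) * (Rabs (a - c) * Cmu)).
    - apply scalar_integral_bound; [apply ex_scalar_integral, mu_integral_continuous|].
      intros r _. apply mu_integral_bound.
    - rewrite (Rabs_minus_sym a c). rewrite <- (Rmult_1_l (Rabs (c - a) * Cmu)) at 2.
      apply Rmult_le_compat_r; [apply Rmult_le_pos; [apply Rabs_pos|easy]|].
      apply Rabs_le. lra. }
  rewrite (Rabs_minus_sym a c) in *.
  eapply Rle_trans; [apply Cmod_triangle|].
  eapply Rle_trans; [apply Rplus_le_compat_l, Cmod_triangle|]. lra.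
Qed.

Lemma double_integral_point a : double_integral mu a a = RtoC 0.
Proof. exact (RInt_point (V := C_R_CompleteNormedModule) a _). Qed.

Lemma double_integral_square a b : 0 <= a <= b -> b <= 1 ->
  Cmod (double_integral mu a b) <= (b - a) * (b - a) * Cmu.
Proof.
  intros Ha Hb. rewrite double_integral_scalar.
  replace ((b - a) * (b - a) * Cmu) with (Rabs (b - a) * ((b - a) * Cmu))
    by (rewrite Rabs_pos_eq by lra; ring).
  apply scalar_integral_bound; [apply ex_scalar_integral, inner_integral_continuous|].
  intros r Hr. rewrite Rmin_left, Rmax_right in Hr by lra.
  eapply Rle_trans; [apply mu_integral_bound|].
  apply Rmult_le_compat_r; [apply Cmu_nonneg|]. rewrite Rabs_pos_eq; lra.
Qed.

Definition evolution (t s : R) x : X :=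
  Cexp (RtoC (/ 2) * double_integral mu s t)%C ⊙ segment_semigroup s t 1 x.

Lemma evolution_linear s t : s <= t <= s + 1 -> is_linear (evolution t s).
Proof.
  intros H. apply is_linear_cscal.
  apply (sg_linear _ (weyl_semigroup _ _ _ (segment_weyl s t H))). lra.
Qed.

Definition evolution_constant : R := exp Cmu * growth 1.

Lemma evolution_constant_nonneg : 0 <= evolution_constant.
Proof. apply Rmult_le_pos; [left; apply exp_pos|apply growth_nonneg]. Qed.

Lemma evolution_factor_bound s t : 0 <= s <= t -> t <= 1 ->
  Cmod (Cexp (RtoC (/ 2) * double_integral mu s t)) <= exp Cmu.
Proof.
  intros Hs Ht. pose proof Cmu_nonneg.
  eapply Rle_trans; [apply Cmod_Cexp_le|]. apply exp_mono.
  rewrite Cmod_mult, Cmod_R, Rabs_pos_eq by lra.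
  pose proof (double_integral_square s t Hs Ht).
  assert ((t - s) * (t - s) * Cmu <= 1 * Cmu) by (apply Rmult_le_compat_r; nra). lra.
Qed.

Lemma evolution_bound s t x : 0 <= s <= t -> t <= 1 ->
  ‖evolution t s x‖ <= evolution_constant * ‖x‖.
Proof.
  intros Hs Ht. unfold evolution, evolution_constant. rewrite Rmult_assoc.
  apply norm_cscal_le; [now apply evolution_factor_bound|].
  apply (segment_bound s t 1); lra.
Qed.

(** The scalars in [segment_cocycle] and [double_integral_Chasles] cancel, thanks to
    the factor 1/2. *)
Lemma evolution_cocycle r s t x : 0 <= r <= s -> s <= t <= 1 ->
  evolution t s (evolution s r x) = evolution t r x.
Proof.
  intros Hr Ht. unfold evolution.
  rewrite (segment_cocycle r s t 1 x), (double_integral_Chasles r s t) by lra.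
  rewrite (linear_cscal (segment_semigroup s t 1))
    by (apply (sg_linear _ (weyl_semigroup _ _ _ (segment_weyl s t ltac:(lra)))); lra).
  set (c := scalar_integral s t _). set (d := double_integral mu r s).
  set (d' := double_integral mu s t).
  transitivity ((Cexp (RtoC (/ 2) * d') * Cexp (RtoC (/ 2) * d))%C
    ⊙ segment_semigroup s t 1 (segment_semigroup r s 1 x)); [vec|].
  transitivity ((Cexp (RtoC (/ 2) * (d + d' + c)) * Cexp (RtoC (1 * 1) * (- c / 2)))%C
    ⊙ segment_semigroup s t 1 (segment_semigroup r s 1 x)); [|vec].
  f_equal. rewrite <- !Cexp_plus. f_equal.
  rewrite Rmult_1_l, RtoC_inv by lra. field.
Qed.

Lemma evolution_diagonal t x : evolution t t x = x.
Proof.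
  unfold evolution. rewrite double_integral_point, Cmult_0_r, Cexp_0.
  assert (W := segment_weyl t t ltac:(lra)). pose proof (weyl_semigroup _ _ _ W) as S.
  transitivity (segment_semigroup t t 1 x); [vec|]. revert x.
  apply (linear_eq_on_Y _ (fun x => x)); [apply (sg_linear _ S); lra|apply is_linear_id|].
  intros y Hy. apply eq_of_norm.
  replace (segment_semigroup t t 1 y ⊖ y) with
    (segment_semigroup t t 1 y ⊖ y ⊖ 1 ⊙ 𝟎) by vec.
  apply Rle_trans with (1 * 0); [|lra].
  apply (orbit_increment_bound _ y 𝟎); [easy| |lra|].
  - pose proof (weyl_generator _ _ _ W y Hy) as H.
    replace (op_integral t t y) with (𝟎 : X) in H; [easy|].
    symmetry. exact (RInt_point (V := real_of X) t _).
  - intros s Hs. replace (segment_semigroup t t s 𝟎) with (𝟎 : X).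
    + replace (𝟎 ⊖ 𝟎) with (𝟎 : X) by vec. rewrite norm_null. lra.
    + symmetry. apply (linear_zero (segment_semigroup t t s)), (sg_linear _ S). lra.
Qed.

Lemma Y_bounded y : Y y -> exists B, 0 <= B /\ forall r, 0 <= r <= 1 -> ‖op (A r) y‖ <= B.
Proof.
  intros Hy.
  destruct (bounded_continuity (V := real_of X) (fun r => op (A r) y) 0 1) as (B & HB).
  { intros r _. now apply op_continuous. }
  exists (Rmax 0 B). split; [apply Rmax_l|]. intros r Hr.
  eapply Rle_trans; [left; exact (HB r Hr)|apply Rmax_r].
Qed.

Lemma op_integral_lipschitz y (B : R) a b c d :
  Y y -> (forall r, 0 <= r <= 1 -> ‖op (A r) y‖ <= B) ->
  0 <= a <= 1 -> 0 <= b <= 1 -> 0 <= c <= 1 -> 0 <= d <= 1 ->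
  ‖op_integral c d y ⊖ op_integral a b y‖ <= (Rabs (c - a) + Rabs (d - b)) * B.
Proof.
  intros Hy HB Ha Hb Hc Hd.
  rewrite <- (op_integral_Chasles c a d y Hy), <- (op_integral_Chasles a b d y Hy).
  replace (_ ⊖ _) with (op_integral c a y ⊕ op_integral b d y) by vec.
  assert (Main : forall u v, 0 <= u <= 1 -> 0 <= v <= 1 ->
    ‖op_integral u v y‖ <= Rabs (v - u) * B).
  { intros u v Hu Hv. apply op_integral_bound; [easy|]. intros r Hr. apply HB.
    pose proof (Rmin_glb u v 0 ltac:(lra) ltac:(lra)).
    pose proof (Rmax_lub u v 1 ltac:(lra) ltac:(lra)). lra. }
  rewrite Rmult_plus_distr_r, (Rabs_minus_sym c a). apply norm_plus_le; now apply Main.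
Qed.

Lemma mu_integral_lipschitz a b c d :
  0 <= a <= b -> b <= 1 -> 0 <= c <= 1 -> 0 <= d <= 1 ->
  Cmod (scalar_integral c d (fun r => scalar_integral a b (mu r)) -
        scalar_integral a b (fun r => scalar_integral a b (mu r))) <=
  (Rabs (c - a) + Rabs (d - b)) * Cmu.
Proof.
  intros Ha Hb Hc Hd. set (m := fun r => scalar_integral a b (mu r)).
  assert (Hm : scalar_continuous m) by exact (mu_integral_continuous a b).
  rewrite <- (scalar_integral_Chasles c a d m Hm), <- (scalar_integral_Chasles a b d m Hm).
  match goal with |- Cmod ?z <= _ => replace z with
    (scalar_integral c a m + scalar_integral b d m)%C by ring end.
  assert (Main : forall u v, Cmod (scalar_integral u v m) <= Rabs (v - u) * Cmu).
  { intros u v. apply scalar_integral_bound; [now apply ex_scalar_integral|].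
    intros r _. eapply Rle_trans; [exact (mu_integral_bound a b r)|].
    rewrite <- (Rmult_1_l Cmu) at 2. apply Rmult_le_compat_r; [apply Cmu_nonneg|].
    apply Rabs_le. lra. }
  eapply Rle_trans; [apply Cmod_triangle|].
  rewrite Rmult_plus_distr_r, (Rabs_minus_sym c a). apply Rplus_le_compat; apply Main.
Qed.

(** The commutator in [weyl_comparison] is the integral of [m] over [[s', t']], for
    the [m] of [[s, t]]; it is close to the one over [[s, t]], which annihilates [y]. *)
Lemma segment_continuous s t x eps :
  0 <= s <= t -> t <= 1 -> 0 < eps -> exists delta, 0 < delta /\
    forall s' t', 0 <= s' <= t' -> t' <= 1 ->
      Rabs (s' - s) < delta -> Rabs (t' - t) < delta ->
      ‖segment_semigroup s' t' 1 x ⊖ segment_semigroup s t 1 x‖ <= eps.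
Proof.
  intros Hs Ht He. pose proof (growth_nonneg 1) as HK. set (K := growth 1) in *.
  pose proof Cmu_nonneg as HC.
  set (q := eps / 3 / (K + 1)).
  assert (Hq : 0 < q) by (apply Rdiv_lt_0_compat; lra).
  assert (Hq' : q * (K + 1) = eps / 3) by (unfold q; field; lra).
  destruct (Y_dense x q Hq) as (y & Hy & Hyx).
  destruct (Y_bounded y Hy) as (B & HB0 & HB). pose proof (norm_pos y) as Hy0.
  set (L := K * K * (2 * B + 2 * Cmu * ‖y‖)).
  assert (HL : 0 <= L).
  { apply Rmult_le_pos; [nra|]. assert (0 <= Cmu * ‖y‖) by now apply Rmult_le_pos. lra. }
  exists (eps / 3 / (L + 1)). split; [apply Rdiv_lt_0_compat; lra|].
  intros s' t' Hs' Ht' Hss Htt. set (d := eps / 3 / (L + 1)) in *.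
  assert (Hd' : d * (L + 1) = eps / 3) by (unfold d; field; lra).
  assert (Hx : forall a b, 0 <= a <= b -> b <= 1 ->
    ‖segment_semigroup a b 1 x ⊖ segment_semigroup a b 1 y‖ <= eps / 3).
  { intros a b Ha Hb.
    pose proof (weyl_semigroup _ _ _ (segment_weyl a b ltac:(lra))) as S.
    rewrite <- (linear_sub (segment_semigroup a b 1)) by (apply (sg_linear _ S); lra).
    eapply Rle_trans; [apply (segment_bound a b 1); lra|].
    fold K. rewrite norm_minus_sym in Hyx. pose proof (norm_pos (x ⊖ y)). nra. }
  replace eps with (eps / 3 + (eps / 3 + eps / 3)) by field.
  apply (norm_minus_trans (segment_semigroup s' t' 1 y)); [now apply Hx|].
  apply (norm_minus_trans (segment_semigroup s t 1 y)).
  2:{ rewrite norm_minus_sym. now apply Hx. }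
  rewrite norm_minus_sym.
  assert (W := segment_weyl s t ltac:(lra)).
  eapply Rle_trans.
  { apply (weyl_comparison _ _ _ _ _ _ _ 1 K K y (segment_weyl s' t' ltac:(lra))
      (pairing_integral s' t' ltac:(lra)) W); [lra|..|easy]; apply segment_bound; lra. }
  set (m := fun r => scalar_integral s t (mu r)).
  apply Rle_trans with (K * (K * ((d + d) * B + 1 * ((d + d) * Cmu * ‖y‖))) * 1).
  - rewrite !Rmult_1_r. apply Rmult_le_compat_l; [easy|].
    apply Rmult_le_compat_l; [easy|]. apply Rplus_le_compat.
    + rewrite norm_minus_sym.
      eapply Rle_trans; [apply (op_integral_lipschitz y B s t s' t'); (easy || lra)|].
      apply Rmult_le_compat_r; lra.
    + apply Rmult_le_compat_l; [lra|].
      replace (scalar_integral s' t' m ⊙ y) with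
        ((scalar_integral s' t' m - scalar_integral s t m)%C ⊙ y
          ⊕ scalar_integral s t m ⊙ y) by vec.
      assert (E0 : scalar_integral s t m ⊙ y = 𝟎)
        by exact (weyl_pairing_self _ _ _ _ _ W (pairing_integral s t ltac:(lra)) Hy).
      rewrite E0.
      replace (_ ⊕ 𝟎) with
        ((scalar_integral s' t' m - scalar_integral s t m)%C ⊙ y) by vec.
      apply norm_cscal_le; [|apply Rle_refl].
      eapply Rle_trans; [apply (mu_integral_lipschitz s t s' t'); lra|].
      apply Rmult_le_compat_r; lra.
  - apply Rle_trans with (d * L); [|nra]. unfold L. right. ring.
Qed.

Lemma evolution_continuous s t x eps :
  0 <= s <= t -> t <= 1 -> 0 < eps -> exists delta, 0 < delta /\
    forall s' t', 0 <= s' <= t' -> t' <= 1 ->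
      Rabs (s' - s) < delta -> Rabs (t' - t) < delta ->
      ‖evolution t' s' x ⊖ evolution t s x‖ <= eps.
Proof.
  intros Hs Ht He. pose proof (exp_pos Cmu) as HeC.
  pose proof (growth_nonneg 1) as HK. set (K := growth 1) in *.
  pose proof (norm_pos x) as Hx. pose proof Cmu_nonneg as HC.
  destruct (segment_continuous s t x (eps / 2 / exp Cmu)) as (d1 & Hd1 & H1);
    [easy..|apply Rdiv_lt_0_compat; lra|].
  set (z := segment_semigroup s t 1 x) in *.
  assert (Hz : ‖z‖ <= K * ‖x‖) by (apply (segment_bound s t 1); lra).
  set (Q := exp Cmu * (K * ‖x‖) + 1).
  assert (HQ : 0 < Q).
  { assert (0 <= exp Cmu * (K * ‖x‖)) by (apply Rmult_le_pos; [lra|now apply Rmult_le_pos]).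
    unfold Q; lra. }
  (* The scalar factors differ by [exp w - 1], where [w] is half the difference of
     the double integrals. *)
  assert (Hexp : exists d2, 0 < d2 /\ forall w : C, Cmod w < d2 ->
            Cmod (Cexp w - 1)%C <= eps / 2 / Q).
  { assert (Hq : 0 < eps / 2 / Q) by (apply Rdiv_lt_0_compat; lra).
    apply Cexp_continuous_at_0. easy. }
  destruct Hexp as (d2 & Hd2 & H2).
  assert (Hd3 : 0 < d2 / (2 * Cmu + 1)) by (apply Rdiv_lt_0_compat; lra).
  assert (Hd3' : d2 / (2 * Cmu + 1) * (2 * Cmu + 1) = d2) by (field; lra).
  set (d3 := d2 / (2 * Cmu + 1)) in *.
  exists (Rmin d1 d3). split; [now apply Rmin_glb_lt|].
  intros s' t' Hs' Ht' Hss Htt. pose proof (Rmin_l d1 d3). pose proof (Rmin_r d1 d3).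
  specialize (H1 s' t' Hs' Ht' ltac:(lra) ltac:(lra)).
  set (w := (RtoC (/ 2) * (double_integral mu s' t' - double_integral mu s t))%C).
  assert (Hw : Cmod w < d2).
  { unfold w. rewrite Cmod_mult, Cmod_R, Rabs_pos_eq by lra.
    assert (H3 := double_integral_lipschitz s t s' t' ltac:(lra) ltac:(lra)
      ltac:(lra) ltac:(lra)).
    assert ((2 * Rabs (s' - s) + Rabs (t' - t)) * Cmu <= 3 * d3 * Cmu)
      by (apply Rmult_le_compat_r; lra).
    assert (0 <= d3 * Cmu) by (apply Rmult_le_pos; lra). lra. }
  specialize (H2 w Hw).
  set (e := Cexp (RtoC (/ 2) * double_integral mu s t)).
  set (e' := Cexp (RtoC (/ 2) * double_integral mu s' t')).
  assert (Ee : e' = (e * Cexp w)%C).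
  { unfold e, e', w. rewrite <- Cexp_plus. f_equal. ring. }
  unfold evolution. fold e e' z.
  replace (e' ⊙ segment_semigroup s' t' 1 x ⊖ e ⊙ z) with
    (e' ⊙ (segment_semigroup s' t' 1 x ⊖ z) ⊕ e ⊙ ((Cexp w - 1)%C ⊙ z))
    by (rewrite Ee; vec).
  replace eps with (exp Cmu * (eps / 2 / exp Cmu) + eps / 2) by (field; lra).
  apply norm_plus_le.
  - apply norm_cscal_le; [now apply evolution_factor_bound|easy].
  - apply Rle_trans with (exp Cmu * (eps / 2 / Q * (K * ‖x‖))).
    + apply norm_cscal_le; [now apply evolution_factor_bound|].
      now apply norm_cscal_le.
    + assert (E1 : eps / 2 / Q * Q = eps / 2) by (field; lra).
      assert (0 < eps / 2 / Q) by (apply Rdiv_lt_0_compat; lra).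
      apply Rle_trans with (eps / 2 / Q * (exp Cmu * (K * ‖x‖))); [right; ring|].
      unfold Q in E1 at 2. lra.
Qed.

Lemma evolution_commutes r s t y : 0 <= s <= t -> t <= 1 -> Y y ->
  dom (A r) (evolution t s y) /\
  op (A r) (evolution t s y) =
  evolution t s (op (A r) y ⊕ scalar_integral s t (mu r) ⊙ y).
Proof.
  intros Hs Ht Hy.
  destruct (weyl_commutes _ _ _ (segment_weyl s t ltac:(lra)) r 1 y Rle_0_1 Hy) as (H1 & H2).
  unfold evolution.
  destruct (A_scal r (Cexp (RtoC (/ 2) * double_integral mu s t)) _ H1) as (H3 & H4).
  split; [easy|]. rewrite H4, H2, Cmult_1_r. reflexivity.
Qed.

Lemma evolution_invariant s t y : 0 <= s <= t -> t <= 1 -> Y y -> Y (evolution t s y).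
Proof.
  intros Hs Ht Hy. apply Y_scal.
  apply (weyl_invariant _ _ _ _ _ (segment_weyl s t ltac:(lra))); [lra|easy].
Qed.

Lemma segment_near_identity t x eps : 0 <= t < 1 -> 0 < eps ->
  exists delta, 0 < delta /\ forall h r, 0 < h < delta -> t + h <= 1 -> 0 <= r <= 1 ->
    ‖segment_semigroup t (t + h) r x ⊖ x‖ <= eps.
Proof.
  intros Ht He. pose proof (growth_nonneg 1) as HK. set (K := growth 1) in *.
  set (q := eps / 2 / (K + 1)).
  assert (Hq : 0 < q) by (apply Rdiv_lt_0_compat; lra).
  assert (Hq' : q * (K + 1) = eps / 2) by (unfold q; field; lra).
  destruct (Y_dense x q Hq) as (y & Hy & Hyx).
  destruct (Y_bounded y Hy) as (B & HB0 & HB).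
  assert (HKB : 0 <= K * B) by now apply Rmult_le_pos.
  assert (Hd : 0 < eps / 2 / (K * B + 1)) by (apply Rdiv_lt_0_compat; lra).
  assert (Hd' : eps / 2 / (K * B + 1) * (K * B + 1) = eps / 2) by (field; lra).
  set (d := eps / 2 / (K * B + 1)) in *.
  exists d; split; [easy|]. intros h r Hh Hth Hr.
  assert (W := segment_weyl t (t + h) ltac:(lra)).
  pose proof (weyl_semigroup _ _ _ W) as S.
  assert (HT := segment_bound t (t + h) 1 ltac:(lra)).
  set (T := segment_semigroup t (t + h)) in *.
  replace (T r x ⊖ x) with ((T r y ⊖ y ⊖ r ⊙ 𝟎) ⊕ ((y ⊖ x) ⊖ T r (y ⊖ x))).
  2:{ rewrite (linear_sub (T r)) by (apply (sg_linear _ S); lra). vec. }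
  apply Rle_trans with (r * (K * (h * B)) + (q + K * q)).
  - apply norm_plus_le.
    + apply (orbit_increment_bound T y (op_integral t (t + h) y)); [easy| |lra|].
      { now apply (weyl_generator _ _ _ W). }
      intros s Hs. replace (_ ⊖ 𝟎) with (T s (op_integral t (t + h) y)) by vec.
      eapply Rle_trans; [apply HT; lra|]. apply Rmult_le_compat_l; [easy|].
      replace (h * B) with (Rabs (t + h - t) * B)
        by (rewrite Rabs_pos_eq by lra; ring).
      apply op_integral_bound; [easy|]. intros u Hu. apply HB.
      rewrite Rmin_left, Rmax_right in Hu by lra. lra.
    + apply norm_minus_le; [easy|].
      eapply Rle_trans; [apply HT; lra|]. now apply Rmult_le_compat_l.
  - assert (E1 : K * B * h <= K * B * d) by (apply Rmult_le_compat_l; lra).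
    assert (E2 : r * (K * B * h) <= 1 * (K * B * h)).
    { apply Rmult_le_compat_r; [apply Rmult_le_pos; lra|lra]. }
    lra.
Qed.

Lemma op_integral_small t y eps : Y y -> 0 < eps ->
  exists delta, 0 < delta /\ forall h, 0 < h < delta ->
    ‖op_integral t (t + h) y ⊖ h ⊙ op (A t) y‖ <= h * eps.
Proof.
  intros Hy He. destruct (proj2 Hy t eps He) as (d & Hd & H).
  exists d; split; [easy|]. intros h Hh.
  replace h with (t + h - t) at 2 3 by ring.
  apply (RInt_minus_const_le (V := real_of X) (fun r => op (A r) y) t (t + h));
    [lra| |].
  - intros r _. now apply op_continuous.
  - intros r Hr. apply H. rewrite Rabs_pos_eq; lra.
Qed.

(** To first order in [h], the semigroup of [[t, t + h]] at time 1 is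
    [1 + ∫ A] and the integral is [h (A t)], while the exponent of the scalar factor
    is of order [h^2]. *)
Lemma evolution_right_derivative_diagonal t y : 0 <= t < 1 -> Y y ->
  little_o (fun h => evolution (t + h) t y ⊖ y ⊖ h ⊙ op (A t) y).
Proof.
  intros Ht Hy eps He. pose proof (growth_nonneg 1) as HK. set (K := growth 1) in *.
  pose proof Cmu_nonneg as HC. pose proof (norm_pos y) as Hy0.
  assert (Hq : 0 < eps / 3 / (K + 1)) by (apply Rdiv_lt_0_compat; lra).
  assert (Hq' : eps / 3 / (K + 1) * (K + 1) = eps / 3) by (field; lra).
  set (q := eps / 3 / (K + 1)) in *.
  destruct (op_integral_small t y q Hy Hq) as (d1 & Hd1 & H1).
  destruct (segment_near_identity t (op (A t) y) (eps / 3) Ht) as (d2 & Hd2 & H2); [lra|].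
  destruct Cexp_lipschitz_0 as (d3 & Hd3 & H3).
  set (Q := 8 * Cmu * (K * ‖y‖) + 1).
  assert (HQ0 : 0 <= Cmu * (K * ‖y‖)) by (apply Rmult_le_pos; [easy|now apply Rmult_le_pos]).
  assert (HQ : 0 < Q) by (unfold Q; lra).
  assert (Hd4 : 0 < eps / 3 / Q) by (apply Rdiv_lt_0_compat; lra).
  assert (Hd4' : eps / 3 / Q * Q = eps / 3) by (field; lra).
  assert (Hd5 : 0 < d3 / (Cmu + 1)) by (apply Rdiv_lt_0_compat; lra).
  assert (Hd5' : d3 / (Cmu + 1) * (Cmu + 1) = d3) by (field; lra).
  set (d4 := eps / 3 / Q) in *. set (d5 := d3 / (Cmu + 1)) in *.
  exists (Rmin (Rmin d1 d2) (Rmin (Rmin d4 d5) (1 - t))).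
  split; [repeat apply Rmin_glb_lt; lra|]. intros h Hh.
  pose proof (Rmin_l (Rmin d1 d2) (Rmin (Rmin d4 d5) (1 - t))).
  pose proof (Rmin_r (Rmin d1 d2) (Rmin (Rmin d4 d5) (1 - t))).
  pose proof (Rmin_l d1 d2). pose proof (Rmin_r d1 d2).
  pose proof (Rmin_l (Rmin d4 d5) (1 - t)). pose proof (Rmin_r (Rmin d4 d5) (1 - t)).
  pose proof (Rmin_l d4 d5). pose proof (Rmin_r d4 d5).
  specialize (H1 h ltac:(lra)).
  assert (W := segment_weyl t (t + h) ltac:(lra)).
  pose proof (weyl_semigroup _ _ _ W) as S.
  assert (HT := segment_bound t (t + h) 1 ltac:(lra)).
  assert (H2' : forall r, 0 <= r <= 1 ->
    ‖segment_semigroup t (t + h) r (op (A t) y) ⊖ op (A t) y‖ <= eps / 3).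
  { intros r Hr. apply H2; lra. }
  assert (Hw : Cmod (RtoC (/ 2) * double_integral mu t (t + h))%C <= h * h * Cmu).
  { rewrite Cmod_mult, Cmod_R, Rabs_pos_eq by lra.
    pose proof (double_integral_square t (t + h) ltac:(lra) ltac:(lra)) as Hdi.
    replace (t + h - t) with h in Hdi by ring.
    assert (0 <= h * h * Cmu) by (apply Rmult_le_pos; nra). lra. }
  unfold evolution. set (T := segment_semigroup t (t + h)) in *.
  set (w := (RtoC (/ 2) * double_integral mu t (t + h))%C) in *.
  assert (Hwd : h * h * Cmu <= h * (Cmu * d5)).
  { rewrite Rmult_assoc. apply Rmult_le_compat_l; [lra|].
    rewrite Rmult_comm. apply Rmult_le_compat_l; lra. }
  assert (Ht1 : h < 1) by lra.
  assert (Hwd3 : Cmod w < d3).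
  { assert (h * (Cmu * d5) <= 1 * (Cmu * d5)).
    { apply Rmult_le_compat_r; [apply Rmult_le_pos; lra|lra]. }
    lra. }
  specialize (H3 w Hwd3).
  replace (Cexp w ⊙ T 1 y ⊖ y ⊖ h ⊙ op (A t) y) with
    ((T 1 y ⊖ y ⊖ 1 ⊙ (h ⊙ op (A t) y)) ⊕ (Cexp w - 1)%C ⊙ T 1 y) by vec.
  apply Rle_trans with
    (1 * (K * (h * q) + h * (eps / 3)) + 8 * (h * h * Cmu) * (K * ‖y‖)).
  - apply norm_plus_le.
    + apply (orbit_increment_bound T y (op_integral t (t + h) y)); [easy| |lra|].
      { now apply (weyl_generator _ _ _ W). }
      intros r Hr. apply (norm_minus_trans (T r (h ⊙ op (A t) y))).
      * rewrite <- (linear_sub (T r)) by (apply (sg_linear _ S); lra).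
        eapply Rle_trans; [apply HT; lra|]. now apply Rmult_le_compat_l.
      * rewrite (linear_cscal (T r)) by (apply (sg_linear _ S); lra).
        replace (h ⊙ T r (op (A t) y) ⊖ h ⊙ op (A t) y) with
          (h ⊙ (T r (op (A t) y) ⊖ op (A t) y)) by vec.
        apply norm_real_scal_le; [lra|]. apply H2'. lra.
    + apply norm_cscal_le; [lra|]. apply HT. lra.
  - assert (E1 : h * (8 * Cmu * (K * ‖y‖)) <= d4 * (8 * Cmu * (K * ‖y‖))).
    { apply Rmult_le_compat_r; [|lra].
      rewrite Rmult_assoc. lra. }
    assert (E2 : h * (8 * Cmu * (K * ‖y‖)) <= eps / 3) by (unfold Q in Hd4'; lra).
    assert (E3 : h * (h * (8 * Cmu * (K * ‖y‖))) <= h * (eps / 3))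
      by (apply Rmult_le_compat_l; lra).
    assert (E4 : h * (K * q) <= h * (eps / 3)) by (apply Rmult_le_compat_l; lra).
    lra.
Qed.

(** The cocycle identity reduces this to the initial time [t], at the point
    [evolution t s y] of the continuity space. *)
Lemma evolution_right_derivative s t y : 0 <= s <= t -> t < 1 -> Y y ->
  right_derivative (fun r => evolution r s y) t (op (A t) (evolution t s y)).
Proof.
  intros Hs Ht Hy eps He.
  assert (HY : Y (evolution t s y)) by (apply evolution_invariant; (easy || lra)).
  destruct (evolution_right_derivative_diagonal t _ ltac:(lra) HY eps He) as (d & Hd & H).
  exists (Rmin d (1 - t)). split; [apply Rmin_glb_lt; lra|]. intros h Hh.
  pose proof (Rmin_l d (1 - t)). pose proof (Rmin_r d (1 - t)).
  rewrite <- (evolution_cocycle s t (t + h)) by lra. apply H. lra.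
Qed.

Lemma evolution_continuous_left s x :
  0 <= s <= 1 -> continuous_Icc (fun t => evolution t s x) s 1.
Proof.
  intros Hs t Ht eps He.
  destruct (evolution_continuous s t x eps ltac:(lra) ltac:(lra) He) as (d & Hd & H).
  exists d; split; [easy|]. intros r Hr Hrt. apply H; [lra..| |easy].
  now rewrite Rminus_diag, Rabs_R0.
Qed.

(** The commutation relation moves [A t] to the right of the evolution, where it
    acts on the fixed vector [y]. *)
Lemma evolution_velocity_continuous s y : 0 <= s <= 1 -> Y y ->
  continuous_Icc (fun t => op (A t) (evolution t s y)) s 1.
Proof.
  intros Hs Hy t Ht eps He.
  pose proof evolution_constant_nonneg as HK. set (K := evolution_constant) in *.
  pose proof (norm_pos y) as Hy0.
  set (z := fun r => op (A r) y ⊕ scalar_integral s r (mu r) ⊙ y).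
  assert (E0 : forall r, s <= r <= 1 -> op (A r) (evolution r s y) = evolution r s (z r)).
  { intros r Hr. apply evolution_commutes; (easy || lra). }
  set (q := eps / 2 / (2 * (K + 1))).
  assert (Hq : 0 < q) by (apply Rdiv_lt_0_compat; lra).
  assert (Hq' : q * (2 * (K + 1)) = eps / 2) by (unfold q; field; lra).
  destruct (proj2 Hy t q Hq) as (d1 & Hd1 & H1).
  assert (Hq2 : 0 < q / (‖y‖ + 1)) by (apply Rdiv_lt_0_compat; lra).
  assert (Hq2' : q / (‖y‖ + 1) * (‖y‖ + 1) = q) by (field; lra).
  destruct (inner_integral_continuous s t _ Hq2) as (d2 & Hd2 & H2).
  destruct (evolution_continuous_left s (z t) Hs t Ht (eps / 2)) as (d3 & Hd3 & H3); [lra|].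
  exists (Rmin d1 (Rmin d2 d3)). split; [repeat apply Rmin_glb_lt; lra|].
  intros r Hr Hrt. pose proof (Rmin_l d1 (Rmin d2 d3)). pose proof (Rmin_r d1 (Rmin d2 d3)).
  pose proof (Rmin_l d2 d3). pose proof (Rmin_r d2 d3).
  rewrite !E0 by easy. replace eps with (eps / 2 + eps / 2) by field.
  apply (norm_minus_trans (evolution r s (z t))); [|apply H3; lra].
  rewrite <- (linear_sub (evolution r s)) by (apply evolution_linear; lra).
  eapply Rle_trans; [apply evolution_bound; lra|]. fold K.
  assert (Hz : ‖z r ⊖ z t‖ <= q + q).
  { unfold z.
    replace (_ ⊖ _) with ((op (A r) y ⊖ op (A t) y) ⊕
      (scalar_integral s r (mu r) - scalar_integral s t (mu t))%C ⊙ y) by vec.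
    apply norm_plus_le; [apply H1; lra|].
    apply Rle_trans with (q / (‖y‖ + 1) * ‖y‖); [|nra].
    apply norm_cscal_le; [apply H2; lra|apply Rle_refl]. }
  pose proof (norm_pos (z r ⊖ z t)). nra.
Qed.

Lemma evolution_derivative s y : 0 <= s <= 1 -> Y y ->
  forall t, s <= t <= 1 -> forall eps, 0 < eps -> exists delta, 0 < delta /\
    forall r, s <= r <= 1 -> Rabs (r - t) < delta ->
      ‖evolution r s y ⊖ evolution t s y ⊖ (r - t) ⊙ op (A t) (evolution t s y)‖
        <= eps * Rabs (r - t).
Proof.
  intros Hs Hy.
  apply (derivative_of_right_derivative (fun t => evolution t s y)
    (fun t => op (A t) (evolution t s y))).
  - now apply evolution_continuous_left.
  - now apply evolution_velocity_continuous.
  - intros t Ht. apply evolution_right_derivative; (easy || lra).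
Qed.

(** Duhamel's formula with [W = evolution]: the bound and the cocycle identity are
    those of the evolution, while [V] enters through single orbits in [Y]. *)
Lemma evolution_unique (V : R -> R -> X -> X) s t x :
  (forall s t, 0 <= s <= t -> t <= 1 -> is_linear (V t s)) ->
  (forall y, Y y -> V s s y = y) ->
  (forall y r, Y y -> s <= r <= 1 -> Y (V r s y)) ->
  (forall y, Y y -> continuous_Icc (fun r => V r s y) s 1) ->
  (forall y r, Y y -> s <= r < 1 ->
     right_derivative (fun r => V r s y) r (op (A r) (V r s y))) ->
  0 <= s < 1 -> s <= t <= 1 -> V t s x = evolution t s x.
Proof.
  intros HL H0 HY HC HD Hs Ht. revert x.
  apply linear_eq_on_Y; [apply HL; lra|apply evolution_linear; lra|].
  intros y Hy. apply eq_of_norm.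
  replace (V t s y) with (evolution t t (V t s y)) by apply evolution_diagonal.
  replace (evolution t s y) with (evolution t s (V s s y)) by now rewrite H0.
  apply Rle_trans with (evolution_constant * 0 * (t - s)); [|right; ring].
  apply (duhamel_bound evolution (fun r => V r s y) s t); [lra| |..].
  - apply evolution_constant_nonneg.
  - intros a b H1 H2. apply evolution_linear; lra.
  - intros a b z H1 H2. apply evolution_bound; lra.
  - intros a b c z H1 H2. apply evolution_cocycle; lra.
  - intros z a Ha e He.
    destruct (evolution_continuous a t z e ltac:(lra) ltac:(lra) He) as (d & Hd & H).
    exists d; split; [easy|]. intros b Hb Hab. apply H; [lra..|easy|].
    now rewrite Rminus_diag, Rabs_R0.
  - intros a Ha e He. destruct (HC y Hy a ltac:(lra) e He) as (d & Hd & H).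
    exists d; split; [easy|]. intros b Hb. apply H. lra.
  - intros a Ha. exists (op (A a) (V a s y)), (op (A a) (V a s y)).
    split; [apply HD; (easy || lra)|]. split.
    + apply evolution_right_derivative_diagonal; [lra|]. apply HY; (easy || lra).
    + replace (_ ⊖ _) with (𝟎 : X) by vec. rewrite norm_null. lra.
Qed.

(** One inclusion holds because the continuity space is a core, the other because
    generators are closed. *)
Lemma segment_generator_core s t x z : s <= t <= s + 1 ->
  generator (segment_semigroup s t) x z <->
  forall eps, 0 < eps -> exists y, Y y /\ ‖y ⊖ x‖ <= eps /\ ‖op_integral s t y ⊖ z‖ <= eps.
Proof.
  intros Hst. assert (W := segment_weyl s t Hst).
  pose proof (weyl_semigroup _ _ _ W) as S. split.
  - intros H eps He.
    apply (invariant_dense_core (segment_semigroup s t) Y (op_integral s t)); try easy.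
    + exact Y_zero.
    + exact Y_plus.
    + exact Y_scal.
    + intros r y Hr Hy. now apply (weyl_invariant _ _ _ _ _ W).
    + apply (weyl_generator _ _ _ W).
  - intros H. apply generator_closed; [easy|]. intros eps He.
    destruct (H eps He) as (y & Hy & H1 & H2). exists y, (op_integral s t y).
    split; [|easy]. now apply (weyl_generator _ _ _ W).
Qed.

Lemma evolution_is_evolution_system : is_evolution_system A Y evolution.
Proof.
  split; [|split; [|split]].
  - intros s t (Hs & Ht & Hst). unfold I01, Icc in *. simpl in *. apply evolution_linear. lra.
  - intros y s Hy Hs. split; [|split].
    + apply evolution_diagonal.
    + intros t Ht. unfold Icc in Ht.
      assert (HY : Y (evolution t s y)) by (apply evolution_invariant; (easy || lra)).
      split; [easy|apply HY].
    + exists (fun t => op (A t) (evolution t s y)). split.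
      * apply continuous_on_norm_iff. apply evolution_velocity_continuous; (easy || lra).
      * intros t Ht. split; [|reflexivity]. apply is_derive_within_norm_iff; [easy|].
        apply evolution_derivative; (easy || lra).
  - intros r s t x Hr Hs Ht Hrs Hst. unfold I01, Icc in *. apply evolution_cocycle; lra.
  - intros x. apply continuous_on_plane_norm_iff. intros s t (Hs & Ht & Hst) eps He.
    unfold I01, Icc in *. simpl in *.
    destruct (evolution_continuous s t x eps ltac:(lra) ltac:(lra) He) as (d & Hd & H).
    exists d. split; [easy|]. intros s' t' (Hs' & Ht' & Hst') Hss Htt.
    unfold I01, Icc in Hs', Ht'. simpl in *. apply H; lra.
Qed.

(** At [t = 1], where there is no initial value problem, by continuity. *)
Lemma evolution_system_diagonal (V : R -> R -> X -> X) t x :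
  is_evolution_system A Y V -> I01 t -> V t t x = x.
Proof.
  intros (HL & HS & _ & HC) Ht. unfold I01, Icc in Ht.
  assert (HD : forall s, 0 <= s <= 1 -> Delta01 (s, s)).
  { intros s Hs. unfold Delta01, I01, Icc. simpl. lra. }
  assert (Hlt : forall s z, 0 <= s < 1 -> V s s z = z).
  { intros s z Hs. revert z.
    apply (linear_eq_on_Y _ (fun z => z)); [apply HL, HD; lra|apply is_linear_id|].
    intros y Hy. apply (HS y s Hy Hs). }
  destruct (Rle_lt_or_eq_dec t 1 (proj2 Ht)) as [Hl| ->]; [apply Hlt; lra|].
  apply eq_of_norm_eps. intros eps He.
  pose proof (proj1 (continuous_on_plane_norm_iff _ _) (HC x)) as Hc.
  destruct (Hc 1 1 (HD 1 ltac:(lra)) eps He) as (d & Hd & H).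
  set (s := 1 - Rmin d 1 / 2).
  pose proof (Rmin_l d 1). pose proof (Rmin_r d 1).
  assert (0 < Rmin d 1) by (apply Rmin_glb_lt; lra).
  assert (Hs : Rabs (s - 1) < d).
  { unfold s. replace (1 - Rmin d 1 / 2 - 1) with (- (Rmin d 1 / 2)) by ring.
    rewrite Rabs_Ropp, Rabs_pos_eq; lra. }
  specialize (H s s (HD s ltac:(unfold s; lra)) Hs Hs). simpl in H.
  rewrite (Hlt s x) in H by (unfold s; lra). now rewrite norm_minus_sym.
Qed.

Lemma evolution_system_unique (V : R -> R -> X -> X) s t x :
  is_evolution_system A Y V -> Delta01 (s, t) -> V t s x = evolution t s x.
Proof.
  intros HV (Hs & Ht & Hst). unfold I01, Icc in Hs, Ht. simpl in Hs, Ht, Hst.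
  destruct (Rle_lt_or_eq_dec s t Hst) as [Hlt| <-].
  2:{ rewrite evolution_diagonal. now apply evolution_system_diagonal. }
  destruct HV as (HL & HS & HCo & HC).
  assert (HS' : forall y, Y y -> is_C1_solution A Y s y (fun t => V t s y)).
  { intros y Hy. apply HS; [easy|lra]. }
  apply evolution_unique; [| | | | |lra|lra].
  - intros a b Ha Hb. apply HL. unfold Delta01, I01, Icc. simpl. lra.
  - intros y Hy. apply (HS' y Hy).
  - intros y r Hy Hr. destruct (HS' y Hy) as (_ & H & _). now apply H.
  - intros y Hy r Hr eps He.
    pose proof (proj1 (continuous_on_plane_norm_iff _ _) (HC y)) as Hc.
    destruct (Hc s r ltac:(unfold Delta01, I01, Icc; simpl; lra) eps He) as (d & Hd & H).
    exists d. split; [easy|]. intros q Hq Hqr.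
    apply (H s q); [unfold Delta01, I01, Icc; simpl; lra| |easy].
    now rewrite Rminus_diag, Rabs_R0.
  - intros y r Hy Hr eps He. destruct (HS' y Hy) as (_ & _ & x' & _ & H).
    destruct (H r) as (H1 & H2); [unfold Icc; lra|]. rewrite <- H2.
    destruct (proj1 (is_derive_within_norm_iff (Icc s 1) (fun t => V t s y) r _
      ltac:(unfold Icc; lra)) H1 eps He) as (d & Hd & H3).
    exists (Rmin d (1 - r)). split; [apply Rmin_glb_lt; lra|]. intros h Hh.
    pose proof (Rmin_l d (1 - r)). pose proof (Rmin_r d (1 - r)).
    specialize (H3 (r + h)). replace (r + h - r) with h in H3 by ring.
    rewrite Rabs_pos_eq in H3 by lra. apply H3; [unfold Icc|]; lra.
Qed.

Lemma evolution_formula s t : s <= t <= s + 1 ->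
  exists (B : operator X) (T : R -> X -> X),
    is_closure B (Operator Y (op_integral s t)) /\ generates B T /\
    forall x, evolution t s x = Cexp (RtoC (/ 2) * double_integral mu s t) ⊙ T 1 x.
Proof.
  intros Hst. set (T := segment_semigroup s t).
  pose proof (weyl_semigroup _ _ _ (segment_weyl s t Hst)) as S. fold T in S.
  set (B := Operator (fun x => exists z, generator T x z)
    (fun x => epsilon (inhabits 𝟎) (fun z => generator T x z))).
  assert (HB : forall x z, graph B (x, z) <-> generator T x z).
  { intros x z. unfold graph, B. simpl. split.
    - intros (Hx & <-). now apply epsilon_spec.
    - intros H. assert (Hx : exists z, generator T x z) by now exists z.
      split; [easy|]. apply (generator_unique T x); [easy| |easy]. now apply epsilon_spec. }
  exists B, T. split; [|split].
  - intros (x & z). rewrite HB, adherent_pair_norm_iff. unfold T.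
    rewrite segment_generator_core by easy. split; intros H eps He.
    + destruct (H eps He) as (y & Hy & H1 & H2). exists y, (op_integral s t y). easy.
    + destruct (H eps He) as (y & z' & (Hy & Hz) & H1 & H2). simpl in Hy, Hz.
      exists y. now rewrite Hz.
  - split; [now apply semigroup_C0|]. intros x y. rewrite HB. symmetry.
    apply generator_filterlim.
  - reflexivity.
Qed.

End ScalarCommutators.

(** * Extension of the data from the unit interval to the line *)

(** Replacing [A t] by [A (clamp t)], and likewise for the other data, extends a
    family on the unit interval to the line without changing the continuity space,
    the stability constants or the continuity of the kernel.  Integrals and limits
    then need no restriction of the domain. *)
Definition clamp (t : R) : R := Rmax 0 (Rmin t 1).

Lemma clamp_I01 t : I01 (clamp t).
Proof.
  unfold I01, Icc, clamp. split; [apply Rmax_l|]. apply Rmax_lub; [lra|apply Rmin_r].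
Qed.

Lemma clamp_id t : I01 t -> clamp t = t.
Proof.
  intros Ht. unfold I01, Icc in Ht. unfold clamp.
  rewrite Rmin_left, Rmax_right; lra.
Qed.

Lemma clamp_mono s t : s <= t -> clamp s <= clamp t.
Proof.
  intros H. unfold clamp. apply Rmax_lub; [apply Rmax_l|].
  eapply Rle_trans; [|apply Rmax_r]. apply Rmin_glb; [|apply Rmin_r].
  eapply Rle_trans; [apply Rmin_l|easy].
Qed.

Lemma clamp_lipschitz s t : Rabs (clamp s - clamp t) <= Rabs (s - t).
Proof.
  assert (Main : forall s t, s <= t -> clamp t - clamp s <= t - s).
  { clear. intros s t H. unfold clamp, Rmax, Rmin.
    repeat destruct (Rle_dec _ _); lra. }
  destruct (Rle_lt_dec s t) as [H|H].
  - rewrite Rabs_minus_sym, (Rabs_minus_sym s t).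
    pose proof (clamp_mono s t H). specialize (Main s t H).
    rewrite !Rabs_pos_eq; lra.
  - pose proof (clamp_mono t s ltac:(lra)). specialize (Main t s ltac:(lra)).
    rewrite !Rabs_pos_eq; lra.
Qed.

Section ContinuousKernels.

Context (mu : R -> R -> C).
Context (mu_continuous_on : continuous_on (fun p : R * R => I01 (fst p) /\ I01 (snd p))
  (fun p => mu (fst p) (snd p))).

Lemma clamped_kernel_continuous a b eps : 0 < eps ->
  exists delta, 0 < delta /\ forall c d, Rabs (c - a) < delta -> Rabs (d - b) < delta ->
    Cmod (mu (clamp c) (clamp d) - mu (clamp a) (clamp b)) < eps.
Proof.
  intros He. set (z := mu (clamp a) (clamp b)).
  assert (Hl : locally (T := C_UniformSpace) z (fun w => Cmod (w - z) < eps)).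
  { apply (locally_le_locally_norm (V := C_R_NormedModule)).
    exists (mkposreal eps He). intros w Hw. rewrite Cmod_norm. exact Hw. }
  destruct (mu_continuous_on (clamp a, clamp b) (conj (clamp_I01 a) (clamp_I01 b)) _ Hl)
    as (d & Hd).
  exists d. split; [apply cond_pos|]. intros c e Hc He'.
  apply (Hd (clamp c, clamp e)); [|split; apply clamp_I01].
  split.
  - apply Rle_lt_trans with (Rabs (c - a)); [apply clamp_lipschitz|easy].
  - apply Rle_lt_trans with (Rabs (e - b)); [apply clamp_lipschitz|easy].
Qed.

Lemma clamped_kernel_uniform eps : 0 < eps ->
  exists delta, 0 < delta /\ forall a b c d, Rabs (a - c) <= delta -> Rabs (b - d) <= delta ->
    Cmod (mu (clamp a) (clamp b) - mu (clamp c) (clamp d)) <= eps.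
Proof.
  intros He.
  assert (H2 : forall p : C -> R, (forall w, Rabs (p w) <= Cmod w) ->
    (forall w z : C, p (w - z)%C = p w - p z) -> exists delta, 0 < delta /\
    forall a b c d, Rabs (a - c) <= delta -> Rabs (b - d) <= delta ->
      Rabs (p (mu (clamp a) (clamp b) - mu (clamp c) (clamp d))%C) <= eps / 2).
  { intros p Hp Hpm.
    destruct (uniform_continuity_2d (fun x y => p (mu (clamp x) (clamp y))) 0 1 0 1)
      with (eps := mkposreal (eps / 2) ltac:(lra)) as (delta & Hd).
    - intros x y _ _ e.
      destruct (clamped_kernel_continuous x y e (cond_pos e)) as (d & Hd & H).
      exists (mkposreal d Hd). intros u v Hu Hv. rewrite <- Hpm.
      eapply Rle_lt_trans; [apply Hp|]. now apply H.
    - pose proof (cond_pos delta). exists (delta / 2). split; [lra|].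
      intros a b c d Hac Hbd. rewrite Hpm. left.
      pose proof (clamp_lipschitz a c). pose proof (clamp_lipschitz b d).
      specialize (Hd (clamp c) (clamp d) (clamp a) (clamp b) (clamp_I01 _) (clamp_I01 _)
        (clamp_I01 _) (clamp_I01 _) ltac:(lra) ltac:(lra)).
      simpl in Hd. now rewrite !(clamp_id (clamp _)) in Hd by apply clamp_I01. }
  destruct (H2 Re) as (d1 & Hd1 & H3).
  { apply Cmod_Re. }
  { reflexivity. }
  destruct (H2 Im) as (d2 & Hd2 & H4).
  { intros w. unfold Im. eapply Rle_trans; [apply Rmax_r|apply Rmax_Cmod]. }
  { reflexivity. }
  exists (Rmin d1 d2). split; [now apply Rmin_glb_lt|]. intros a b c d Hac Hbd.
  pose proof (Rmin_l d1 d2). pose proof (Rmin_r d1 d2).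
  specialize (H3 a b c d ltac:(lra) ltac:(lra)).
  specialize (H4 a b c d ltac:(lra) ltac:(lra)).
  set (w := (mu (clamp a) (clamp b) - mu (clamp c) (clamp d))%C) in *.
  replace w with (RtoC (Re w) + Ci * RtoC (Im w))%C
    by (apply injective_projections; simpl; ring).
  eapply Rle_trans; [apply Cmod_triangle|].
  rewrite Cmod_mult, Cmod_Ci, !Cmod_R. lra.
Qed.

Lemma clamped_kernel_bounded :
  exists B, forall a b, Cmod (mu (clamp a) (clamp b)) <= B.
Proof.
  destruct (clamped_kernel_uniform 1 Rlt_0_1) as (delta & Hd & H).
  destruct (nfloor_ex (/ delta)) as (N & _ & HN).
  { left. now apply Rinv_0_lt_compat. }
  assert (Hsteps : (INR N + 1) * delta >= 1).
  { assert (/ delta * delta = 1) by (field; lra). nra. }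
  (* Move both arguments towards 0 in steps of length at most [delta]. *)
  assert (Main : forall n a b, 0 <= a <= INR n * delta -> 0 <= b <= INR n * delta ->
    Cmod (mu (clamp a) (clamp b)) <= Cmod (mu (clamp 0) (clamp 0)) + INR n).
  { induction n as [|n IH]; intros a b Ha Hb.
    - simpl in *. replace a with 0 by lra. replace b with 0 by lra. lra.
    - rewrite S_INR in *.
      set (c := Rmax 0 (a - delta)). set (d := Rmax 0 (b - delta)).
      pose proof (pos_INR n).
      assert (0 <= INR n * delta) by (apply Rmult_le_pos; lra).
      assert (Hc : 0 <= c <= INR n * delta).
      { split; [apply Rmax_l|]. apply Rmax_lub; lra. }
      assert (Hd' : 0 <= d <= INR n * delta).
      { split; [apply Rmax_l|]. apply Rmax_lub; lra. }
      specialize (IH c d Hc Hd').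
      assert (Hstep : Cmod (mu (clamp a) (clamp b) - mu (clamp c) (clamp d)) <= 1).
      { apply H; rewrite Rabs_pos_eq; unfold c, d, Rmax; destruct (Rle_dec _ _); lra. }
      replace (mu (clamp a) (clamp b)) with
        ((mu (clamp a) (clamp b) - mu (clamp c) (clamp d)) + mu (clamp c) (clamp d))%C
        by ring.
      eapply Rle_trans; [apply Cmod_triangle|]. lra. }
  exists (Cmod (mu (clamp 0) (clamp 0)) + INR (S N)). intros a b.
  rewrite <- (clamp_id (clamp a)), <- (clamp_id (clamp b)) by apply clamp_I01.
  pose proof (clamp_I01 a) as Ha. pose proof (clamp_I01 b) as Hb. unfold I01, Icc in Ha, Hb.
  apply Main; rewrite S_INR; lra.
Qed.

End ContinuousKernels.

Section Transfer.

Context {X : CompleteNormedModule C_AbsRing}.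
Implicit Types (x y z : X).

Lemma maximal_continuity_subspace_clamp (A : R -> operator X) y :
  maximal_continuity_subspace A y <-> continuity_space (fun t => A (clamp t)) y.
Proof.
  unfold maximal_continuity_subspace, continuity_space. rewrite continuous_on_norm_iff.
  split; intros (H1 & H2); split.
  - intros t. apply H1, clamp_I01.
  - intros t eps He. destruct (H2 (clamp t) (clamp_I01 t) eps He) as (d & Hd & H).
    exists d. split; [easy|]. intros s Hs. apply H; [apply clamp_I01|].
    pose proof (clamp_lipschitz s t). lra.
  - intros t Ht. rewrite <- (clamp_id t Ht). apply H1.
  - intros t Ht eps He. destruct (H2 t eps He) as (d & Hd & H).
    exists d. split; [easy|]. intros s Hs Hst. specialize (H s Hst).
    now rewrite !clamp_id in H.
Qed.

Lemma is_evolution_system_ext (A A' : R -> operator X) (Y Y' : X -> Prop) U :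
  (forall t, I01 t -> A t = A' t) -> (forall y, Y y <-> Y' y) ->
  is_evolution_system A Y U -> is_evolution_system A' Y' U.
Proof.
  intros HA HY (H1 & H2 & H3 & H4). split; [easy|split; [|easy]].
  intros y s Hy Hs. destruct (H2 y s (proj2 (HY y) Hy) Hs) as (E1 & E2 & x' & E3 & E4).
  assert (HI : forall t, Icc s 1 t -> I01 t) by (unfold I01, Icc; intros; lra).
  split; [easy|split].
  - intros t Ht. rewrite <- HA by now apply HI. destruct (E2 t Ht). split; [|easy].
    now apply HY.
  - exists x'. split; [easy|]. intros t Ht. rewrite <- HA by now apply HI. now apply E4.
Qed.

Lemma semigroup_prod_clamp (E : R -> R -> X -> X) t s n x :
  semigroup_prod (fun r => E (clamp r)) t s n x =
  semigroup_prod E (fun i => clamp (t i)) s n x.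
Proof. induction n as [|n IH]; simpl; [easy|now rewrite IH]. Qed.

Lemma stable_locally_bounded (M omega : R) (E : R -> R -> X -> X) t p :
  0 <= M -> stable M omega E -> I01 t -> bounded_upto (E t) p (M * exp (Rabs omega * p)).
Proof.
  intros HM HE Ht. split; [apply Rmult_le_pos; [easy|left; apply exp_pos]|].
  intros s x Hs.
  pose proof (HE O (fun _ => t) (fun _ => s)) as H. simpl in H.
  eapply Rle_trans; [apply H; intros i Hi; [now split|lia]|].
  apply Rmult_le_compat_r; [apply norm_pos|]. apply Rmult_le_compat_l; [easy|].
  apply exp_mono. pose proof (Rle_abs omega). pose proof (Rabs_pos omega). nra.
Qed.

End Transfer.

Theorem theorem2p1 :
  forall (X : CompleteNormedModule C_AbsRing)
         (A : R -> operator X) (E : R -> R -> X -> X)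
         (M omega : R) (mu : R -> R -> C),
    (forall t, I01 t -> generates (A t) (E t)) ->
    1 <= M ->
    stable M omega E ->
    (forall s t tau, I01 s -> I01 t -> 0 <= tau ->
       extends
         (op_comp (A s) (everywhere (E t tau)))
         (op_comp (everywhere (E t tau))
            (op_plus (A s)
               (everywhere (fun x => scal (Cmult (mu s t) (RtoC tau) : C_AbsRing) x))))) ->
    is_dense (maximal_continuity_subspace A) ->
    continuous_on (fun p : R * R => I01 (fst p) /\ I01 (snd p))
      (fun p => mu (fst p) (snd p)) ->
    exists U : R -> R -> X -> X,
      is_evolution_system A (maximal_continuity_subspace A) U /\
      (forall V : R -> R -> X -> X,
         is_evolution_system A (maximal_continuity_subspace A) V ->
         forall s t x, Delta01 (s, t) -> V t s x = U t s x) /\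
      (forall s t, Delta01 (s, t) ->
         exists (B : operator X) (T : R -> X -> X),
           is_closure B (integral_op A s t) /\
           generates B T /\
           forall x,
             U t s x =
             scal (Cexp (Cmult (RtoC (/ 2)) (double_integral mu s t))
                     : C_AbsRing) (T 1 x)).
Proof.
  intros X A E M omega mu Hgen HM Hstab Hcomm Hdense Hmu.
  set (A' := fun t => A (clamp t)). set (E' := fun t => E (clamp t)).
  set (mu' := fun s t => mu (clamp s) (clamp t)).
  assert (HM0 : 0 <= M) by lra.
  assert (hE : forall t, semigroup (E' t)).
  { intros t. apply C0_semigroup; [apply (Hgen _ (clamp_I01 t))|].
    intros p. eexists. exact (stable_locally_bounded M omega E _ p HM0 Hstab (clamp_I01 t)). }
  assert (hA : forall t x y, graph (A' t) (x, y) <-> generator (E' t) x y).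
  { intros t x y. rewrite <- generator_filterlim. apply (Hgen _ (clamp_I01 t)). }
  assert (hC : forall s t tau x, 0 <= tau -> dom (A' s) x ->
    dom (A' s) (E' t tau x) /\
    op (A' s) (E' t tau x) = E' t tau (op (A' s) x ⊕ (mu' s t * tau)%C ⊙ x)).
  { intros s t tau x Htau Hx.
    destruct (Hcomm _ _ tau (clamp_I01 s) (clamp_I01 t) Htau x) as (H1 & H2).
    - split; [split; [exact Hx|exact I]|exact I].
    - split; [apply H1|exact H2]. }
  assert (hY : forall y, continuity_space A' y <-> maximal_continuity_subspace A y).
  { intros y. symmetry. apply maximal_continuity_subspace_clamp. }
  assert (hD : forall x eps, 0 < eps -> exists y, continuity_space A' y /\ ‖y ⊖ x‖ <= eps).
  { intros x eps He. destruct (proj1 (adherent_norm_iff _ x) (Hdense x) eps He) as (y & Hy & H).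
    exists y. split; [now apply hY|easy]. }
  pose proof (clamped_kernel_uniform mu Hmu) as hmu.
  destruct (clamped_kernel_bounded mu Hmu) as (Cmu & hB).
  assert (hS : forall (n : nat) (t s : nat -> R),
    (forall i, (i <= n)%nat -> 0 <= s i) -> (forall i, (i < n)%nat -> t i <= t (S i)) ->
    forall x, ‖semigroup_prod E' t s n x‖ <= M * exp (omega * sum_f_R0 s n) * ‖x‖).
  { intros n t s Hs Ht x. unfold E'. rewrite semigroup_prod_clamp. apply Hstab.
    - intros i Hi. split; [apply clamp_I01|now apply Hs].
    - intros i Hi. now apply clamp_mono, Ht. }
  assert (HAA : forall t, I01 t -> A' t = A t).
  { intros t Ht. unfold A'. now rewrite clamp_id. }
  set (U := evolution A' mu' M omega Cmu).
  exists U. split; [|split].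
  - apply (is_evolution_system_ext A' A (continuity_space A')); [easy..|].
    exact (evolution_is_evolution_system A' E' mu' hE hA hC hD hmu M omega Cmu HM0 hB hS).
  - intros V HV s t x Hst.
    apply (evolution_system_unique A' E' mu' hE hA hC hD hmu M omega Cmu HM0 hB hS); [|easy].
    apply (is_evolution_system_ext A A' (maximal_continuity_subspace A)).
    + intros r Hr. symmetry. now apply HAA.
    + intros y. exact (iff_sym (hY y)).
    + exact HV.
  - intros s t (Hs & Ht & Hst). simpl in Hs, Ht, Hst.
    assert (HI : forall r, Rmin s t < r < Rmax s t -> I01 r).
    { intros r Hr. rewrite Rmin_left, Rmax_right in Hr by easy.
      unfold I01, Icc in *. lra. }
    destruct (evolution_formula A' E' mu' hE hA hC hD hmu M omega Cmu HM0 hB hS s t)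
      as (B & T & HB & HT & HU).
    { unfold I01, Icc in *. lra. }
    exists B, T. split; [|split; [easy|]].
    + assert (Hint : forall y, op_integral A' s t y = op (integral_op A s t) y).
      { intros y. apply (RInt_ext (V := real_of X)). intros r Hr.
        now rewrite HAA by now apply HI. }
      unfold is_closure in HB. intros (x & z). rewrite (HB (x, z)), !adherent_pair_norm_iff.
      split; intros H eps He; destruct (H eps He) as (y & w & (Hy & Hw) & H1 & H2);
        exists y, w; (split; [|easy]); simpl in Hy, Hw; split.
      * now apply hY.
      * rewrite <- Hw. symmetry. apply Hint.
      * now apply hY.
      * rewrite <- Hw. apply Hint.
    + intros x. unfold U. rewrite (HU x).
      replace (double_integral mu s t) with (double_integral mu' s t); [reflexivity|].
      apply (RInt_ext (V := C_R_CompleteNormedModule)). intros r Hr.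
      apply (RInt_ext (V := C_R_CompleteNormedModule)). intros q Hq.
      assert (Hsr : s <= r <= t) by (rewrite Rmin_left, Rmax_right in Hr; lra).
      rewrite Rmin_left, Rmax_right in Hq by lra.
      unfold mu'. unfold I01, Icc in *. rewrite !clamp_id; unfold I01, Icc; (easy || lra).
Qed.
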